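(* Let $\alpha\ge0$, $\gamma>0$, $0\le\xi\le1$, and let $\nu\ge\mu\ge1$ satisfy $\mu+\nu=\alpha-\gamma$ and $\mu\nu=\gamma$. Let $c$ be a real number with $$-1<c\le\min\left\{1+\frac1\mu-\frac1\nu,\ \frac{1+\frac1\mu-\xi}{1+2\xi}\right\},$$ and let $\beta<1$ satisfy $$\frac{\beta}{1-\beta}=-(1+c)\int_0^1t^c\big[(1-\xi)g(t)+\xi(2q(t)-1)\big]dt .$$ If $f\in W_\beta(\alpha,\gamma)$, then the function $$V_\lambda(f)(z)=(1+c)\int_0^1t^{c-1}f(tz)\,dt$$ belongs to $M(\xi)$.
   Context: $\mathbb{D}=\{z\in\mathbb{C}:|z|<1\}$. $\mathcal{A}$ is the class of analytic functions $f$ in $\mathbb{D}$ with $f(0)=f'(0)-1=0$. For $0\le\xi\le1$, the Pascu class $M(\xi)$ consists of the $f\in\mathcal{A}$ with $\mathrm{Re}\,\dfrac{\xi z(zf'(z))'+(1-\xi)zf'(z)}{\xi zf'(z)+(1-\xi)f(z)}>0$ in $\mathbb{D}$, i.e. $\xi zf'+(1-\xi)f$ is starlike with respect to the origin. For $\alpha\ge0,\gamma\ge0,\beta<1$, $W_\beta(\alpha,\gamma)$ is the class of $f\in\mathcal{A}$ for which there is $\phi\in\mathbb{R}$ with $\mathrm{Re}\left(e^{i\phi}\left((1-\alpha+2\gamma)\frac{f(z)}{z}+(\alpha-2\gamma)f'(z)+\gamma zf''(z)-\beta\right)\right)>0$ for all $z\in\mathbb{D}$. The operator here is $V_\lambda(f)(z)=\int_0^1\lambda(t)\frac{f(tz)}{t}\,dt$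 with $\lambda(t)=(1+c)t^c$. $g$ is the solution of $\frac{d}{dt}\left[t^{1/\nu}(1+g(t))\right]=\frac{2}{\mu\nu}t^{1/\nu-1}\int_0^1\frac{s^{1/\mu-1}}{(1+st)^2}\,ds$ with $g(0)=1$, with series $g(t)=2\sum_{n=0}^\infty\frac{(n+1)(-1)^nt^n}{(1+\mu n)(1+\nu n)}-1$; $q$ is the solution of $\frac{d}{dt}\left[t^{1/\nu}q(t)\right]=\frac{1}{\mu\nu}t^{1/\nu-1}\int_0^1 s^{1/\mu-1}\frac{1-st}{(1+st)^3}\,ds$ with $q(0)=1$, with series $q(t)=\sum_{n=0}^\infty\frac{(n+1)^2(-1)^nt^n}{(1+\mu n)(1+\nu n)}$. *)

(* Defs.v *)
From Stdlib Require Import Reals.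
From Coquelicot Require Import Coquelicot.

Open Scope R_scope.

(* Improper at both ends: powers [t^a] with [-1 < a < 0] are integrated
   below, and the integrands need only be given for [0 < t < 1]. *)
Definition int01 {V : CompleteNormedModule R_AbsRing} (h : R -> V) : V :=
  RInt_gen h (at_right 0) (at_left 1).

Definition in_disk (z : C) : Prop := Cmod z < 1.

Definition Cexpi (phi : R) : C := (cos phi, sin phi).

(* The class [A]: analytic (i.e. complex differentiable at every point of the
   unit disk) and normalized.  Only the values of [f] on the disk matter. *)
Definition class_A (f : C -> C) : Prop :=
  (forall z : C, in_disk z -> @ex_derive C_AbsRing C_NormedModule f z) /\
  f 0 = RtoC 0 /\ C_derive f 0 = RtoC 1.

(* [f z / z], with its removable singularity at the origin filled in
   (for [f 0 = 0]). *)
Definition div_id (f : C -> C) (z : C) : C :=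
  if Ceq_dec z 0 then C_derive f 0 else (f z / z)%C.

Definition class_W (beta alpha gamma : R) (f : C -> C) : Prop :=
  class_A f /\
  exists phi : R, forall z : C, in_disk z ->
    0 < Re (Cexpi phi *
            (RtoC (1 - alpha + 2 * gamma) * div_id f z
             + RtoC (alpha - 2 * gamma) * C_derive f z
             + RtoC gamma * z * C_derive (C_derive f) z
             - RtoC beta))%C.

Definition pascu_num (xi : R) (f : C -> C) (z : C) : C :=
  (RtoC xi * z * C_derive (fun w => w * C_derive f w) z
   + RtoC (1 - xi) * z * C_derive f z)%C.

Definition pascu_den (xi : R) (f : C -> C) (z : C) : C :=
  (RtoC xi * z * C_derive f z + RtoC (1 - xi) * f z)%C.

(* At the origin the quotient is [0 / 0]; for [f] in the class [A] this is a
   removable singularity with value 1, so the condition there is void. *)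
Definition class_M (xi : R) (f : C -> C) : Prop :=
  class_A f /\
  forall z : C, in_disk z -> z <> RtoC 0 ->
    pascu_den xi f z <> RtoC 0 /\
    0 < Re (pascu_num xi f z / pascu_den xi f z)%C.

(* The differential equation is singular at [0], so the initial value is
   attained in the limit. *)
Definition is_g (mu nu : R) (g : R -> R) : Prop :=
  g 0 = 1 /\ filterlim g (at_right 0) (locally (g 0)) /\
  forall t : R, 0 < t < 1 ->
    is_derive (fun u => Rpower u (1 / nu) * (1 + g u)) t
      (2 / (mu * nu) * Rpower t (1 / nu - 1)
       * int01 (fun s => Rpower s (1 / mu - 1) / (1 + s * t) ^ 2)).

Definition is_q (mu nu : R) (q : R -> R) : Prop :=
  q 0 = 1 /\ filterlim q (at_right 0) (locally (q 0)) /\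
  forall t : R, 0 < t < 1 ->
    is_derive (fun u => Rpower u (1 / nu) * q u) t
      (1 / (mu * nu) * Rpower t (1 / nu - 1)
       * int01 (fun s => Rpower s (1 / mu - 1)
                         * ((1 - s * t) / (1 + s * t) ^ 3))).

(* [V_lambda] for [lambda t = (1 + c) t^c]. *)
Definition V_op (c : R) (f : C -> C) (z : C) : C :=
  (RtoC (1 + c) *
   int01 (V := C_R_CompleteNormedModule)
     (fun t : R => RtoC (Rpower t (c - 1)) * f (RtoC t * z)))%C.

(* Main.v *)
Require Import Defs.
From Stdlib Require Import Reals Lra Lia Psatz.
From Coquelicot Require Import Coquelicot.

Open Scope R_scope.

(** Write [f z = sum a_n z^n] and [P_m = (1 + mu m)(1 + nu m) a_(m+1)].  Since
    [mu + nu = alpha - gamma] and [mu nu = gamma], membership of [f] in the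
    class [W] says that [P - beta] maps the disk into a half plane, while for
    [F = V_op c f] the numerator and denominator of the Pascu quotient are [z]
    times [N = sum (m+1) b_m P_m z^m] and [D = sum b_m P_m z^m], where
    [b_m = (1+c)(1+xi m) / ((1+c+m)(1+mu m)(1+nu m))] ([weight]).

    The quotient [N / D] has positive real part as soon as all the combinations
    [(1+w)/2 N + (1-w)/2 D], [|w| = 1], lie in one open half plane bounded by a
    line through 0 ([half_plane_ratio]).  Such a combination is the convolution of [P] with
    [h = sum b_m (1 + (1+w)/2 m) z^m], and a convolution is a mean of the values
    of [P - beta] against the kernel [2 Re h - 2 kappa] on a circle; it stays
    in the half plane if the kernel is nonnegative and the constant terms match
    ([convolution_half_plane]).  The integral condition on [beta] says exactly
    that they match when [kappa] is the limit of [sum b_m (m+1) (-x)^m] as [x]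
    tends to 1 ([int01_gq]).

    It remains to prove that [Re h z >= sum b_m (m+1) (-|z|)^m >= kappa]
    ([Re_weighted_ge_koebe], [koebe_decr]).  These inequalities are linear in
    the weights and stable under averages over dilations [z -> s z], that is,
    under multiplication of [b_m] by the moments [A + B / (m + a)] of a positive
    measure.  The bounds on [c] allow one to reach [b_m] in this way from
    [1 / ((m+1)(m+2))] ([weight_nonneg]), and for these weights an integration
    by parts makes the integrand nonnegative ([excess_base]).

    Complex differentiability in the disk is all that is known of [f], so the
    Taylor expansion is proved first ([taylor]): Goursat's theorem on
    rectangles, pulled to annuli by the exponential map, makes circle means
    independent of the radius. *)

(** * Sequences of subexponential growth *)

(** Coefficient sequences whose power series converge in the unit disk.
    Boundedness of [u n * r^n] for every [r < 1] is used rather than a radius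
    of convergence because it passes, by plain domination, to coefficients
    multiplied by a polynomial in [n]. *)
Definition tame (u : nat -> R) : Prop :=
  forall r, 0 <= r < 1 -> exists M, forall n, Rabs (u n) * r ^ n <= M.

(** Each of the first [n + 1] terms of the geometric series is at least
    [q ^ n]. *)
Lemma sum_pow_le (q : R) (n : nat) :
  0 <= q < 1 -> INR (S n) * q ^ n <= / (1 - q).
Proof.
  intros Hq.
  assert (H : INR (S n) * q ^ n <= sum_f_R0 (fun k => q ^ k) n).
  { induction n as [|n IH].
    - simpl; lra.
    - rewrite tech5.
      rewrite (S_INR (S n)).
      assert (Hp : 0 <= q ^ n) by (apply pow_le; lra).
      simpl (q ^ S n) in *.
      assert (0 <= INR (S n)) by apply pos_INR.
      assert (INR (S n) * (q * q ^ n) <= INR (S n) * q ^ n).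
      { apply Rmult_le_compat_l; [easy|]. nra. }
      nra. }
  apply Rle_trans with (1 := H).
  rewrite tech3 by lra.
  unfold Rdiv. rewrite <- (Rmult_1_l (/ (1 - q))) at 2.
  apply Rmult_le_compat_r.
  - left; apply Rinv_0_lt_compat; lra.
  - assert (0 <= q ^ S n) by (apply pow_le; lra). lra.
Qed.

Lemma ratio_lt_1 (r s : R) : 0 <= r < s -> 0 <= r / s < 1.
Proof.
  intros H. split; [apply Rdiv_le_0_compat; lra|]. apply Rlt_div_l; lra.
Qed.

Lemma tame_dom (u v : nat -> R) (K : R) :
  tame u -> (forall n, Rabs (v n) <= K * INR (S n) * Rabs (u n)) -> tame v.
Proof.
  intros Hu Hv r Hr.
  set (s := (1 + r) / 2).
  assert (Hs : 0 <= r < s) by (unfold s; lra). assert (Hs1 : s < 1) by (unfold s; lra).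
  assert (Hrs := ratio_lt_1 r s Hs).
  destruct (Hu s) as [M HM]; [lra|].
  exists (Rabs K * (/ (1 - r / s) * M)).
  intros n.
  replace (r ^ n) with ((r / s) ^ n * s ^ n).
  2:{ rewrite <- Rpow_mult_distr. f_equal. field. lra. }
  assert (Hp1 : 0 <= (r / s) ^ n) by (apply pow_le; lra).
  assert (Hp2 : 0 <= s ^ n) by (apply pow_le; lra).
  assert (Hq := sum_pow_le (r / s) n Hrs).
  assert (HS : 0 <= INR (S n)) by apply pos_INR.
  apply Rle_trans with ((Rabs K * INR (S n) * Rabs (u n)) * ((r / s) ^ n * s ^ n)).
  { apply Rmult_le_compat_r; [nra|].
    apply Rle_trans with (1 := Hv n).
    apply Rmult_le_compat_r; [apply Rabs_pos|].
    apply Rmult_le_compat_r; [easy|apply Rle_abs]. }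
  replace (Rabs K * INR (S n) * Rabs (u n) * ((r / s) ^ n * s ^ n))
    with (Rabs K * ((INR (S n) * (r / s) ^ n) * (Rabs (u n) * s ^ n))) by ring.
  apply Rmult_le_compat_l; [apply Rabs_pos|].
  apply Rmult_le_compat; auto.
  - apply Rmult_le_pos; auto.
  - apply Rmult_le_pos; auto using Rabs_pos.
Qed.

Lemma tame_ext (u v : nat -> R) : (forall n, v n = u n) -> tame u -> tame v.
Proof.
  intros H Hu r Hr. destruct (Hu r Hr) as [M HM]. exists M.
  intros n. rewrite H. auto.
Qed.

Lemma tame_le (u v : nat -> R) :
  tame u -> (forall n, Rabs (v n) <= Rabs (u n)) -> tame v.
Proof.
  intros Hu H r Hr. destruct (Hu r Hr) as [M HM]. exists M.
  intros n. apply Rle_trans with (2 := HM n).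
  apply Rmult_le_compat_r; [apply pow_le; lra|auto].
Qed.

Lemma tame_1 : tame (fun _ => 1).
Proof.
  intros r Hr. exists 1. intros n. rewrite Rabs_R1, Rmult_1_l.
  rewrite <- (pow1 n). apply pow_incr; lra.
Qed.

Lemma tame_plus (u v : nat -> R) :
  tame u -> tame v -> tame (fun n => u n + v n).
Proof.
  intros Hu Hv r Hr.
  destruct (Hu r Hr) as [M HM]. destruct (Hv r Hr) as [N HN].
  exists (M + N). intros n.
  assert (0 <= r ^ n) by (apply pow_le; lra).
  specialize (HM n); specialize (HN n).
  assert (H1 := Rabs_triang (u n) (v n)). nra.
Qed.

Lemma tame_shift (u : nat -> R) : tame u -> tame (fun n => u (S n)).
Proof.
  intros Hu r Hr.
  destruct (Rle_lt_dec r 0) as [H0|H0].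
  - exists (Rabs (u 1%nat)). intros [|n].
    + simpl; lra.
    + replace r with 0 by lra. simpl. assert (H := Rabs_pos (u 1%nat)). lra.
  - destruct (Hu r Hr) as [M HM]. exists (M / r). intros n.
    apply Rmult_le_reg_r with r; [lra|].
    unfold Rdiv. rewrite (Rmult_assoc M), Rinv_l by lra.
    specialize (HM (S n)). simpl in HM. lra.
Qed.

Lemma tame_unshift (u : nat -> R) : tame (fun n => u (S n)) -> tame u.
Proof.
  intros Hu r Hr.
  destruct (Hu r Hr) as [M HM]. exists (Rabs (u 0%nat) + Rabs M).
  assert (H0 := Rabs_pos (u 0%nat)). assert (H1 := Rle_abs M).
  assert (H2 := Rabs_pos M).
  intros [|n].
  - simpl. lra.
  - specialize (HM n). simpl.
    assert (0 <= Rabs (u (S n)) * r ^ n).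
    { apply Rmult_le_pos; [apply Rabs_pos|apply pow_le; lra]. }
    nra.
Qed.

Lemma tame_ex_series (u : nat -> R) (r : R) :
  tame u -> 0 <= r < 1 -> ex_series (fun n => Rabs (u n) * r ^ n).
Proof.
  intros Hu Hr.
  set (s := (1 + r) / 2).
  assert (Hs : 0 <= r < s) by (unfold s; lra). assert (Hs1 : s < 1) by (unfold s; lra).
  assert (Hrs := ratio_lt_1 r s Hs).
  destruct (Hu s) as [M HM]; [lra|].
  apply (@ex_series_le R_AbsRing R_CompleteNormedModule)
    with (fun n => M * (r / s) ^ n).
  - intros n. change (norm (Rabs (u n) * r ^ n)) with (Rabs (Rabs (u n) * r ^ n)).
    rewrite Rabs_pos_eq.
    2:{ apply Rmult_le_pos; [apply Rabs_pos|apply pow_le; lra]. }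
    replace (r ^ n) with (s ^ n * (r / s) ^ n).
    2:{ rewrite <- Rpow_mult_distr. f_equal. field. lra. }
    rewrite <- Rmult_assoc. apply Rmult_le_compat_r; [apply pow_le; lra|auto].
  - apply (@ex_series_scal_l R_AbsRing). apply ex_series_geom. rewrite Rabs_pos_eq; lra.
Qed.

Lemma tame_CV_radius (u : nat -> R) (x : R) :
  tame u -> Rabs x < 1 -> Rbar_lt (Rabs x) (CV_radius u).
Proof.
  intros Hu Hx.
  set (s := (1 + Rabs x) / 2).
  assert (H0 := Rabs_pos x).
  assert (Hs : Rabs x < s < 1) by (unfold s; lra).
  apply Rbar_lt_le_trans with s; [simpl; lra|].
  apply (proj1 (CV_radius_bounded u)).
  destruct (Hu s) as [M HM]; [lra|]. exists M. intros n.
  rewrite Rabs_mult, <- RPow_abs, (Rabs_pos_eq s) by lra. apply HM.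
Qed.

(** * Absolutely convergent complex series *)

Definition Csum (u : nat -> C) : C :=
  (Series (fun n => fst (u n)), Series (fun n => snd (u n))).

Definition Cabs_summable (u : nat -> C) : Prop := ex_series (fun n => Cmod (u n)).

Lemma fst_le_Cmod (z : C) : Rabs (fst z) <= Cmod z.
Proof. apply Rle_trans with (2 := Rmax_Cmod z). apply Rmax_l. Qed.

Lemma snd_le_Cmod (z : C) : Rabs (snd z) <= Cmod z.
Proof. apply Rle_trans with (2 := Rmax_Cmod z). apply Rmax_r. Qed.

Lemma ex_series_fst (u : nat -> C) :
  Cabs_summable u -> ex_series (fun n => fst (u n)).
Proof.
  intros H. apply (@ex_series_le R_AbsRing R_CompleteNormedModule)
    with (2 := H). intros n. apply fst_le_Cmod.
Qed.

Lemma ex_series_snd (u : nat -> C) :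
  Cabs_summable u -> ex_series (fun n => snd (u n)).
Proof.
  intros H. apply (@ex_series_le R_AbsRing R_CompleteNormedModule)
    with (2 := H). intros n. apply snd_le_Cmod.
Qed.

Lemma Cabs_summable_le (u : nat -> C) (v : nat -> R) :
  (forall n, Cmod (u n) <= v n) -> ex_series v -> Cabs_summable u.
Proof.
  intros H Hv. apply (@ex_series_le R_AbsRing R_CompleteNormedModule)
    with (2 := Hv). intros n.
  change (norm (Cmod (u n))) with (Rabs (Cmod (u n))).
  rewrite Rabs_pos_eq by apply Cmod_ge_0. apply H.
Qed.

Lemma Cabs_summable_ext (u v : nat -> C) :
  (forall n, u n = v n) -> Cabs_summable u -> Cabs_summable v.
Proof.
  intros H. apply ex_series_ext. intros n. now rewrite H.
Qed.

Lemma Cabs_summable_plus (u v : nat -> C) :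
  Cabs_summable u -> Cabs_summable v -> Cabs_summable (fun n => u n + v n)%C.
Proof.
  intros Hu Hv. apply Cabs_summable_le with (fun n => Cmod (u n) + Cmod (v n)).
  - intros n. apply Cmod_triangle.
  - apply (@ex_series_plus R_AbsRing R_NormedModule _ _ Hu Hv).
Qed.

Lemma Cabs_summable_scal (k : C) (u : nat -> C) :
  Cabs_summable u -> Cabs_summable (fun n => k * u n)%C.
Proof.
  intros Hu. apply Cabs_summable_le with (fun n => Cmod k * Cmod (u n)).
  - intros n. rewrite Cmod_mult. lra.
  - apply (@ex_series_scal_l R_AbsRing). exact Hu.
Qed.

Lemma Csum_ext (u v : nat -> C) : (forall n, u n = v n) -> Csum u = Csum v.
Proof.
  intros H. unfold Csum. f_equal; apply Series_ext; intros n; now rewrite H.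
Qed.

Lemma Csum_plus (u v : nat -> C) :
  Cabs_summable u -> Cabs_summable v ->
  Csum (fun n => u n + v n)%C = (Csum u + Csum v)%C.
Proof.
  intros Hu Hv. unfold Csum, Cplus; simpl. f_equal.
  - now apply Series_plus; apply ex_series_fst.
  - now apply Series_plus; apply ex_series_snd.
Qed.

Lemma Csum_scal (k : C) (u : nat -> C) :
  Cabs_summable u -> Csum (fun n => k * u n)%C = (k * Csum u)%C.
Proof.
  intros Hu. unfold Csum, Cmult; simpl.
  assert (H1 := ex_series_fst u Hu). assert (H2 := ex_series_snd u Hu).
  f_equal.
  - rewrite Series_minus; [|now apply (@ex_series_scal_l R_AbsRing)..].
    now rewrite !Series_scal_l.
  - rewrite Series_plus; [|now apply (@ex_series_scal_l R_AbsRing)..].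
    now rewrite !Series_scal_l.
Qed.

Lemma Csum_conj (u : nat -> C) :
  Csum (fun n => Cconj (u n)) = Cconj (Csum u).
Proof.
  unfold Csum, Cconj; simpl. f_equal. apply Series_opp.
Qed.

Lemma Cabs_summable_S (u : nat -> C) :
  Cabs_summable u <-> Cabs_summable (fun n => u (S n)).
Proof. apply (@ex_series_incr_1 R_AbsRing R_NormedModule (fun n => Cmod (u n))). Qed.

Lemma Csum_S (u : nat -> C) :
  Cabs_summable u -> Csum u = (u 0%nat + Csum (fun n => u (S n)))%C.
Proof.
  intros Hu. unfold Csum, Cplus; simpl. f_equal.
  - now apply Series_incr_1, ex_series_fst.
  - now apply Series_incr_1, ex_series_snd.
Qed.

Lemma ex_series_0 : ex_series (fun _ : nat => 0).
Proof.
  apply ex_series_ext with (fun n => 0 * (1 / 2) ^ n); [intros n; apply Rmult_0_l|].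
  apply (@ex_series_scal_l R_AbsRing). apply ex_series_geom. rewrite Rabs_pos_eq; lra.
Qed.

Lemma Series_nonneg (v : nat -> R) :
  (forall n, 0 <= v n) -> ex_series v -> 0 <= Series v.
Proof.
  intros H Hv. rewrite <- (Rmult_0_l (Series v)), <- Series_scal_l.
  apply Series_le with (2 := Hv). intros n. specialize (H n). lra.
Qed.

Lemma RtoC_neq_0 (x : R) : x <> 0 -> RtoC x <> RtoC 0.
Proof. intros H E. apply H. now apply RtoC_inj. Qed.

Lemma polar (z : C) : exists e, Cmod e = 1 /\ z = (RtoC (Cmod z) * e)%C.
Proof.
  destruct (Ceq_dec z 0) as [E|E].
  - exists (RtoC 1). rewrite Cmod_1, E, Cmod_0. split; [easy|ring].
  - assert (H : 0 < Cmod z) by now apply Cmod_gt_0.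
    assert (H' : RtoC (Cmod z) <> RtoC 0) by (apply RtoC_neq_0; lra).
    exists (z / RtoC (Cmod z))%C. split.
    + rewrite Cmod_div, Cmod_R, Rabs_pos_eq by (easy || lra). field. lra.
    + now field.
Qed.

Lemma Cmod_unit (z : C) : exists k, Cmod k = 1 /\ (k * z)%C = RtoC (Cmod z).
Proof.
  destruct (polar z) as [e [He E]].
  exists (Cconj e). split; [now rewrite Cmod_conj|].
  transitivity (Cconj e * (RtoC (Cmod z) * e))%C; [now rewrite <- E|].
  transitivity (RtoC (Cmod z) * (e * Cconj e))%C; [ring|].
  rewrite <- Cmod2_conj, He. replace (1 ^ 2) with 1 by ring. ring.
Qed.

(** Multiplying by the unimodular [k] that makes the sum real and nonnegative
    reduces the triangle inequality to the one for real series. *)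
Lemma Cmod_Csum_le (u : nat -> C) (v : nat -> R) :
  (forall n, Cmod (u n) <= v n) -> ex_series v -> Cmod (Csum u) <= Series v.
Proof.
  intros H Hv.
  assert (Hu : Cabs_summable u) by now apply Cabs_summable_le with v.
  destruct (Cmod_unit (Csum u)) as [k [Hk Hs]].
  rewrite <- (Csum_scal k u Hu) in Hs.
  apply (f_equal fst) in Hs. simpl in Hs. rewrite <- Hs.
  assert (Hle : forall n, Rabs (fst (k * u n)%C) <= v n).
  { intros n. apply Rle_trans with (1 := fst_le_Cmod _).
    rewrite Cmod_mult, Hk, Rmult_1_l. apply H. }
  apply Rle_trans with (1 := Rle_abs _).
  apply Rle_trans with (Series (fun n => Rabs (fst (k * u n)%C))).
  - apply Series_Rabs.
    apply (@ex_series_le R_AbsRing R_CompleteNormedModule) with (2 := Hv).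
    intros n. change (norm ?x) with (Rabs x). rewrite Rabs_Rabsolu. apply Hle.
  - apply Series_le with (2 := Hv). intros n. split; [apply Rabs_pos|apply Hle].
Qed.

(** * Complex derivatives and complex power series *)

(** This form hides the filters and the two uniform structures of the
    plane. *)
Lemma C_is_derive_iff (F : C -> C) (z l : C) :
  @is_derive C_AbsRing C_NormedModule F z l <->
  forall eps, 0 < eps -> exists delta, 0 < delta /\
    forall h, Cmod h < delta ->
      Cmod (F (z + h) - F z - h * l)%C <= eps * Cmod h.
Proof.
  split.
  - intros [_ H] eps Heps.
    specialize (H z (fun P HP => HP) (mkposreal eps Heps)).
    destruct H as [delta Hd]. exists delta. split; [apply cond_pos|].
    intros h Hh.
    specialize (Hd (z + h)%C).
    assert (Hb : ball (M := AbsRing_NormedModule C_AbsRing) z delta (z + h)%C).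
    { change (Cmod (z + h + - z)%C < delta).
      replace (z + h + - z)%C with h by ring. exact Hh. }
    specialize (Hd Hb).
    change (Cmod (F (z + h) + - F z + - ((z + h + - z) * l))%C
            <= eps * Cmod (z + h + - z)%C) in Hd.
    replace (z + h + - z)%C with h in Hd by ring.
    exact Hd.
  - intros H. split.
    + apply (@is_linear_scal_l C_AbsRing C_NormedModule).
    + intros x Hx.
      assert (Ex : z = x).
      { apply (@is_filter_lim_locally_unique C_AbsRing
                 (AbsRing_NormedModule C_AbsRing)). exact Hx. }
      subst x. intros [eps Heps].
      destruct (H eps Heps) as [delta [Hd H1]].
      exists (mkposreal delta Hd). intros y Hy.
      change (Cmod (y + - z)%C < delta) in Hy.
      specialize (H1 _ Hy).
      assert (E : (z + (y + - z))%C = y :> C) by (generalize (y : C); intros; ring).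
      rewrite E in H1. exact H1.
Qed.

Definition CPS (a : nat -> C) (z : C) : C := Csum (fun n => a n * z ^ n)%C.

Definition ctame (a : nat -> C) : Prop := tame (fun n => Cmod (a n)).

Lemma ctame_dom (a b : nat -> C) (K : R) :
  ctame a -> (forall n, Cmod (b n) <= K * INR (S n) * Cmod (a n)) -> ctame b.
Proof.
  intros Ha H. apply tame_dom with (1 := Ha) (K := K). intros n.
  rewrite !Rabs_pos_eq by apply Cmod_ge_0. apply H.
Qed.

Lemma ctame_le (a b : nat -> C) :
  ctame a -> (forall n, Cmod (b n) <= Cmod (a n)) -> ctame b.
Proof.
  intros Ha H. apply tame_le with (1 := Ha). intros n.
  rewrite !Rabs_pos_eq by apply Cmod_ge_0. apply H.
Qed.

Lemma ctame_plus (a b : nat -> C) :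
  ctame a -> ctame b -> ctame (fun n => a n + b n)%C.
Proof.
  intros Ha Hb. apply tame_le with (1 := tame_plus _ _ Ha Hb).
  intros n. rewrite Rabs_pos_eq by apply Cmod_ge_0.
  apply Rle_trans with (2 := Rle_abs _). apply Cmod_triangle.
Qed.

Lemma ctame_scal (k : C) (a : nat -> C) : ctame a -> ctame (fun n => k * a n)%C.
Proof.
  intros Ha. apply ctame_dom with (1 := Ha) (K := Cmod k).
  intros n. rewrite Cmod_mult. rewrite S_INR.
  assert (H1 := pos_INR n). assert (H2 := Cmod_ge_0 k). assert (H3 := Cmod_ge_0 (a n)).
  assert (H4 : 0 <= Cmod k * Cmod (a n)) by nra. nra.
Qed.

Lemma ctame_S (a : nat -> C) : ctame a -> ctame (fun n => a (S n)).
Proof. apply (tame_shift (fun n => Cmod (a n))). Qed.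

Lemma ctame_summable (a : nat -> C) (z : C) :
  ctame a -> Cmod z < 1 -> Cabs_summable (fun n => a n * z ^ n)%C.
Proof.
  intros Ha Hz.
  assert (H := tame_ex_series _ (Cmod z) Ha (conj (Cmod_ge_0 z) Hz)).
  apply Cabs_summable_le with (2 := H). intros n.
  rewrite Cmod_mult, Cmod_pow, Rabs_pos_eq by apply Cmod_ge_0. lra.
Qed.

Lemma CPS_ext (a b : nat -> C) (z : C) :
  (forall n, a n = b n) -> CPS a z = CPS b z.
Proof. intros H. apply Csum_ext. intros n. now rewrite H. Qed.

Lemma CPS_plus (a b : nat -> C) (z : C) :
  ctame a -> ctame b -> Cmod z < 1 ->
  CPS (fun n => a n + b n)%C z = (CPS a z + CPS b z)%C.
Proof.
  intros Ha Hb Hz. unfold CPS. rewrite <- Csum_plus by now apply ctame_summable.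
  apply Csum_ext. intros n. ring.
Qed.

Lemma CPS_scal (k : C) (a : nat -> C) (z : C) :
  ctame a -> Cmod z < 1 -> CPS (fun n => k * a n)%C z = (k * CPS a z)%C.
Proof.
  intros Ha Hz. unfold CPS. rewrite <- Csum_scal by now apply ctame_summable.
  apply Csum_ext. intros n. ring.
Qed.

Lemma CPS_S (a : nat -> C) (z : C) :
  ctame a -> Cmod z < 1 -> CPS a z = (a 0%nat + z * CPS (fun n => a (S n)) z)%C.
Proof.
  intros Ha Hz. unfold CPS. rewrite Csum_S by now apply ctame_summable.
  rewrite <- Csum_scal by (apply ctame_summable; [now apply ctame_S|easy]).
  f_equal; [simpl; ring|]. apply Csum_ext. intros n. simpl. ring.
Qed.

Lemma CPS_0 (a : nat -> C) : ctame a -> CPS a 0 = a 0%nat.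
Proof.
  intros Ha. rewrite CPS_S; [ring|easy|]. rewrite Cmod_0. lra.
Qed.

Definition C_dcoef (a : nat -> C) (n : nat) : C := (RtoC (INR (S n)) * a (S n))%C.

Lemma ctame_dcoef (a : nat -> C) : ctame a -> ctame (C_dcoef a).
Proof.
  intros Ha. apply ctame_dom with (1 := ctame_S _ Ha) (K := 1).
  intros n. unfold C_dcoef. rewrite Cmod_mult, Cmod_R, Rabs_pos_eq by apply pos_INR.
  lra.
Qed.

(** [n * z^(n-1)] without the predecessor. *)
Fixpoint pow_deriv (z : C) (n : nat) : C :=
  match n with 0%nat => 0%C | S m => (z * pow_deriv z m + z ^ m)%C end.

Lemma pow_deriv_S (z : C) (n : nat) :
  pow_deriv z (S n) = (RtoC (INR (S n)) * z ^ n)%C.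
Proof.
  induction n as [|n IH]; [simpl; ring|].
  change (pow_deriv z (S (S n))) with (z * pow_deriv z (S n) + z ^ S n)%C.
  rewrite IH, (S_INR (S n)), RtoC_plus. simpl (z ^ S n)%C. ring.
Qed.

Lemma pow_deriv_bound (z : C) (r : R) (n : nat) :
  Cmod z <= r -> Cmod (pow_deriv z n) * r <= INR n * r ^ n.
Proof.
  intros Hz. assert (H0 := Cmod_ge_0 z).
  induction n as [|n IH].
  - simpl. rewrite Cmod_0. lra.
  - change (pow_deriv z (S n)) with (z * pow_deriv z n + z ^ n)%C.
    apply Rle_trans with ((r * Cmod (pow_deriv z n) + r ^ n) * r).
    + apply Rmult_le_compat_r; [lra|].
      apply Rle_trans with (1 := Cmod_triangle _ _).
      rewrite Cmod_mult, Cmod_pow.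
      apply Rplus_le_compat.
      * apply Rmult_le_compat_r; [apply Cmod_ge_0|easy].
      * apply pow_incr. lra.
    + rewrite S_INR. simpl. nra.
Qed.

Lemma pow_remainder_bound (z h : C) (r : R) (n : nat) :
  Cmod z <= r -> Cmod (z + h)%C <= r ->
  Cmod ((z + h) ^ n - z ^ n - h * pow_deriv z n)%C * r ^ 2
  <= (INR n) ^ 2 * r ^ n * Cmod h ^ 2.
Proof.
  intros Hz Hzh. assert (H0 := Cmod_ge_0 z).
  induction n as [|n IH].
  - simpl. replace (1 - 1 - h * 0)%C with (RtoC 0) by ring. rewrite Cmod_0. lra.
  - replace ((z + h) ^ S n - z ^ S n - h * pow_deriv z (S n))%C
      with ((z + h) * ((z + h) ^ n - z ^ n - h * pow_deriv z n)
            + h ^ 2 * pow_deriv z n)%C by (simpl; ring).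
    set (E := ((z + h) ^ n - z ^ n - h * pow_deriv z n)%C) in *.
    assert (HB := pow_deriv_bound z r n Hz).
    assert (HE := Cmod_ge_0 E). assert (HQ := Cmod_ge_0 (pow_deriv z n)).
    assert (Hh : 0 <= Cmod h ^ 2) by apply pow2_ge_0.
    assert (Hr : 0 <= r ^ n) by (apply pow_le; lra).
    assert (Hn := pos_INR n).
    apply Rle_trans with ((r * Cmod E + Cmod h ^ 2 * Cmod (pow_deriv z n)) * r ^ 2).
    + apply Rmult_le_compat_r; [apply pow2_ge_0|].
      apply Rle_trans with (1 := Cmod_triangle _ _).
      rewrite !Cmod_mult, Cmod_pow.
      apply Rplus_le_compat; [|lra].
      apply Rmult_le_compat_r; easy.
    + rewrite S_INR. simpl (r ^ S n).
      assert (r * (Cmod E * r ^ 2) <= r * ((INR n) ^ 2 * r ^ n * Cmod h ^ 2)).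
      { apply Rmult_le_compat_l; [lra|easy]. }
      assert (Cmod h ^ 2 * r * (Cmod (pow_deriv z n) * r)
              <= Cmod h ^ 2 * r * (INR n * r ^ n)).
      { apply Rmult_le_compat_l; [|easy]. apply Rmult_le_pos; lra. }
      assert (0 <= (INR n + 1) * (r * r ^ n) * Cmod h ^ 2).
      { apply Rmult_le_pos; [|easy]. apply Rmult_le_pos; [lra|].
        apply Rmult_le_pos; lra. }
      nra.
Qed.

(** Term by term differentiation: the second order remainders of the powers
    are summable against [a], uniformly in a small increment. *)
Lemma CPS_is_derive (a : nat -> C) (z : C) :
  ctame a -> Cmod z < 1 ->
  @is_derive C_AbsRing C_NormedModule (CPS a) z (CPS (C_dcoef a) z).
Proof.
  intros Ha Hz. assert (H0 := Cmod_ge_0 z).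
  set (r := (1 + Cmod z) / 2).
  assert (Hr : Cmod z < r < 1) by (unfold r; lra).
  assert (HT : ex_series (fun n => Rabs (INR (S n) * (INR (S n) * Cmod (a n))) * r ^ n)).
  { apply tame_ex_series; [|lra].
    apply tame_dom with (u := fun n => INR (S n) * Cmod (a n)) (K := 1).
    - apply tame_dom with (1 := Ha) (K := 1). intros n.
      rewrite Rabs_mult, (Rabs_pos_eq (INR (S n))) by apply pos_INR. lra.
    - intros n. rewrite Rabs_mult, (Rabs_pos_eq (INR (S n))) by apply pos_INR. lra. }
  set (K := Series (fun n => Rabs (INR (S n) * (INR (S n) * Cmod (a n))) * r ^ n)) in *.
  assert (Hest : forall h, Cmod h < r - Cmod z ->
    Cmod (CPS a (z + h) - CPS a z - h * CPS (C_dcoef a) z)%C <= (K / r ^ 2) * Cmod h ^ 2).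
  { intros h Hh.
    assert (Hzh : Cmod (z + h)%C <= r).
    { apply Rle_trans with (1 := Cmod_triangle _ _). lra. }
    assert (Hs1 : Cabs_summable (fun n => a n * (z + h) ^ n)%C) by (apply ctame_summable; [easy|lra]).
    assert (Hs2 : Cabs_summable (fun n => a n * z ^ n)%C) by (apply ctame_summable; [easy|lra]).
    assert (Hs3 : Cabs_summable (fun n => a n * pow_deriv z n)%C).
    { apply Cabs_summable_S.
      apply Cabs_summable_ext with (fun n => C_dcoef a n * z ^ n)%C.
      - intros n. rewrite pow_deriv_S. unfold C_dcoef. ring.
      - apply ctame_summable; [now apply ctame_dcoef|easy]. }
    assert (HD : CPS (C_dcoef a) z = Csum (fun n => a n * pow_deriv z n)%C).
    { rewrite (Csum_S _ Hs3). simpl (pow_deriv z 0).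
      replace (a 0%nat * 0)%C with (RtoC 0) by ring. rewrite Cplus_0_l.
      apply Csum_ext. intros n. rewrite pow_deriv_S. unfold C_dcoef. ring. }
    rewrite HD. unfold CPS.
    replace (Csum (fun n => a n * (z + h) ^ n) - Csum (fun n => a n * z ^ n)
             - h * Csum (fun n => a n * pow_deriv z n))%C
      with (Csum (fun n => a n * ((z + h) ^ n - z ^ n - h * pow_deriv z n)))%C.
    2:{ rewrite <- (Csum_scal h) by easy.
        transitivity (Csum (fun n => a n * (z + h) ^ n
            + ((-1) * (a n * z ^ n) + (-1) * (h * (a n * pow_deriv z n))))%C).
        - apply Csum_ext. intros n. ring.
        - rewrite !Csum_plus, !(Csum_scal (-1)); try ring; auto;
          repeat (apply Cabs_summable_plus || apply Cabs_summable_scal); auto. }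
    replace (K / r ^ 2 * Cmod h ^ 2) with
      (Series (fun n => (Cmod h ^ 2 / r ^ 2) *
          (Rabs (INR (S n) * (INR (S n) * Cmod (a n))) * r ^ n))).
    2:{ rewrite Series_scal_l. fold K. field. lra. }
    apply Cmod_Csum_le.
    2:{ apply (@ex_series_scal_l R_AbsRing). exact HT. }
    intros n. rewrite Cmod_mult.
    assert (HE := pow_remainder_bound z h r n (Rlt_le _ _ (proj1 Hr)) Hzh).
    set (E := Cmod ((z + h) ^ n - z ^ n - h * pow_deriv z n)%C) in *.
    rewrite Rabs_pos_eq.
    2:{ assert (H1 := pos_INR (S n)). assert (H2 := Cmod_ge_0 (a n)).
        apply Rmult_le_pos; [easy|]. now apply Rmult_le_pos. }
    assert (Hr2 : 0 < r ^ 2) by (apply pow_lt; lra).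
    apply Rmult_le_reg_r with (r ^ 2); [easy|].
    replace (Cmod h ^ 2 / r ^ 2 * (INR (S n) * (INR (S n) * Cmod (a n)) * r ^ n) * r ^ 2)
      with (Cmod (a n) * (INR (S n) ^ 2 * r ^ n * Cmod h ^ 2)) by (field; lra).
    rewrite Rmult_assoc. apply Rmult_le_compat_l; [apply Cmod_ge_0|].
    apply Rle_trans with (1 := HE).
    apply Rmult_le_compat_r; [apply pow2_ge_0|].
    apply Rmult_le_compat_r; [apply pow_le; lra|].
    apply pow_incr. split; [apply pos_INR|]. apply le_INR. lia. }
  apply C_is_derive_iff. intros eps Heps.
  assert (HK : 0 <= K / r ^ 2).
  { apply Rmult_le_pos; [|left; apply Rinv_0_lt_compat; apply pow_lt; lra].
    apply Series_nonneg; [|easy]. intros n.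
    apply Rmult_le_pos; [apply Rabs_pos|apply pow_le; lra]. }
  set (k := K / r ^ 2) in *.
  exists (Rmin (r - Cmod z) (eps / (k + 1))). split.
  { apply Rmin_pos; [lra|]. apply Rdiv_lt_0_compat; lra. }
  intros h Hh.
  apply Rle_trans with (1 := Hest h (Rlt_le_trans _ _ _ Hh (Rmin_l _ _))).
  assert (Hh2 := Rlt_le_trans _ _ _ Hh (Rmin_r _ _)).
  apply Rlt_div_r in Hh2; [|lra].
  assert (H1 := Cmod_ge_0 h). nra.
Qed.

Lemma in_disk_open (z : C) : Cmod z < 1 ->
  exists delta, 0 < delta /\ forall h, Cmod h < delta -> Cmod (z + h)%C < 1.
Proof.
  intros Hz. exists (1 - Cmod z). split; [lra|]. intros h Hh.
  apply Rle_lt_trans with (1 := Cmod_triangle _ _). lra.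
Qed.

Lemma C_is_derive_ext_disk (F G : C -> C) (z l : C) :
  (forall w, Cmod w < 1 -> F w = G w) -> Cmod z < 1 ->
  @is_derive C_AbsRing C_NormedModule F z l ->
  @is_derive C_AbsRing C_NormedModule G z l.
Proof.
  intros H Hz HF. rewrite C_is_derive_iff in *. intros eps Heps.
  destruct (HF eps Heps) as [d1 [Hd1 H1]].
  destruct (in_disk_open z Hz) as [d2 [Hd2 H2]].
  exists (Rmin d1 d2). split; [now apply Rmin_pos|]. intros h Hh.
  rewrite <- !H; auto.
  - apply H1. apply Rlt_le_trans with (1 := Hh), Rmin_l.
  - apply H2. apply Rlt_le_trans with (1 := Hh), Rmin_r.
Qed.

(** The disk being open, a function that agrees with a power series on it
    inherits the derivatives of all orders; applied to [C_derive F], this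
    reaches the second derivative. *)
Lemma C_derive_CPS (F : C -> C) (a : nat -> C) (z : C) :
  ctame a -> (forall w, Cmod w < 1 -> F w = CPS a w) -> Cmod z < 1 ->
  C_derive F z = CPS (C_dcoef a) z.
Proof.
  intros Ha HF Hz. apply is_C_derive_unique.
  apply C_is_derive_ext_disk with (CPS a); auto.
  - intros w Hw. symmetry. auto.
  - now apply CPS_is_derive.
Qed.

(** * Averages of real power series over dilations *)

(** Coefficients of the average of [PSeries d (s * x)] against
    [s^(a-1) ds] on [0 < s < 1]. *)
Definition avg (a : R) (d : nat -> R) (m : nat) : R := d m / (INR m + a).

Lemma tame_avg (a : R) (d : nat -> R) : 0 < a -> tame d -> tame (avg a d).
Proof.
  intros Ha Hd. apply tame_dom with (1 := Hd) (K := / a). intros m.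
  unfold avg, Rdiv. assert (Hm := pos_INR m).
  rewrite Rabs_mult, Rabs_inv, (Rabs_pos_eq (INR m + a)) by lra.
  rewrite Rmult_comm. apply Rmult_le_compat_r; [apply Rabs_pos|].
  assert (H1 : / (INR m + a) <= / a) by (apply Rinv_le_contravar; lra).
  assert (H2 : 0 < / a) by now apply Rinv_0_lt_compat.
  rewrite S_INR. nra.
Qed.

Lemma tame_ex_pseries (d : nat -> R) (x : R) :
  tame d -> Rabs x < 1 -> ex_pseries d x.
Proof. intros Hd Hx. apply CV_radius_inside. now apply tame_CV_radius. Qed.

Lemma PSeries_lin (A B : R) (u v : nat -> R) (x : R) :
  tame u -> tame v -> Rabs x < 1 ->
  PSeries (fun n => A * u n + B * v n) x = A * PSeries u x + B * PSeries v x.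
Proof.
  intros Hu Hv Hx. rewrite <- !PSeries_scal.
  apply (PSeries_plus (PS_scal A u) (PS_scal B v));
    (apply (@ex_pseries_scal R_AbsRing R_NormedModule);
     [apply Rmult_comm|now apply tame_ex_pseries]).
Qed.

Lemma tame_PS_derive (d : nat -> R) : tame d -> tame (PS_derive d).
Proof.
  intros Hd. apply tame_dom with (1 := tame_shift _ Hd) (K := 1). intros n.
  unfold PS_derive. rewrite Rabs_mult, (Rabs_pos_eq (INR (S n))) by apply pos_INR.
  lra.
Qed.

Lemma ex_derive_cont (f : R -> R) (x : R) : ex_derive f x -> continuous f x.
Proof. apply (ex_derive_continuous (K := R_AbsRing) (V := R_NormedModule)). Qed.

Lemma PSeries_continuous (d : nat -> R) (x : R) :
  tame d -> Rabs x < 1 -> continuous (PSeries d) x.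
Proof.
  intros Hd Hx. apply ex_derive_cont.
  eexists. apply is_derive_PSeries. now apply tame_CV_radius.
Qed.

Lemma is_derive_Rpower (a x : R) :
  0 < x -> is_derive (fun u => Rpower u a) x (a * Rpower x (a - 1)).
Proof. intros Hx. apply is_derive_Reals. now apply derivable_pt_lim_power. Qed.

Lemma Rpower_pred (a x : R) : 0 < x -> Rpower x a = x * Rpower x (a - 1).
Proof.
  intros Hx. rewrite <- (Rpower_1 x Hx) at 2. rewrite <- Rpower_plus.
  f_equal. ring.
Qed.

(** The Euler operator [x d/dx + a] multiplies the [m]-th coefficient by
    [m + a]. *)
Lemma avg_is_derive (a x : R) (d : nat -> R) :
  tame d -> 0 < a -> 0 < x < 1 ->
  is_derive (fun u => Rpower u a * PSeries (avg a d) u) x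
    (Rpower x (a - 1) * PSeries d x).
Proof.
  intros Hd Ha Hx.
  assert (Hax : Rabs x < 1) by (rewrite Rabs_pos_eq; lra).
  assert (He := tame_avg a d Ha Hd).
  assert (HE := is_derive_PSeries (avg a d) x (tame_CV_radius _ _ He Hax)).
  assert (HR := is_derive_Rpower a x (proj1 Hx)).
  assert (Eq : PSeries d x
               = a * PSeries (avg a d) x + x * PSeries (PS_derive (avg a d)) x).
  { rewrite <- PSeries_scal, <- PSeries_incr_1, <- PSeries_plus.
    - apply PSeries_ext. intros n. unfold PS_plus, PS_scal.
      change (d n = a * avg a d n + PS_incr_1 (PS_derive (avg a d)) n).
      unfold avg. destruct n as [|n].
      + change (d 0%nat = a * (d 0%nat / (0 + a)) + 0). field. lra.
      + unfold PS_incr_1, PS_derive. field. assert (H := pos_INR (S n)). lra.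
    - apply (@ex_pseries_scal R_AbsRing R_NormedModule); [apply Rmult_comm|].
      now apply tame_ex_pseries.
    - apply (@ex_pseries_incr_1 R_AbsRing R_NormedModule).
      apply tame_ex_pseries; [now apply tame_PS_derive|easy]. }
  rewrite Eq.
  replace (Rpower x (a - 1) * (a * PSeries (avg a d) x + x * PSeries (PS_derive (avg a d)) x))
    with (a * Rpower x (a - 1) * PSeries (avg a d) x
          + Rpower x a * PSeries (PS_derive (avg a d)) x).
  2:{ rewrite (Rpower_pred a x) by lra. ring. }
  apply (is_derive_mult (fun u => Rpower u a) (PSeries (avg a d))); auto.
  apply Rmult_comm.
Qed.

Lemma at_right_0_near (x : R) : 0 < x -> at_right 0 (fun u => 0 < u < x).
Proof.
  intros Hx. exists (mkposreal x Hx). intros u Hu Hu0.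
  change (Rabs (u + - 0) < x) in Hu. apply Rabs_def2 in Hu. lra.
Qed.

Lemma at_left_1_near (x : R) : x < 1 -> at_left 1 (fun u => x < u < 1).
Proof.
  intros Hx. exists (mkposreal (1 - x) ltac:(lra)). intros u Hu Hu1.
  change (Rabs (u + - (1)) < 1 - x) in Hu. apply Rabs_def2 in Hu. lra.
Qed.

Lemma Rpower_lim_0 (a : R) :
  0 < a -> filterlim (fun x => Rpower x a) (at_right 0) (locally 0).
Proof.
  intros Ha. apply filterlim_locally. intros eps.
  exists (mkposreal (Rpower eps (/ a)) (exp_pos _)).
  intros x Hx Hx0. simpl in Hx. change (Rabs (x + - 0) < Rpower eps (/ a)) in Hx.
  rewrite Ropp_0, Rplus_0_r, Rabs_pos_eq in Hx by lra.
  change (Rabs (Rpower x a + - 0) < eps).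
  rewrite Ropp_0, Rplus_0_r, Rabs_pos_eq by (left; apply exp_pos).
  replace (pos eps) with (Rpower (Rpower eps (/ a)) a).
  2:{ rewrite Rpower_mult, Rinv_l by lra. apply Rpower_1, cond_pos. }
  unfold Rpower at 1 2. apply exp_increasing.
  apply Rmult_lt_compat_l; [easy|]. apply ln_increasing; lra.
Qed.

Lemma avg_lim_0 (a : R) (d : nat -> R) :
  tame d -> 0 < a ->
  filterlim (fun x => Rpower x a * PSeries d x) (at_right 0) (locally 0).
Proof.
  intros Hd Ha. replace (locally 0) with (locally (0 * PSeries d 0)) by (f_equal; ring).
  apply (filterlim_comp_2 (G := locally 0) (H := locally (PSeries d 0))
           (fun x => Rpower x a) (PSeries d) Rmult).
  - now apply Rpower_lim_0.
  - apply (filterlim_filter_le_1 (F := locally 0)).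
    + apply filter_le_within.
    + apply PSeries_continuous; [easy|]. rewrite Rabs_R0. lra.
  - apply (filterlim_mult (K := R_AbsRing) 0 (PSeries d 0)).
Qed.

Lemma derive_nonneg_le (F dF : R -> R) (a b : R) :
  a <= b -> (forall x, a <= x <= b -> is_derive F x (dF x)) ->
  (forall x, a <= x <= b -> 0 <= dF x) -> F a <= F b.
Proof.
  intros Hab HF HdF.
  destruct (MVT_gen F a b dF) as [c [Hc E]].
  - intros x. rewrite Rmin_left, Rmax_right by easy. intros Hx. apply HF; lra.
  - intros x. rewrite Rmin_left, Rmax_right by easy. intros Hx.
    apply continuity_pt_filterlim.
    apply ex_derive_cont.
    eexists. now apply HF.
  - rewrite Rmin_left, Rmax_right in Hc by easy. specialize (HdF c Hc). nra.
Qed.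

(** [x^a * PSeries (avg a d) x] has a nonnegative derivative and vanishes at
    the origin. *)
Lemma avg_nonneg (a : R) (d : nat -> R) :
  tame d -> 0 < a ->
  (forall x, 0 < x < 1 -> 0 <= PSeries d x) ->
  forall x, 0 < x < 1 -> 0 <= PSeries (avg a d) x.
Proof.
  intros Hd Ha H x Hx.
  assert (Hp : 0 < Rpower x a) by apply exp_pos.
  apply Rmult_le_reg_l with (1 := Hp). rewrite Rmult_0_r.
  assert (HL := avg_lim_0 a (avg a d) (tame_avg a d Ha Hd) Ha).
  apply (filterlim_le (F := at_right 0) (fun u => Rpower u a * PSeries (avg a d) u)
     (fun _ => Rpower x a * PSeries (avg a d) x) 0
     (Rpower x a * PSeries (avg a d) x)).
  - apply filter_imp with (2 := at_right_0_near x (proj1 Hx)). intros u Hu.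
    apply (derive_nonneg_le (fun u => Rpower u a * PSeries (avg a d) u)
             (fun u => Rpower u (a - 1) * PSeries d u)); [lra| |].
    + intros y Hy. apply avg_is_derive; auto; lra.
    + intros y Hy. apply Rmult_le_pos; [left; apply exp_pos|]. apply H. lra.
  - exact HL.
  - apply filterlim_const.
Qed.

(** Since the primitive [x^a * PSeries (avg a d) x] vanishes at [0], the
    improper integral is the boundary value at [1] of the averaged series;
    for [a < 1] it is improper at [0], and at [1] nothing better than
    conditional convergence is assumed. *)
Lemma int01_avg (a l : R) (d : nat -> R) :
  tame d -> 0 < a ->
  filterlim (PSeries (avg a d)) (at_left 1) (locally l) ->
  is_RInt_gen (fun s => Rpower s (a - 1) * PSeries d s) (at_right 0) (at_left 1) l.
Proof.
  intros Hd Ha Hl.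
  set (F := fun u => Rpower u a * PSeries (avg a d) u).
  assert (H1 : filterlim F (at_left 1) (locally l)).
  { rewrite <- (Rmult_1_l l).
    apply (filterlim_comp_2 (G := locally 1) (H := locally l)
             (fun x => Rpower x a) (PSeries (avg a d)) Rmult).
    - apply (filterlim_filter_le_1 (F := locally 1)); [apply filter_le_within|].
      assert (E : Rpower 1 a = 1) by (unfold Rpower; now rewrite ln_1, Rmult_0_r, exp_0).
      cut (filterlim (fun x => Rpower x a) (locally 1) (locally (Rpower 1 a))); [now rewrite E|].
      apply (ex_derive_cont (fun x => Rpower x a) 1).
      eexists. apply is_derive_Rpower. lra.
    - exact Hl.
    - apply (filterlim_mult (K := R_AbsRing) 1 l). }
  assert (H0 : filterlim F (at_right 0) (locally 0)).
  { apply avg_lim_0; auto. now apply tame_avg. }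
  assert (HI : filter_prod (at_right 0) (at_left 1) (fun ab =>
     is_RInt (fun s => Rpower s (a - 1) * PSeries d s) (fst ab) (snd ab)
             (F (snd ab) - F (fst ab)))).
  { apply (Filter_prod (at_right 0) (at_left 1) _
      (fun x => 0 < x < 1) (fun y => 0 < y < 1)).
    - apply (at_right_0_near 1 Rlt_0_1).
    - apply (at_left_1_near 0 Rlt_0_1).
    - intros x y Hx Hy. simpl.
      apply (is_RInt_derive (V := R_CompleteNormedModule) F).
      + intros u Hu. apply avg_is_derive; auto.
        assert (A1 := Rmin_glb_lt x y 0). assert (A2 := Rmax_lub_lt x y 1). lra.
      + intros u Hu.
        assert (A1 := Rmin_glb_lt x y 0). assert (A2 := Rmax_lub_lt x y 1).
        apply (continuous_mult (K := R_AbsRing) (fun s => Rpower s (a - 1)) (PSeries d)).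
        * apply ex_derive_cont.
          eexists. apply is_derive_Rpower. lra.
        * apply PSeries_continuous; [easy|]. rewrite Rabs_pos_eq; lra. }
  intros P HP.
  assert (HF : filter_prod (at_right 0) (at_left 1)
                 (fun ab => P (F (snd ab) - F (fst ab)))).
  { replace l with (l - 0) in HP by ring.
    assert (HL : filterlim (fun ab : R * R => F (snd ab) - F (fst ab))
                   (filter_prod (at_right 0) (at_left 1)) (locally (l - 0))).
    { apply (filterlim_comp_2 (G := locally l) (H := locally (- 0))
         (fun ab : R * R => F (snd ab)) (fun ab : R * R => - F (fst ab)) Rplus).
      - apply filterlim_comp with (at_left 1); [apply filterlim_snd|exact H1].
      - apply filterlim_comp with (locally 0).
        + apply filterlim_comp with (at_right 0); [apply filterlim_fst|exact H0].
        + apply (filterlim_opp (K := R_AbsRing) (V := R_NormedModule) 0).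
      - apply (filterlim_plus (K := R_AbsRing) (V := R_NormedModule) l (- 0)). }
    exact (HL P HP). }
  apply filter_and with (1 := HI) in HF.
  apply filter_imp with (2 := HF). intros ab [Ha1 Ha2].
  eexists. split; [exact Ha1|exact Ha2].
Qed.

(** * The extremal inequality for the weights 1/((m+1)(m+2)) *)

Lemma one_minus_neq_0 (z : C) : Cmod z < 1 -> (1 - z)%C <> RtoC 0.
Proof.
  intros Hz E.
  assert (E1 : z = RtoC 1).
  { transitivity (1 - (1 - z))%C; [ring|]. rewrite E. ring. }
  rewrite E1, Cmod_1 in Hz. lra.
Qed.

Lemma ctame_R (u : nat -> R) : tame u -> ctame (fun n => RtoC (u n)).
Proof.
  intros Hu. apply tame_le with (1 := Hu). intros n.
  rewrite Cmod_R, Rabs_Rabsolu. lra.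
Qed.

Lemma tame_INR : tame INR.
Proof.
  apply tame_dom with (1 := tame_1) (K := 1). intros n.
  rewrite Rabs_R1, Rabs_pos_eq by apply pos_INR. rewrite S_INR. lra.
Qed.

(** The closed forms of this and the next series come from their functional
    equations [G = 1 + z G] and [G = z (G + 1/(1-z))]. *)
Lemma CPS_geom (z : C) : Cmod z < 1 -> CPS (fun _ => RtoC 1) z = (1 / (1 - z))%C.
Proof.
  intros Hz. assert (H0 := one_minus_neq_0 z Hz).
  assert (E := CPS_S _ z (ctame_R _ tame_1) Hz). simpl in E.
  set (G := CPS (fun _ => RtoC 1) z) in *.
  transitivity ((G - z * G) / (1 - z))%C; [now field|].
  rewrite E at 1. now field.
Qed.

Lemma CPS_nat (z : C) :
  Cmod z < 1 -> CPS (fun n => RtoC (INR n)) z = (z / (1 - z) ^ 2)%C.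
Proof.
  intros Hz. assert (H0 := one_minus_neq_0 z Hz).
  assert (E := CPS_S _ z (ctame_R _ tame_INR) Hz). cbv beta in E.
  rewrite (CPS_ext (fun n => RtoC (INR (S n))) (fun n => RtoC (INR n) + RtoC 1)%C) in E.
  2:{ intros n. now rewrite S_INR, RtoC_plus. }
  rewrite CPS_plus, CPS_geom in E; auto using ctame_R, tame_INR, tame_1.
  set (G := CPS (fun n => RtoC (INR n)) z) in *.
  transitivity ((G - z * G) / (1 - z))%C; [now field|].
  rewrite E at 1. simpl (INR 0). now field.
Qed.

Lemma Re_CPS_ray (a : nat -> C) (e : C) (x : R) :
  fst (CPS a (RtoC x * e)) = PSeries (fun n => fst (a n * e ^ n)%C) x.
Proof.
  apply Series_ext. intros n. rewrite Cpow_mult_l, <- RtoC_pow.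
  replace (a n * (RtoC (x ^ n) * e ^ n))%C with (RtoC (x ^ n) * (a n * e ^ n))%C by ring.
  simpl. ring.
Qed.

Lemma Im_CPS_ray (a : nat -> C) (e : C) (x : R) :
  snd (CPS a (RtoC x * e)) = PSeries (fun n => snd (a n * e ^ n)%C) x.
Proof.
  apply Series_ext. intros n. rewrite Cpow_mult_l, <- RtoC_pow.
  replace (a n * (RtoC (x ^ n) * e ^ n))%C with (RtoC (x ^ n) * (a n * e ^ n))%C by ring.
  simpl. ring.
Qed.

Lemma m1_pow (n : nat) : (RtoC (-1) ^ n)%C = RtoC ((-1) ^ n).
Proof. now rewrite RtoC_pow. Qed.

Lemma PSeries_alt (u : nat -> R) (x : R) :
  PSeries (fun n => u n * (-1) ^ n) x = fst (CPS (fun n => RtoC (u n)) (RtoC (- x))).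
Proof.
  replace (RtoC (- x)) with (RtoC x * RtoC (-1))%C.
  2:{ rewrite <- RtoC_mult. f_equal. ring. }
  rewrite Re_CPS_ray. apply PSeries_ext. intros n.
  rewrite m1_pow, <- RtoC_mult. reflexivity.
Qed.

Lemma Cmod_ray (e : C) (x : R) : Cmod e = 1 -> 0 <= x -> Cmod (RtoC x * e)%C = x.
Proof. intros He Hx. rewrite Cmod_mult, Cmod_R, He, Rabs_pos_eq; lra. Qed.

Lemma PSeries_alt_1 (x : R) : Rabs x < 1 ->
  PSeries (fun n => (-1) ^ n) x = 1 / (1 + x).
Proof.
  intros Hx. apply Rabs_def2 in Hx as Hx'.
  rewrite (PSeries_ext _ (fun n => 1 * (-1) ^ n)) by (intros; ring).
  rewrite PSeries_alt, CPS_geom by (now rewrite Cmod_R, Rabs_Ropp).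
  rewrite <- RtoC_minus, <- RtoC_div by lra. simpl. field. lra.
Qed.

Lemma PSeries_alt_INR (x : R) : Rabs x < 1 ->
  PSeries (fun n => INR n * (-1) ^ n) x = - x / (1 + x) ^ 2.
Proof.
  intros Hx. apply Rabs_def2 in Hx as Hx'.
  rewrite PSeries_alt, CPS_nat by (now rewrite Cmod_R, Rabs_Ropp).
  rewrite <- RtoC_minus, <- RtoC_pow, <- RtoC_div.
  - simpl. field. lra.
  - apply pow_nonzero. lra.
Qed.

Lemma tame_alt (u : nat -> R) : tame u -> tame (fun n => u n * (-1) ^ n).
Proof.
  intros Hu. apply tame_le with (1 := Hu). intros n.
  rewrite Rabs_mult, pow_1_abs. lra.
Qed.

Lemma tame_S_INR : tame (fun n => INR (S n)).
Proof. apply (tame_shift INR), tame_INR. Qed.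

Lemma tame_m1_pow : tame (fun n => (-1) ^ n).
Proof. apply tame_ext with (2 := tame_alt _ tame_1). intros n. ring. Qed.

Lemma PSeries_koebe (x : R) : Rabs x < 1 ->
  PSeries (fun n => INR (S n) * (-1) ^ n) x = 1 / (1 + x) ^ 2.
Proof.
  intros Hx. apply Rabs_def2 in Hx as Hx'.
  rewrite (PSeries_ext _ (fun n => 1 * (INR n * (-1) ^ n) + 1 * (-1) ^ n)).
  - rewrite PSeries_lin, PSeries_alt_1, PSeries_alt_INR
      by (auto using tame_alt, tame_INR, tame_m1_pow).
    field. lra.
  - intros n. rewrite S_INR. ring.
Qed.

(** [excess e w] lists, along the ray through [e], the Taylor coefficients of
    [Re ((1+w)/2 * 1/(1-z)^2 + (1-w)/2 * 1/(1-z)) - 1/(1+|z|)^2]: for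
    unimodular [w] the first two terms are the functions that detect
    starlikeness by convolution, and the last one is the Koebe function
    divided by the variable, at [- |z|]. *)
Definition excess (e w : C) (m : nat) : R :=
  fst ((1 + (1 + w) / RtoC 2 * RtoC (INR m)) * e ^ m)%C - INR (S m) * (-1) ^ m.

Lemma ctame_excess (w : C) :
  ctame (fun m => 1 + (1 + w) / RtoC 2 * RtoC (INR m))%C.
Proof.
  apply ctame_plus; [apply ctame_R, tame_1|].
  apply ctame_scal, ctame_R, tame_INR.
Qed.

Lemma tame_fst (a : nat -> C) : ctame a -> tame (fun n => fst (a n)).
Proof.
  intros Ha. apply tame_le with (1 := Ha). intros n.
  rewrite (Rabs_pos_eq (Cmod _)) by apply Cmod_ge_0. apply fst_le_Cmod.
Qed.

Lemma tame_snd (a : nat -> C) : ctame a -> tame (fun n => snd (a n)).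
Proof.
  intros Ha. apply tame_le with (1 := Ha). intros n.
  rewrite (Rabs_pos_eq (Cmod _)) by apply Cmod_ge_0. apply snd_le_Cmod.
Qed.

Lemma ctame_ray (a : nat -> C) (e : C) :
  ctame a -> Cmod e <= 1 -> ctame (fun n => a n * e ^ n)%C.
Proof.
  intros Ha He. apply ctame_le with (1 := Ha). intros n.
  rewrite Cmod_mult, Cmod_pow.
  assert (Cmod e ^ n <= 1).
  { rewrite <- (pow1 n). apply pow_incr. split; [apply Cmod_ge_0|easy]. }
  assert (H1 := Cmod_ge_0 (a n)). nra.
Qed.

Lemma tame_opp (u : nat -> R) : tame u -> tame (fun n => - u n).
Proof. intros Hu. apply tame_le with (1 := Hu). intros n. rewrite Rabs_Ropp. lra. Qed.

Lemma tame_excess (e w : C) : Cmod e <= 1 -> tame (excess e w).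
Proof.
  intros He. apply tame_plus.
  - apply (tame_fst (fun m => (1 + (1 + w) / RtoC 2 * RtoC (INR m)) * e ^ m)%C).
    apply ctame_ray; [apply ctame_excess|easy].
  - apply tame_opp, tame_alt, tame_S_INR.
Qed.

Lemma PSeries_excess (e w : C) (x : R) :
  Cmod e = 1 -> 0 <= x < 1 ->
  PSeries (excess e w) x
  = fst (1 / (1 - RtoC x * e)
         + (1 + w) / RtoC 2 * (RtoC x * e / (1 - RtoC x * e) ^ 2))%C
    - 1 / (1 + x) ^ 2.
Proof.
  intros He Hx.
  assert (Hax : Rabs x < 1) by (rewrite Rabs_pos_eq; lra).
  assert (Hz : Cmod (RtoC x * e)%C < 1) by (rewrite Cmod_ray; lra).
  assert (T1 : tame (fun m => fst ((1 + (1 + w) / RtoC 2 * RtoC (INR m)) * e ^ m)%C)).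
  { apply (tame_fst (fun m => (1 + (1 + w) / RtoC 2 * RtoC (INR m)) * e ^ m)%C).
    apply ctame_ray; [apply ctame_excess|lra]. }
  transitivity (1 * PSeries (fun m => fst ((1 + (1 + w) / RtoC 2 * RtoC (INR m)) * e ^ m)%C) x
     + (-1) * PSeries (fun n => INR (S n) * (-1) ^ n) x).
  - rewrite <- PSeries_lin by (auto using tame_alt, tame_S_INR).
    apply PSeries_ext. intros m. unfold excess. ring.
  - rewrite PSeries_koebe by easy.
    rewrite <- (Re_CPS_ray (fun m => 1 + (1 + w) / RtoC 2 * RtoC (INR m))%C).
    rewrite (CPS_plus (fun _ => RtoC 1) (fun m => (1 + w) / RtoC 2 * RtoC (INR m))%C).
    + rewrite CPS_scal, CPS_geom, CPS_nat; auto using ctame_R, tame_INR.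
      field. lra.
    + apply ctame_R, tame_1.
    + apply ctame_scal, ctame_R, tame_INR.
    + easy.
Qed.

(** The value of the unimodular [w] only enters through a triangle
    inequality; the remaining bound depends on [Re e] alone, and vanishes for
    [e = -1]. *)
Lemma PSeries_excess_ge (e w : C) (x : R) :
  Cmod e = 1 -> Cmod w = 1 -> 0 <= x < 1 ->
  let D := 1 - 2 * x * fst e + x ^ 2 in
  x * (1 + fst e) / 2 *
    ((1 - x) ^ 2 / D ^ 2 + 2 * (1 - 2 * x - x ^ 2) / (D * (1 + x) ^ 2))
  <= PSeries (excess e w) x.
Proof.
  intros He Hw Hx D. rewrite PSeries_excess by easy.
  assert (Hz : Cmod (RtoC x * e)%C < 1) by (rewrite Cmod_ray; lra).
  assert (H0 := one_minus_neq_0 _ Hz).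
  assert (Hcz := Cmod_ray e x He (proj1 Hx)).
  set (z := (RtoC x * e)%C) in *.
  assert (He2 : fst e ^ 2 + snd e ^ 2 = 1).
  { change (Re e ^ 2 + Im e ^ 2 = 1). rewrite <- Cmod2_alt, He. ring. }
  assert (HD : Cmod (1 - z)%C ^ 2 = D).
  { rewrite Cmod2_alt. unfold z, D, Re, Im. simpl. nra. }
  assert (HDpos : 0 < D).
  { rewrite <- HD. apply pow_lt. now apply Cmod_gt_0. }
  replace (1 / (1 - z) + (1 + w) / RtoC 2 * (z / (1 - z) ^ 2))%C
    with (RtoC (/ 2) * (1 / (1 - z) + 1 / (1 - z) ^ 2)
          + RtoC (/ 2) * (w * (z / (1 - z) ^ 2)))%C.
  2:{ rewrite RtoC_inv by lra. field. exact H0. }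
  assert (Hw1 : - (x / D) <= fst (w * (z / (1 - z) ^ 2))%C).
  { assert (H1 := fst_le_Cmod (w * (z / (1 - z) ^ 2))%C).
    rewrite Cmod_mult, Hw, Cmod_div, Cmod_pow, HD in H1 by (now apply Cpow_nz).
    rewrite Hcz in H1.
    assert (H2 := Rle_abs (- fst (w * (z / (1 - z) ^ 2))%C)).
    rewrite Rabs_Ropp in H2. lra. }
  assert (Einv : (1 / (1 - z))%C = (RtoC (/ D) * (1 - Cconj z))%C).
  { rewrite RtoC_inv, <- HD by lra.
    rewrite Cmod2_conj.
    replace (Cconj (1 - z))%C with (1 - Cconj z)%C.
    2:{ unfold Cconj, Cminus, Cplus, Copp; simpl. f_equal; ring. }
    field. split; [|easy]. intros E.
    apply H0. transitivity (Cconj (1 - Cconj z))%C.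
    - unfold Cconj, Cminus, Cplus, Copp; simpl. f_equal; ring.
    - rewrite E. unfold Cconj; simpl. now rewrite Ropp_0. }
  assert (E2 : (1 / (1 - z) ^ 2)%C = (RtoC (/ D) * (1 - Cconj z) * (RtoC (/ D) * (1 - Cconj z)))%C).
  { rewrite <- Einv. now field. }
  rewrite E2, Einv.
  set (y := fst (w * (z / (1 - z) ^ 2))%C) in *.
  change (fst (?p + RtoC ?q * ?r)%C) with (fst p + (q * fst r - 0 * snd r)).
  fold y. rewrite Rmult_0_l.
  unfold z. simpl.
  apply Rle_trans with
    (/ 2 * ((1 - x * fst e) / D + ((1 - x * fst e) ^ 2 - x ^ 2 * (1 - fst e ^ 2)) / D ^ 2)
     + / 2 * (- (x / D)) - 1 / (1 + x) ^ 2).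
  - apply Req_le. unfold D in *. field. split; [|lra].
    intros E. apply (Rlt_irrefl 0). rewrite <- E at 2.
    replace (1 - 2 * x * fst e + x * x) with (1 - 2 * x * fst e + x ^ 2) by ring. lra.
  - apply Rplus_le_compat_r.
    replace (1 - fst e ^ 2) with (snd e ^ 2) by lra.
    apply Rle_trans with (/ 2 * ((1 - x * fst e) / D
       + ((1 - x * fst e) ^ 2 - x ^ 2 * snd e ^ 2) / D ^ 2) + / 2 * y); [lra|].
    apply Req_le. field. lra.
Qed.

Lemma tame_PS_Int (c : nat -> R) : tame c -> tame (PS_Int c).
Proof.
  intros Hc. apply tame_unshift. apply tame_le with (1 := Hc).
  intros n. unfold PS_Int. unfold Rdiv.
  rewrite Rabs_mult, Rabs_inv, (Rabs_pos_eq (INR (S n))) by apply pos_INR.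
  rewrite <- (Rmult_1_r (Rabs (c n))) at 2.
  apply Rmult_le_compat_l; [apply Rabs_pos|].
  rewrite <- Rinv_1. apply Rinv_le_contravar; [lra|].
  rewrite S_INR. assert (H := pos_INR n). lra.
Qed.

Lemma PS_Int_is_derive (c : nat -> R) (x : R) :
  tame c -> Rabs x < 1 -> is_derive (PSeries (PS_Int c)) x (PSeries c x).
Proof.
  intros Hc Hx.
  rewrite <- (PSeries_ext (PS_derive (PS_Int c)) c).
  - apply is_derive_PSeries, tame_CV_radius; [now apply tame_PS_Int|easy].
  - intros n. unfold PS_derive, PS_Int. field. apply not_0_INR. lia.
Qed.

Lemma PS_Int_0 (c : nat -> R) : PSeries (PS_Int c) 0 = 0.
Proof. now rewrite PSeries_0. Qed.

Lemma PS_Int_2 (c : nat -> R) (x : R) :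
  PSeries (PS_Int (PS_Int c)) x
  = x ^ 2 * PSeries (fun m => c m / ((INR m + 1) * (INR m + 2))) x.
Proof.
  simpl. rewrite Rmult_1_r, Rmult_assoc, <- !PSeries_incr_1.
  apply PSeries_ext. intros [|[|n]]; simpl PS_incr_1.
  - reflexivity.
  - unfold PS_Int. change (@zero R_AbsRing) with 0. unfold Rdiv.
    change (0 * / INR 1 = 0). ring.
  - unfold PS_Int. rewrite !S_INR. field. assert (H := pos_INR n). lra.
Qed.

(** The inequality fails pointwise before averaging, so it is integrated
    against [r - t].  In the lower bound above, [(1-t)^2/D^2] is
    [(1-t)/(1+t)] times the derivative of [t/D]; integrating that part by
    parts turns the whole integrand into [t * (r*(1-t)^2 + 2*t^2*(1-r))]
    divided by [D*(1+t)^2], which is nonnegative.  In terms of the second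
    primitive [U] of the series, [X t = U t + (r - t) U' t - (boundary term)]
    is therefore nondecreasing; it vanishes at [0], and [X r] is [r^2] times
    the sum to be estimated. *)
Lemma excess_base (e w : C) (r : R) :
  Cmod e = 1 -> Cmod w = 1 -> 0 < r < 1 ->
  0 <= PSeries (fun m => excess e w m / ((INR m + 1) * (INR m + 2))) r.
Proof.
  intros He Hw Hr.
  set (c := excess e w).
  assert (Hc : tame c) by (apply tame_excess; lra).
  set (C := fst e).
  assert (HC : -1 <= C <= 1).
  { assert (H := fst_le_Cmod e). rewrite He in H. fold C in H.
    apply Rabs_le_between in H. lra. }
  set (X := fun t => PSeries (PS_Int (PS_Int c)) t + (r - t) * PSeries (PS_Int c) t
     - (1 + C) / 2 * (t ^ 2 * (r - t) * (1 - t) / ((1 + t) * (1 - 2 * t * C + t ^ 2)))).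
  set (dX := fun t => (r - t) * PSeries c t
     - (1 + C) / 2 *
       (((2 * t * (r - t) * (1 - t) - t ^ 2 * (1 - t) - t ^ 2 * (r - t))
          * ((1 + t) * (1 - 2 * t * C + t ^ 2))
         - t ^ 2 * (r - t) * (1 - t)
           * ((1 - 2 * t * C + t ^ 2) + (1 + t) * (2 * t - 2 * C)))
        / ((1 + t) * (1 - 2 * t * C + t ^ 2)) ^ 2)).
  assert (HX : X 0 <= X r).
  { apply (derive_nonneg_le X dX); [lra| |].
    - intros t Ht.
      assert (HD : 0 < 1 - 2 * t * C + t ^ 2) by nra.
      assert (Hat : Rabs t < 1) by (rewrite Rabs_pos_eq; lra).
      assert (H1 := PS_Int_is_derive _ t (tame_PS_Int _ Hc) Hat).
      assert (H2 := PS_Int_is_derive _ t Hc Hat).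
      assert (H3 : is_derive (fun t => (r - t) * PSeries (PS_Int c) t) t
                     (-1 * PSeries (PS_Int c) t + (r - t) * PSeries c t)).
      { apply (is_derive_mult (fun t => r - t) (PSeries (PS_Int c)) t (-1)
                 (PSeries c t)); [|exact H2|apply Rmult_comm].
        auto_derive; [easy|ring]. }
      assert (H4 := is_derive_plus (K := R_AbsRing) (V := R_NormedModule) _ _ _ _ _ H1 H3).
      set (Q := (1 + C) / 2 *
           (((2 * t * (r - t) * (1 - t) - t ^ 2 * (1 - t) - t ^ 2 * (r - t))
              * ((1 + t) * (1 - 2 * t * C + t ^ 2))
             - t ^ 2 * (r - t) * (1 - t)
               * ((1 - 2 * t * C + t ^ 2) + (1 + t) * (2 * t - 2 * C)))
            / ((1 + t) * (1 - 2 * t * C + t ^ 2)) ^ 2)).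
      assert (H5 : is_derive (fun t => (1 + C) / 2 *
         (t ^ 2 * (r - t) * (1 - t) / ((1 + t) * (1 - 2 * t * C + t ^ 2)))) t Q).
      { unfold Q. auto_derive.
        - apply Rmult_integral_contrapositive_currified; [lra|].
          simpl in HD. lra.
        - field. simpl in HD. lra. }
      assert (H6 := is_derive_minus (K := R_AbsRing) (V := R_NormedModule) _ _ _ _ _ H4 H5).
      replace (dX t) with
        (minus (plus (PSeries (PS_Int c) t)
           (-1 * PSeries (PS_Int c) t + (r - t) * PSeries c t)) Q).
      + exact H6.
      + unfold minus, plus, opp, dX, Q; simpl. ring.
    - intros t Ht.
      assert (HD : 0 < 1 - 2 * t * C + t ^ 2) by nra.
      assert (HE : 0 <= t < 1) by lra.
      assert (HP := PSeries_excess_ge e w t He Hw HE). cbv zeta in HP.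
      fold C in HP. fold c in HP.
      apply Rle_trans with ((1 + C) / 2 *
        (t * (r * (1 - t) ^ 2 + 2 * t ^ 2 * (1 - r))
           / ((1 - 2 * t * C + t ^ 2) * (1 + t) ^ 2))).
      + apply Rmult_le_pos; [lra|]. apply Rdiv_le_0_compat.
        * apply Rmult_le_pos; [lra|].
          assert (0 <= r * (1 - t) ^ 2) by (apply Rmult_le_pos; [lra|apply pow2_ge_0]).
          assert (0 <= 2 * t ^ 2 * (1 - r)).
          { apply Rmult_le_pos; [|lra]. assert (H1 := pow2_ge_0 t). lra. }
          lra.
        * apply Rmult_lt_0_compat; [easy|]. apply pow_lt. lra.
      + assert (HP2 : 0 <= (r - t)) by lra.
        apply (Rmult_le_compat_l _ _ _ HP2) in HP.
        unfold dX.
        refine (Rle_trans _ _ _ _ (Rplus_le_compat_r _ _ _ HP)).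
        apply Req_le. field. lra. }
  assert (X0 : X 0 = 0).
  { unfold X. rewrite !PS_Int_0. field. }
  assert (Xr : X r = r ^ 2 * PSeries (fun m => c m / ((INR m + 1) * (INR m + 2))) r).
  { unfold X. rewrite PS_Int_2. field.
    assert (HD : 0 < 1 - 2 * r * C + r ^ 2) by nra. simpl in HD. lra. }
  rewrite X0, Xr in HX.
  apply Rmult_le_reg_l with (r ^ 2); [apply pow_lt; lra|]. lra.
Qed.

(** * The weights of the integral operator *)

Definition nonneg_on_unit (d : nat -> R) : Prop :=
  tame d /\ forall x, 0 < x < 1 -> 0 <= PSeries d x.

Lemma tame_scal_l (k : R) (d : nat -> R) : tame d -> tame (fun m => k * d m).
Proof.
  intros Hd. apply tame_dom with (1 := Hd) (K := Rabs k). intros m.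
  rewrite Rabs_mult, S_INR. assert (Hm := pos_INR m).
  assert (0 <= Rabs k * Rabs (d m)) by (apply Rmult_le_pos; apply Rabs_pos). nra.
Qed.

Lemma nonneg_on_unit_ext (d e : nat -> R) :
  (forall m, e m = d m) -> nonneg_on_unit d -> nonneg_on_unit e.
Proof.
  intros H [Hd Hp]. split; [now apply tame_ext with d|].
  intros x Hx. rewrite (PSeries_ext e d) by easy. auto.
Qed.

(** [1 / (m + a)] is the [m]-th moment of [s^(a-1) ds] on [0 < s < 1], so that
    [A + B / (m + a)] is the moment sequence of a positive measure. *)
Lemma nonneg_on_unit_factor (a A B : R) (d : nat -> R) :
  0 < a -> 0 <= A -> 0 <= B -> nonneg_on_unit d ->
  nonneg_on_unit (fun m => d m * (A + B / (INR m + a))).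
Proof.
  intros Ha HA HB [Hd Hp].
  apply nonneg_on_unit_ext with (fun m => A * d m + B * avg a d m).
  { intros m. unfold avg. field. assert (Hm := pos_INR m). lra. }
  assert (T1 := tame_scal_l A d Hd).
  assert (T2 := tame_scal_l B _ (tame_avg a d Ha Hd)).
  split; [now apply tame_plus|].
  intros x Hx. assert (Hax : Rabs x < 1) by (rewrite Rabs_pos_eq; lra).
  rewrite PSeries_lin by (auto using tame_avg).
  assert (H1 := Hp x Hx). assert (H2 := avg_nonneg a d Hd Ha Hp x Hx). nra.
Qed.

Lemma one_plus_pos (k : R) (m : nat) : 0 <= k -> 0 < 1 + k * INR m.
Proof. intros Hk. assert (H := Rmult_le_pos k (INR m) Hk (pos_INR m)). lra. Qed.

Definition weight (mu nu xi c : R) (m : nat) : R :=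
  (1 + c) * (1 + xi * INR m)
  / ((1 + c + INR m) * (1 + mu * INR m) * (1 + nu * INR m)).

(** The bound on [c] makes the weights [1/((m+1)(m+2))] times three moment
    sequences.  For [c <= 1] the factors are paired as
    [(m+2)/(m+1+c)], [(m+1)/(1+mu m)], [(1+xi m)/(1+nu m)].  For [c > 1] the
    first of these is no moment sequence any more; but then [xi < 1/3] and
    [xi * (1 + c) <= 1], and [(1+xi m)/(m+1+c)], [(m+2)/(1+nu m)],
    [(m+1)/(1+mu m)] are. *)
Lemma weight_nonneg (mu nu xi c : R) (d : nat -> R) :
  0 <= xi <= 1 -> 1 <= mu -> mu <= nu -> -1 < c ->
  c <= (1 + 1 / mu - xi) / (1 + 2 * xi) ->
  nonneg_on_unit (fun m => d m / ((INR m + 1) * (INR m + 2))) ->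
  nonneg_on_unit (fun m => weight mu nu xi c m * d m).
Proof.
  intros Hxi Hmu Hnu Hc Hc2 Hd.
  assert (Imu : 0 < / mu <= 1).
  { split; [apply Rinv_0_lt_compat; lra|].
    rewrite <- Rinv_1. apply Rinv_le_contravar; lra. }
  assert (Inu : 0 < / nu <= 1).
  { split; [apply Rinv_0_lt_compat; lra|].
    rewrite <- Rinv_1. apply Rinv_le_contravar; lra. }
  assert (Hc3 : c * (1 + 2 * xi) <= 2 - xi).
  { apply Rmult_le_compat_r with (r := 1 + 2 * xi) in Hc2; [|lra].
    unfold Rdiv in Hc2. rewrite Rmult_assoc, Rinv_l in Hc2 by lra. lra. }
  set (P1 := fun m => (1 + c) * (d m / ((INR m + 1) * (INR m + 2)))).
  assert (H1 : nonneg_on_unit P1).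
  { destruct Hd as [T Hp]. split; [now apply tame_scal_l|].
    intros x Hx. unfold P1.
    change (0 <= PSeries (PS_scal (1 + c) (fun m => d m / ((INR m + 1) * (INR m + 2)))) x).
    rewrite PSeries_scal. apply Rmult_le_pos; [lra|auto]. }
  assert (H2 := nonneg_on_unit_factor (/ mu) (/ mu) (/ mu * (1 - / mu)) _
     (proj1 Imu) ltac:(lra) ltac:(nra) H1).
  destruct (Rle_lt_dec c 1) as [C1|C1].
  - assert (H3 := nonneg_on_unit_factor (1 + c) 1 (1 - c) _
       ltac:(lra) ltac:(lra) ltac:(lra) H2).
    assert (A1 : 0 <= xi / nu) by (unfold Rdiv; nra).
    assert (A2 : 0 <= / nu * (1 - xi / nu)) by (unfold Rdiv in *; nra).
    assert (H4 := nonneg_on_unit_factor (/ nu) (xi / nu) (/ nu * (1 - xi / nu)) _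
       (proj1 Inu) A1 A2 H3).
    apply nonneg_on_unit_ext with (2 := H4). intros m.
    unfold P1, weight. assert (Hm := pos_INR m). field.
    assert (Pmu := one_plus_pos mu m ltac:(lra)). assert (Pnu := one_plus_pos nu m ltac:(lra)).
    repeat split; lra.
  - assert (Hxi3 : 3 * xi < 1) by nra.
    assert (H3 := nonneg_on_unit_factor (1 + c) xi (1 - xi * (1 + c)) _
       ltac:(lra) ltac:(lra) ltac:(nra) H2).
    assert (H4 := nonneg_on_unit_factor (/ nu) (/ nu) (/ nu * (2 - / nu)) _
       (proj1 Inu) ltac:(lra) ltac:(nra) H3).
    apply nonneg_on_unit_ext with (2 := H4). intros m.
    unfold P1, weight. assert (Hm := pos_INR m). field.
    assert (Pmu := one_plus_pos mu m ltac:(lra)). assert (Pnu := one_plus_pos nu m ltac:(lra)).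
    repeat split; lra.
Qed.

Lemma weight_pos (mu nu xi c : R) (m : nat) :
  0 <= xi -> 0 < mu -> 0 < nu -> -1 < c -> 0 < weight mu nu xi c m.
Proof.
  intros Hxi Hmu Hnu Hc. assert (Hm := pos_INR m). unfold weight.
  assert (0 <= mu * INR m) by (apply Rmult_le_pos; lra).
  assert (0 <= nu * INR m) by (apply Rmult_le_pos; lra).
  assert (0 <= xi * INR m) by (apply Rmult_le_pos; lra).
  apply Rdiv_lt_0_compat; repeat apply Rmult_lt_0_compat; lra.
Qed.

Lemma weight_0 (mu nu xi c : R) : -1 < c -> weight mu nu xi c 0 = 1.
Proof. intros Hc. unfold weight. simpl. field. lra. Qed.

Lemma weight_bound (mu nu xi c : R) (m : nat) :
  0 <= xi -> 0 < mu -> 0 < nu -> -1 < c ->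
  Rabs (weight mu nu xi c m) <= (1 + xi) * INR (S m).
Proof.
  intros Hxi Hmu Hnu Hc. assert (Hm := pos_INR m).
  rewrite Rabs_pos_eq by (left; now apply weight_pos).
  rewrite S_INR. unfold weight.
  assert (0 <= mu * INR m) by (apply Rmult_le_pos; lra).
  assert (0 <= nu * INR m) by (apply Rmult_le_pos; lra).
  assert (0 <= xi * INR m) by (apply Rmult_le_pos; lra).
  apply Rle_div_l.
  { repeat apply Rmult_lt_0_compat; lra. }
  apply Rle_trans with ((1 + xi) * (INR m + 1) * (1 + c)); [nra|].
  apply Rmult_le_compat_l; [nra|].
  apply Rle_trans with ((1 + c + INR m) * 1 * 1); [lra|].
  apply Rmult_le_compat; [lra|lra| |lra].
  apply Rmult_le_compat; lra.
Qed.

Lemma tame_weight (mu nu xi c : R) (d : nat -> R) :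
  0 <= xi -> 0 < mu -> 0 < nu -> -1 < c -> tame d ->
  tame (fun m => weight mu nu xi c m * d m).
Proof.
  intros Hxi Hmu Hnu Hc Hd. apply tame_dom with (1 := Hd) (K := 1 + xi).
  intros m. rewrite Rabs_mult. apply Rmult_le_compat_r; [apply Rabs_pos|].
  now apply weight_bound.
Qed.

Lemma ctame_weight (mu nu xi c : R) (a : nat -> C) :
  0 <= xi -> 0 < mu -> 0 < nu -> -1 < c -> ctame a ->
  ctame (fun m => RtoC (weight mu nu xi c m) * a m)%C.
Proof.
  intros Hxi Hmu Hnu Hc Hd. apply ctame_dom with (1 := Hd) (K := 1 + xi).
  intros m. rewrite Cmod_mult, Cmod_R. apply Rmult_le_compat_r; [apply Cmod_ge_0|].
  now apply weight_bound.
Qed.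

(** Value at [-x] of the weighted Koebe series [sum b_m (m+1) z^m]. *)
Definition koebe (mu nu xi c x : R) : R :=
  PSeries (fun m => weight mu nu xi c m * (INR (S m) * (-1) ^ m)) x.

(** The extremal inequality for the actual weights: among all points of a
    circle and all unimodular [w], the Koebe value at the negative real point
    is the smallest. *)
Lemma Re_weighted_ge_koebe (mu nu xi c : R) (z w : C) :
  0 <= xi <= 1 -> 1 <= mu -> mu <= nu -> -1 < c ->
  c <= (1 + 1 / mu - xi) / (1 + 2 * xi) -> Cmod z < 1 -> Cmod w = 1 ->
  koebe mu nu xi c (Cmod z)
  <= fst (CPS (fun m => RtoC (weight mu nu xi c m)
                        * (1 + (1 + w) / RtoC 2 * RtoC (INR m)))%C z).
Proof.
  intros Hxi Hmu Hnu Hc Hc2 Hz Hw.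
  assert (Hz0 := Cmod_ge_0 z).
  destruct (polar z) as [e [He Ez]].
  set (r := Cmod z) in *. rewrite Ez, Re_CPS_ray. unfold koebe.
  set (p := fun m => fst (RtoC (weight mu nu xi c m)
     * (1 + (1 + w) / RtoC 2 * RtoC (INR m)) * e ^ m)%C).
  set (q := fun m => weight mu nu xi c m * (INR (S m) * (-1) ^ m)).
  assert (Tp : tame p).
  { apply (tame_fst (fun m => RtoC (weight mu nu xi c m)
     * (1 + (1 + w) / RtoC 2 * RtoC (INR m)) * e ^ m)%C).
    apply ctame_ray; [|lra].
    apply ctame_weight; try lra. apply ctame_excess. }
  assert (Tq : tame q).
  { apply tame_weight; try lra. apply tame_alt, tame_S_INR. }
  assert (Hpq : nonneg_on_unit (fun m => weight mu nu xi c m * excess e w m)).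
  { apply weight_nonneg; try lra. split.
    - apply tame_le with (excess e w); [apply tame_excess; lra|].
      intros m. assert (Hm := pos_INR m). unfold Rdiv.
      rewrite Rabs_mult, Rabs_inv, (Rabs_pos_eq (_ * _)) by nra.
      rewrite <- (Rmult_1_r (Rabs (excess e w m))) at 2.
      apply Rmult_le_compat_l; [apply Rabs_pos|].
      rewrite <- Rinv_1. apply Rinv_le_contravar; nra.
    - intros x Hx. now apply excess_base. }
  destruct (Rle_lt_or_eq_dec 0 r Hz0) as [H|H].
  - destruct Hpq as [_ Hpq]. specialize (Hpq r (conj H Hz)).
    assert (Har : Rabs r < 1) by (rewrite Rabs_pos_eq; lra).
    assert (E : PSeries (fun m => weight mu nu xi c m * excess e w m) r
                = 1 * PSeries p r + (-1) * PSeries q r).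
    { rewrite <- PSeries_lin by easy. apply PSeries_ext. intros m.
      unfold p, q, excess. rewrite <- Cmult_assoc.
      change (fst (RtoC ?a * ?b)%C) with (a * fst b - 0 * snd b). ring. }
    fold q. fold p. lra.
  - rewrite <- H, !PSeries_0. unfold q, p. simpl. rewrite weight_0 by easy. lra.
Qed.

(** Before weighting, the derivative in question is [x / (1 + x)^2] up to sign
    and an average. *)
Lemma koebe_decr (mu nu xi c x y : R) :
  0 <= xi <= 1 -> 1 <= mu -> mu <= nu -> -1 < c ->
  c <= (1 + 1 / mu - xi) / (1 + 2 * xi) -> 0 < x -> x <= y -> y < 1 ->
  koebe mu nu xi c y <= koebe mu nu xi c x.
Proof.
  intros Hxi Hmu Hnu Hc Hc2 H0x Hxy Hy1.
  set (q := fun m => weight mu nu xi c m * (INR (S m) * (-1) ^ m)).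
  assert (Tq : tame q).
  { apply tame_weight; try lra. apply tame_alt, tame_S_INR. }
  assert (Hn : nonneg_on_unit
     (fun m => weight mu nu xi c m * (- (INR m * (INR (S m) * (-1) ^ m))))).
  { apply weight_nonneg; try lra.
    assert (T : tame (fun m => - (INR m * (-1) ^ m))).
    { apply tame_opp, tame_alt, tame_INR. }
    apply nonneg_on_unit_ext with (avg 2 (fun m => - (INR m * (-1) ^ m))).
    - intros m. unfold avg. rewrite S_INR. field. assert (H := pos_INR m). lra.
    - split; [apply tame_avg; [lra|easy]|].
      intros u Hu. apply avg_nonneg; [easy|lra| |easy].
      intros v Hv.
      change (0 <= PSeries (PS_opp (fun m => INR m * (-1) ^ m)) v).
      rewrite PSeries_opp, PSeries_alt_INR by (rewrite Rabs_pos_eq; lra).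
      replace (- (- v / (1 + v) ^ 2)) with (v / (1 + v) ^ 2) by (field; lra).
      apply Rdiv_le_0_compat; [lra|]. apply pow_lt. lra. }
  destruct Hn as [_ Hn].
  cut (- koebe mu nu xi c x <= - koebe mu nu xi c y); [lra|].
  apply (derive_nonneg_le (fun u => - PSeries q u) (fun u => - PSeries (PS_derive q) u)); [lra| |].
  - intros u Hu. apply (is_derive_opp (K := R_AbsRing) (V := R_NormedModule)).
    apply is_derive_PSeries, tame_CV_radius; [easy|]. rewrite Rabs_pos_eq; lra.
  - intros u Hu. specialize (Hn u ltac:(lra)).
    apply Rmult_le_reg_l with u; [lra|]. rewrite Rmult_0_r.
    replace (u * - PSeries (PS_derive q) u) with (- (u * PSeries (PS_derive q) u)) by ring.
    rewrite <- PSeries_incr_1, <- PSeries_opp.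
    rewrite (PSeries_ext _ (fun m => weight mu nu xi c m * - (INR m * (INR (S m) * (-1) ^ m)))).
    + easy.
    + intros [|m]; unfold PS_opp, opp; simpl PS_incr_1.
      * simpl. change (- 0 = weight mu nu xi c 0 * - (0 * (1 * 1))). ring.
      * unfold PS_derive, q.
        change (- (INR (S m) * (weight mu nu xi c (S m) * (INR (S (S m)) * (-1) ^ S m)))
          = weight mu nu xi c (S m) * - (INR (S m) * (INR (S (S m)) * (-1) ^ S m))). ring.
Qed.

Lemma koebe_nonneg (mu nu xi c x : R) :
  0 <= xi <= 1 -> 1 <= mu -> mu <= nu -> -1 < c ->
  c <= (1 + 1 / mu - xi) / (1 + 2 * xi) -> 0 < x < 1 ->
  0 <= koebe mu nu xi c x.
Proof.
  intros Hxi Hmu Hnu Hc Hc2 Hx.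
  assert (Hn : nonneg_on_unit (fun m => weight mu nu xi c m * (INR (S m) * (-1) ^ m))).
  { apply weight_nonneg; try lra.
    apply nonneg_on_unit_ext with (avg 2 (fun m => (-1) ^ m)).
    - intros m. unfold avg. rewrite S_INR. field. assert (H := pos_INR m). lra.
    - split; [apply tame_avg; [lra|apply tame_m1_pow]|].
      intros u Hu. apply avg_nonneg; [apply tame_m1_pow|lra| |easy].
      intros v Hv. rewrite PSeries_alt_1 by (rewrite Rabs_pos_eq; lra).
      apply Rdiv_le_0_compat; lra. }
  now apply Hn.
Qed.

Lemma decr_lim_left_1 (F : R -> R) :
  (forall x y, 0 < x -> x <= y -> y < 1 -> F y <= F x) ->
  (forall x, 0 < x < 1 -> 0 <= F x) ->
  exists l : R, filterlim F (at_left 1) (locally l) /\ forall x, 0 < x < 1 -> l <= F x.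
Proof.
  intros Hd Hp.
  destruct (completeness (fun y => exists x, 0 < x < 1 /\ y = - F x)) as [s [Hs1 Hs2]].
  - exists 0. intros y [x [Hx ->]]. specialize (Hp x Hx). lra.
  - exists (- F (1 / 2)), (1 / 2). split; [lra|easy].
  - exists (- s).
    assert (Hl : forall x, 0 < x < 1 -> - s <= F x).
    { intros x Hx. assert (- F x <= s) by (apply Hs1; now exists x). lra. }
    split; [|exact Hl].
    apply filterlim_locally. intros eps. assert (He := cond_pos eps).
    assert (Hex : exists x0, 0 < x0 < 1 /\ F x0 < - s + eps).
    { apply Classical_Prop.NNPP. intros Hn.
      assert (s <= s - eps); [|lra]. apply Hs2. intros y [x [Hx ->]].
      destruct (Rlt_le_dec (F x) (- s + eps)) as [H|H]; [|lra].
      exfalso. apply Hn. now exists x. }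
    destruct Hex as [x0 [Hx0 Hlt]].
    apply filter_imp with (2 := at_left_1_near x0 (proj2 Hx0)). intros x Hx.
    change (Rabs (F x + - - s) < eps).
    assert (H1 := Hl x ltac:(lra)). assert (H2 := Hd x0 x ltac:(lra) ltac:(lra) ltac:(lra)).
    rewrite Rabs_pos_eq; lra.
Qed.

(** * Integrals of continuous complex functions of a real variable *)

Definition Ccont (f : R -> C) (x : R) : Prop :=
  continuous (fun t => fst (f t)) x /\ continuous (fun t => snd (f t)) x.

Definition Cint (f : R -> C) (a b : R) : C :=
  (RInt (fun t => fst (f t)) a b, RInt (fun t => snd (f t)) a b).

Lemma continuous_eps (f : R -> R) (x : R) :
  continuous f x <->
  forall eps, 0 < eps -> exists delta, 0 < delta /\
    forall y, Rabs (y - x) < delta -> Rabs (f y - f x) < eps.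
Proof.
  split.
  - intros H eps Heps.
    destruct (proj1 (filterlim_locally f (f x)) H (mkposreal eps Heps)) as [d Hd].
    exists d. split; [apply cond_pos|]. exact Hd.
  - intros H. apply filterlim_locally. intros eps.
    destruct (H eps (cond_pos eps)) as [d [Hd H1]].
    exists (mkposreal d Hd). exact H1.
Qed.

Lemma Ccont_eps (f : R -> C) (x : R) :
  Ccont f x <->
  forall eps, 0 < eps -> exists delta, 0 < delta /\
    forall y, Rabs (y - x) < delta -> Cmod (f y - f x)%C < eps.
Proof.
  unfold Ccont. rewrite !continuous_eps. split.
  - intros [H1 H2] eps Heps.
    destruct (H1 (eps / 2)) as [d1 [Hd1 D1]]; [lra|].
    destruct (H2 (eps / 2)) as [d2 [Hd2 D2]]; [lra|].
    exists (Rmin d1 d2). split; [now apply Rmin_pos|]. intros y Hy.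
    specialize (D1 y (Rlt_le_trans _ _ _ Hy (Rmin_l _ _))).
    specialize (D2 y (Rlt_le_trans _ _ _ Hy (Rmin_r _ _))).
    apply Rle_lt_trans with (1 := Cmod_2Rmax _).
    assert (Hs : sqrt 2 < 2).
    { rewrite <- (sqrt_pow2 2) at 2 by lra. apply sqrt_lt_1; simpl; lra. }
    assert (HM : Rmax (Rabs (fst (f y - f x)%C)) (Rabs (snd (f y - f x)%C)) < eps / 2).
    { apply Rmax_lub_lt; assumption. }
    assert (0 <= Rmax (Rabs (fst (f y - f x)%C)) (Rabs (snd (f y - f x)%C))).
    { apply Rle_trans with (2 := Rmax_l _ _). apply Rabs_pos. }
    nra.
  - intros H. split; intros eps Heps; destruct (H eps Heps) as [d [Hd D]];
      exists d; split; auto; intros y Hy; specialize (D y Hy);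
      apply Rle_lt_trans with (2 := D).
    + apply (fst_le_Cmod (f y - f x)%C).
    + apply (snd_le_Cmod (f y - f x)%C).
Qed.

Lemma Ccont_const (k : C) (x : R) : Ccont (fun _ => k) x.
Proof. split; apply continuous_const. Qed.

Lemma Ccont_plus (f g : R -> C) (x : R) :
  Ccont f x -> Ccont g x -> Ccont (fun t => f t + g t)%C x.
Proof.
  intros [H1 H2] [H3 H4]. split.
  - now apply (continuous_plus (fun t => fst (f t)) (fun t => fst (g t))).
  - now apply (continuous_plus (fun t => snd (f t)) (fun t => snd (g t))).
Qed.

Lemma Ccont_mult (f g : R -> C) (x : R) :
  Ccont f x -> Ccont g x -> Ccont (fun t => f t * g t)%C x.
Proof.
  intros [H1 H2] [H3 H4]. split.
  - apply (continuous_minus (fun t => fst (f t) * fst (g t)) (fun t => snd (f t) * snd (g t))).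
    + now apply (continuous_mult (fun t => fst (f t)) (fun t => fst (g t))).
    + now apply (continuous_mult (fun t => snd (f t)) (fun t => snd (g t))).
  - apply (continuous_plus (fun t => fst (f t) * snd (g t)) (fun t => snd (f t) * fst (g t))).
    + now apply (continuous_mult (fun t => fst (f t)) (fun t => snd (g t))).
    + now apply (continuous_mult (fun t => snd (f t)) (fun t => fst (g t))).
Qed.

Lemma Ccont_conj (f : R -> C) (x : R) : Ccont f x -> Ccont (fun t => Cconj (f t)) x.
Proof.
  intros [H1 H2]. split; [exact H1|].
  now apply (continuous_opp (fun t => snd (f t))).
Qed.

Lemma Ccont_pow (f : R -> C) (n : nat) (x : R) :
  Ccont f x -> Ccont (fun t => f t ^ n)%C x.
Proof.
  intros H. induction n as [|n IH]; [apply Ccont_const|].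
  now apply Ccont_mult.
Qed.

Lemma Ccont_ext (f g : R -> C) (x : R) :
  (forall t, f t = g t) -> Ccont f x -> Ccont g x.
Proof.
  intros H [H1 H2]. split.
  - apply continuous_ext with (2 := H1). intros t. now rewrite H.
  - apply continuous_ext with (2 := H2). intros t. now rewrite H.
Qed.

Definition Cintegrable (f : R -> C) (a b : R) : Prop :=
  ex_RInt (fun t => fst (f t)) a b /\ ex_RInt (fun t => snd (f t)) a b.

Lemma Ccont_integrable (f : R -> C) (a b : R) :
  a <= b -> (forall t, a <= t <= b -> Ccont f t) -> Cintegrable f a b.
Proof.
  intros Hab H. split; apply (ex_RInt_continuous (V := R_CompleteNormedModule));
    rewrite Rmin_left, Rmax_right by easy; intros t Ht; now apply H.
Qed.

Lemma Cintegrable_const (k : C) (a b : R) : Cintegrable (fun _ => k) a b.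
Proof. split; apply (ex_RInt_const (V := R_NormedModule)). Qed.

Lemma Cintegrable_plus (f g : R -> C) (a b : R) :
  Cintegrable f a b -> Cintegrable g a b -> Cintegrable (fun t => f t + g t)%C a b.
Proof.
  intros [H1 H2] [H3 H4]. split.
  - now apply (ex_RInt_plus (V := R_NormedModule) (fun t => fst (f t)) (fun t => fst (g t))).
  - now apply (ex_RInt_plus (V := R_NormedModule) (fun t => snd (f t)) (fun t => snd (g t))).
Qed.

Lemma Cintegrable_scal (k : C) (f : R -> C) (a b : R) :
  Cintegrable f a b -> Cintegrable (fun t => k * f t)%C a b.
Proof.
  intros [H1 H2]. split.
  - apply (ex_RInt_minus (V := R_NormedModule) (fun t => fst k * fst (f t)) (fun t => snd k * snd (f t)));
      now apply (ex_RInt_scal (V := R_NormedModule)).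
  - apply (ex_RInt_plus (V := R_NormedModule) (fun t => fst k * snd (f t)) (fun t => snd k * fst (f t)));
      now apply (ex_RInt_scal (V := R_NormedModule)).
Qed.

Lemma Cintegrable_ext (f g : R -> C) (a b : R) :
  (forall t, f t = g t) -> Cintegrable f a b -> Cintegrable g a b.
Proof.
  intros H [H1 H2]. split.
  - apply (ex_RInt_ext (V := R_NormedModule)) with (2 := H1). intros t _. now rewrite H.
  - apply (ex_RInt_ext (V := R_NormedModule)) with (2 := H2). intros t _. now rewrite H.
Qed.

Lemma Cint_ext (f g : R -> C) (a b : R) :
  (forall t, f t = g t) -> Cint f a b = Cint g a b.
Proof.
  intros H. unfold Cint. f_equal; apply (RInt_ext (V := R_CompleteNormedModule));
    intros t _; now rewrite H.
Qed.

Lemma Cint_plus (f g : R -> C) (a b : R) :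
  Cintegrable f a b -> Cintegrable g a b ->
  Cint (fun t => f t + g t)%C a b = (Cint f a b + Cint g a b)%C.
Proof.
  intros [H1 H2] [H3 H4]. unfold Cint, Cplus; simpl. f_equal.
  - now apply (RInt_plus (V := R_CompleteNormedModule) (fun t => fst (f t)) (fun t => fst (g t))).
  - now apply (RInt_plus (V := R_CompleteNormedModule) (fun t => snd (f t)) (fun t => snd (g t))).
Qed.

Lemma Cint_scal (k : C) (f : R -> C) (a b : R) :
  Cintegrable f a b -> Cint (fun t => k * f t)%C a b = (k * Cint f a b)%C.
Proof.
  intros [H1 H2]. unfold Cint, Cmult; simpl.
  assert (E : forall (l : R) (u : R -> R), ex_RInt u a b ->
            RInt (fun t => l * u t) a b = l * RInt u a b).
  { intros l u Hu. now apply (RInt_scal (V := R_CompleteNormedModule) u). }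
  assert (X : forall (l : R) (u : R -> R), ex_RInt u a b -> ex_RInt (fun t => l * u t) a b).
  { intros l u Hu. now apply (ex_RInt_scal (V := R_NormedModule) u). }
  f_equal.
  - rewrite <- !E by assumption.
    now apply (RInt_minus (V := R_CompleteNormedModule) (fun t => fst k * fst (f t))
             (fun t => snd k * snd (f t))); apply X.
  - rewrite <- !E by assumption.
    now apply (RInt_plus (V := R_CompleteNormedModule) (fun t => fst k * snd (f t))
             (fun t => snd k * fst (f t))); apply X.
Qed.

Lemma Cint_conj (f : R -> C) (a b : R) :
  Cintegrable f a b -> Cint (fun t => Cconj (f t)) a b = Cconj (Cint f a b).
Proof.
  intros [H1 H2]. unfold Cint, Cconj; simpl. f_equal.
  now apply (RInt_opp (V := R_CompleteNormedModule) (fun t => snd (f t))).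
Qed.

Lemma Cint_const (k : C) (a b : R) : Cint (fun _ => k) a b = (RtoC (b - a) * k)%C.
Proof.
  unfold Cint. rewrite !(RInt_const (V := R_CompleteNormedModule)).
  unfold Cmult; simpl. unfold scal; simpl; unfold mult; simpl. f_equal; ring.
Qed.

Lemma Cint_Chasles (f : R -> C) (a b c : R) :
  Cintegrable f a b -> Cintegrable f b c ->
  Cint f a c = (Cint f a b + Cint f b c)%C.
Proof.
  intros [H1 H2] [H3 H4]. unfold Cint, Cplus; simpl. f_equal; symmetry.
  - now apply (RInt_Chasles (V := R_CompleteNormedModule) (fun t => fst (f t))).
  - now apply (RInt_Chasles (V := R_CompleteNormedModule) (fun t => snd (f t))).
Qed.

Lemma Cint_shift (f : R -> C) (v a b : R) :
  Cintegrable f (a + v) (b + v) -> Cint (fun t => f (t + v)) a b = Cint f (a + v) (b + v).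
Proof.
  intros [H1 H2]. unfold Cint.
  assert (K : forall u : R -> R, ex_RInt u (a + v) (b + v) ->
      RInt (fun t => u (t + v)) a b = RInt u (a + v) (b + v)).
  { intros u Hu.
    assert (E := RInt_comp_lin (V := R_CompleteNormedModule) u 1 v a b).
    rewrite !Rmult_1_l in E. rewrite <- E by easy.
    apply (RInt_ext (V := R_CompleteNormedModule)). intros t _.
    change (u (t + v) = 1 * u (1 * t + v)). now rewrite !Rmult_1_l. }
  f_equal.
  - apply (K (fun t => fst (f t)) H1).
  - apply (K (fun t => snd (f t)) H2).
Qed.

Lemma Cmod_Cint_le (f : R -> C) (a b M : R) :
  a <= b -> Cintegrable f a b -> (forall t, a <= t <= b -> Cmod (f t) <= M) ->
  Cmod (Cint f a b) <= (b - a) * M.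
Proof.
  intros Hab Hf HM.
  destruct (Cmod_unit (Cint f a b)) as [k [Hk E]].
  rewrite <- (Cint_scal k f a b Hf) in E.
  apply (f_equal fst) in E. simpl in E. rewrite <- E.
  apply Rle_trans with (1 := Rle_abs _).
  apply abs_RInt_le_const; [easy|apply (Cintegrable_scal k f a b Hf)|].
  intros t Ht. apply Rle_trans with (1 := fst_le_Cmod (k * f t)%C).
  rewrite Cmod_mult, Hk, Rmult_1_l. now apply HM.
Qed.

Lemma Series_tail_small (B : nat -> R) (eps : R) :
  ex_series B -> 0 < eps -> exists N, Rabs (Series (fun n => B (N + n)%nat)) < eps.
Proof.
  intros HB He.
  assert (HL : is_lim_seq (sum_n B) (Series B)) by exact (Series_correct B HB).
  apply is_lim_seq_spec in HL. destruct (HL (mkposreal eps He)) as [N HN].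
  exists (S N). specialize (HN N (Nat.le_refl _)). simpl in HN.
  rewrite (Series_incr_n B (S N)) in HN by (lia || easy).
  rewrite <- Rabs_Ropp. simpl pred in HN.
  rewrite sum_n_Reals in HN.
  replace (sum_f_R0 B N - (sum_f_R0 B N + Series (fun k => B (S N + k)%nat)))
    with (- Series (fun k => B (S N + k)%nat)) in HN by ring.
  exact HN.
Qed.

Lemma Cmod_eq_0_of_lt (z : C) : (forall eps, 0 < eps -> Cmod z <= eps) -> z = RtoC 0.
Proof.
  intros H. apply Cmod_eq_0. destruct (Rle_lt_or_eq_dec _ _ (Cmod_ge_0 z)) as [E|E]; [|easy].
  assert (H1 := H (Cmod z / 2) ltac:(lra)). lra.
Qed.

(** Uniformly dominated series may be integrated term by term: stripping the
    first [N] terms changes neither side of the difference, and both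
    remainders are bounded by the tail of [B]. *)
Lemma Cint_Csum (u : nat -> R -> C) (B : nat -> R) (a b : R) :
  a <= b -> ex_series B ->
  (forall n t, Cmod (u n t) <= B n) ->
  (forall n, Cintegrable (u n) a b) ->
  Cintegrable (fun t => Csum (fun n => u n t)) a b ->
  Cint (fun t => Csum (fun n => u n t)) a b = Csum (fun n => Cint (u n) a b).
Proof.
  intros Hab HB Hu Hi Hs.
  assert (Hsum : forall t, Cabs_summable (fun n => u n t)).
  { intros t. now apply Cabs_summable_le with B. }
  assert (Hci : forall n, Cmod (Cint (u n) a b) <= (b - a) * B n).
  { intros n. apply Cmod_Cint_le; auto. }
  assert (HBa : ex_series (fun n => (b - a) * B n)) by now apply (@ex_series_scal_l R_AbsRing).
  assert (Hsi : Cabs_summable (fun n => Cint (u n) a b)) by now apply Cabs_summable_le with (2 := HBa).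
  assert (Hstrip : forall N,
     Cintegrable (fun t => Csum (fun n => u (N + n)%nat t)) a b /\
     (forall t, Cabs_summable (fun n => u (N + n)%nat t)) /\
     Cabs_summable (fun n => Cint (u (N + n)%nat) a b) /\
     (Cint (fun t => Csum (fun n => u n t)) a b - Csum (fun n => Cint (u n) a b)
      = Cint (fun t => Csum (fun n => u (N + n)%nat t)) a b
        - Csum (fun n => Cint (u (N + n)%nat) a b))%C).
  { induction N as [|N [I1 [I2 [I3 I4]]]]; [repeat split; auto; apply Hs|].
    assert (ES : forall n, (S N + n = N + S n)%nat) by (intros; lia).
    assert (J2 : forall t, Cabs_summable (fun n => u (S N + n)%nat t)).
    { intros t. apply Cabs_summable_ext with (fun n => u (N + S n)%nat t).
      - intros n. now rewrite ES.
      - now apply (Cabs_summable_S (fun n => u (N + n)%nat t)). }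
    assert (J3 : Cabs_summable (fun n => Cint (u (S N + n)%nat) a b)).
    { apply Cabs_summable_ext with (fun n => Cint (u (N + S n)%nat) a b).
      - intros n. now rewrite ES.
      - now apply (Cabs_summable_S (fun n => Cint (u (N + n)%nat) a b)). }
    assert (Et : forall t, Csum (fun n => u (S N + n)%nat t)
       = (Csum (fun n => u (N + n)%nat t) + (-1) * u N t)%C).
    { intros t. rewrite (Csum_S _ (I2 t)). rewrite Nat.add_0_r.
      rewrite (Csum_ext (fun n => u (N + S n)%nat t) (fun n => u (S N + n)%nat t)).
      - ring.
      - intros n. now rewrite ES. }
    assert (J1 : Cintegrable (fun t => Csum (fun n => u (N + n)%nat t) + (-1) * u N t)%C a b).
    { apply Cintegrable_plus; [easy|]. now apply Cintegrable_scal. }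
    split; [|split; [|split]]; auto.
    - apply Cintegrable_ext with (2 := J1). intros t. now rewrite Et.
    - rewrite I4, (Cint_ext _ _ a b Et).
      rewrite Cint_plus, Cint_scal by (auto; now apply Cintegrable_scal).
      rewrite (Csum_S _ I3). rewrite Nat.add_0_r.
      rewrite (Csum_ext (fun n => Cint (u (N + S n)%nat) a b)
                        (fun n => Cint (u (S N + n)%nat) a b)).
      + ring.
      + intros n. now rewrite ES. }
  assert (Hz : (Cint (fun t => Csum (fun n => u n t)) a b
                - Csum (fun n => Cint (u n) a b))%C = RtoC 0).
  { apply Cmod_eq_0_of_lt. intros eps He.
    destruct (Series_tail_small B (eps / (2 * (b - a) + 1)) HB) as [N HN].
    { apply Rdiv_lt_0_compat; lra. }
    destruct (Hstrip N) as [I1 [I2 [I3 I4]]]. rewrite I4.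
    assert (HBN : ex_series (fun n => B (N + n)%nat)) by now apply ex_series_incr_n.
    set (T := Series (fun n => B (N + n)%nat)) in *.
    assert (L1 : Cmod (Cint (fun t => Csum (fun n => u (N + n)%nat t)) a b) <= (b - a) * T).
    { apply Cmod_Cint_le; auto. intros t Ht. apply Cmod_Csum_le; auto. }
    assert (L2 : Cmod (Csum (fun n => Cint (u (N + n)%nat) a b)) <= (b - a) * T).
    { unfold T. rewrite <- Series_scal_l. apply Cmod_Csum_le; auto.
      now apply (@ex_series_scal_l R_AbsRing). }
    apply Rle_trans with (1 := Cmod_triangle _ _). rewrite Cmod_opp.
    assert (HT := Rle_abs T).
    apply Rlt_div_r in HN; [|lra].
    assert (0 <= Rabs T) by apply Rabs_pos. nra. }
  transitivity ((Cint (fun t => Csum (fun n => u n t)) a b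
                - Csum (fun n => Cint (u n) a b)) + Csum (fun n => Cint (u n) a b))%C; [ring|].
  rewrite Hz. ring.
Qed.

(** * Goursat's theorem for rectangles *)

Definition holo (G : C -> C) (z : C) : Prop := @ex_derive C_AbsRing C_NormedModule G z.

Definition Ccontinuous_at (F : C -> C) (z : C) : Prop :=
  forall eps, 0 < eps -> exists delta, 0 < delta /\
    forall h, Cmod h < delta -> Cmod (F (z + h) - F z)%C < eps.

Lemma holo_continuous (G : C -> C) (z : C) : holo G z -> Ccontinuous_at G z.
Proof.
  intros [l Hl] eps He. rewrite C_is_derive_iff in Hl.
  destruct (Hl 1 Rlt_0_1) as [d [Hd H]].
  assert (Hl0 := Cmod_ge_0 l).
  exists (Rmin d (eps / (Cmod l + 2))). split.
  { apply Rmin_pos; [easy|]. apply Rdiv_lt_0_compat; lra. }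
  intros h Hh.
  specialize (H h (Rlt_le_trans _ _ _ Hh (Rmin_l _ _))).
  assert (H2 := Rlt_le_trans _ _ _ Hh (Rmin_r _ _)).
  apply Rlt_div_r in H2; [|lra].
  replace (G (z + h) - G z)%C with ((G (z + h) - G z - h * l) + h * l)%C by ring.
  apply Rle_lt_trans with (1 := Cmod_triangle _ _).
  rewrite Cmod_mult. assert (H3 := Cmod_ge_0 h). nra.
Qed.

Lemma Ccont_comp (G : C -> C) (p : R -> C) (x : R) :
  Ccontinuous_at G (p x) ->
  Ccont p x -> Ccont (fun t => G (p t)) x.
Proof.
  intros HG Hp. apply Ccont_eps. intros eps He.
  destruct (HG eps He) as [d [Hd H1]].
  destruct (proj1 (Ccont_eps p x) Hp d Hd) as [d2 [Hd2 H2]].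
  exists d2. split; [easy|]. intros y Hy.
  specialize (H1 _ (H2 y Hy)).
  replace (p x + (p y - p x))%C with (p y) in H1 by ring. exact H1.
Qed.

Lemma Ccont_CPS (h : nat -> C) (p : R -> C) (t : R) :
  ctame h -> Cmod (p t) < 1 -> Ccont p t -> Ccont (fun t => CPS h (p t)) t.
Proof.
  intros Hh Hp. apply (Ccont_comp (CPS h) p), holo_continuous.
  eexists. now apply CPS_is_derive.
Qed.

Lemma Ccont_hor (x y : R) : Ccont (fun s => (s, y)) x.
Proof. split; [apply continuous_id|apply continuous_const]. Qed.

Lemma Ccont_ver (x y : R) : Ccont (fun t => (x, t)) y.
Proof. split; [apply continuous_const|apply continuous_id]. Qed.

Lemma Cmod_pair_le (a b : R) : Cmod (a, b) <= Rabs a + Rabs b.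
Proof.
  replace (a, b) with (RtoC a + Ci * RtoC b)%C.
  - apply Rle_trans with (1 := Cmod_triangle _ _).
    rewrite Cmod_mult, Cmod_Ci, !Cmod_R. lra.
  - unfold Cplus, Cmult, Ci, RtoC; simpl. f_equal; ring.
Qed.

Definition holo_rect (G : C -> C) (x y w h : R) : Prop :=
  forall u v, x <= u <= x + w -> y <= v <= y + h -> holo G (u, v).

Definition bdry (G : C -> C) (x y w h : R) : C :=
  (Cint (fun s => G (s, y)) x (x + w) - Cint (fun s => G (s, y + h)%R) x (x + w)
   + Ci * Cint (fun t => G ((x + w)%R, t)) y (y + h)
   - Ci * Cint (fun t => G (x, t)) y (y + h))%C.

Lemma Cint_hor_ok (G : C -> C) (a b y : R) :
  a <= b -> (forall u, a <= u <= b -> holo G (u, y)) ->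
  Cintegrable (fun s => G (s, y)) a b.
Proof.
  intros Hab H. apply Ccont_integrable; [easy|]. intros t Ht.
  apply (Ccont_comp G (fun s => (s, y))); [|apply Ccont_hor].
  apply holo_continuous. now apply H.
Qed.

Lemma Cint_ver_ok (G : C -> C) (a b x : R) :
  a <= b -> (forall v, a <= v <= b -> holo G (x, v)) ->
  Cintegrable (fun t => G (x, t)) a b.
Proof.
  intros Hab H. apply Ccont_integrable; [easy|]. intros t Ht.
  apply (Ccont_comp G (fun t => (x, t))); [|apply Ccont_ver].
  apply holo_continuous. now apply H.
Qed.

Lemma bdry_quarters (G : C -> C) (x y w h : R) :
  0 <= w -> 0 <= h -> holo_rect G x y (w + w) (h + h) ->
  bdry G x y (w + w) (h + h)
  = (bdry G x y w h + bdry G (x + w) y w h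
     + bdry G x (y + h) w h + bdry G (x + w) (y + h) w h)%C.
Proof.
  intros Hw Hh HG. unfold bdry.
  rewrite <- !Rplus_assoc.
  assert (HH : forall v, y <= v <= y + h + h ->
     Cint (fun s => G (s, v)) x (x + w + w)
     = (Cint (fun s => G (s, v)) x (x + w) + Cint (fun s => G (s, v)) (x + w) (x + w + w))%C).
  { intros v Hv. apply Cint_Chasles; apply Cint_hor_ok; try lra;
      intros u Hu; apply HG; lra. }
  assert (HV : forall u, x <= u <= x + w + w ->
     Cint (fun t => G (u, t)) y (y + h + h)
     = (Cint (fun t => G (u, t)) y (y + h) + Cint (fun t => G (u, t)) (y + h) (y + h + h))%C).
  { intros u Hu. apply Cint_Chasles; apply Cint_ver_ok; try lra;
      intros v Hv; apply HG; lra. }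
  rewrite !HH, !HV by lra. ring.
Qed.

Lemma Cint_affine (P Q : C) (a b : R) :
  Cint (fun t => P + RtoC t * Q)%C a b
  = (RtoC (b - a) * P + RtoC ((b ^ 2 - a ^ 2) / 2) * Q)%C.
Proof.
  assert (K : forall p q, RInt (fun t => p + t * q) a b = (b - a) * p + (b ^ 2 - a ^ 2) / 2 * q).
  { intros p q. apply is_RInt_unique.
    replace ((b - a) * p + (b ^ 2 - a ^ 2) / 2 * q)
      with ((p * b + b ^ 2 / 2 * q) - (p * a + a ^ 2 / 2 * q)) by field.
    assert (D1 : forall t : R, is_derive (fun t => p * t + t ^ 2 / 2 * q) t (p + t * q)).
    { intros t. auto_derive; [easy|]. field. }
    assert (D2 : forall t : R, ex_derive (fun t => p + t * q) t).
    { intros t. auto_derive. easy. }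
    apply (is_RInt_derive (V := R_CompleteNormedModule) (fun t => p * t + t ^ 2 / 2 * q)).
    - intros t _. apply D1.
    - intros t _. apply ex_derive_cont.
      apply D2. }
  unfold Cint. destruct P as [p1 p2], Q as [q1 q2].
  unfold Cplus, Cmult, RtoC; simpl fst; simpl snd. f_equal.
  - rewrite (RInt_ext (V := R_CompleteNormedModule) _ (fun t => p1 + t * q1)).
    + match goal with |- @eq _ ?u ?v => change (@eq R u v) end. rewrite K. field.
    + intros t _. match goal with |- @eq _ ?u ?v => change (@eq R u v) end. simpl. ring.
  - rewrite (RInt_ext (V := R_CompleteNormedModule) _ (fun t => p2 + t * q2)).
    + match goal with |- @eq _ ?u ?v => change (@eq R u v) end. rewrite K. field.
    + intros t _. match goal with |- @eq _ ?u ?v => change (@eq R u v) end. simpl. ring.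
Qed.

Lemma pair_RtoC (x y : R) : (x, y) = (RtoC x + Ci * RtoC y)%C.
Proof. unfold Cplus, Cmult, Ci, RtoC; simpl. f_equal; ring. Qed.

(** Along a straight edge, the integral of [G] is that of its first order
    error [E] at [s0] plus an explicit affine contribution. *)
Lemma edge_error (G : C -> C) (s0 l q0 q1 : C) (a b eps : R) :
  let E := fun z : C => (G z - G s0 - (z - s0) * l)%C in
  a <= b -> Cintegrable (fun t => G (q0 + RtoC t * q1)%C) a b ->
  (forall t, a <= t <= b -> Cmod (E (q0 + RtoC t * q1)%C) <= eps) ->
  exists I, Cmod I <= (b - a) * eps /\
    Cint (fun t => G (q0 + RtoC t * q1)%C) a b
    = (I + (RtoC (b - a) * (G s0 + (q0 - s0) * l)
            + RtoC ((b ^ 2 - a ^ 2) / 2) * (q1 * l)))%C.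
Proof.
  intros E Hab IG Hest.
  set (A := fun t => (G s0 + (q0 - s0) * l + RtoC t * (q1 * l))%C).
  assert (IA : Cintegrable A a b).
  { apply Ccont_integrable; [easy|]. intros t _.
    apply Ccont_plus; [apply Ccont_const|].
    apply Ccont_mult; [|apply Ccont_const].
    split; [apply continuous_id|apply continuous_const]. }
  assert (HE : forall t, (G (q0 + RtoC t * q1) + (-1) * A t)%C = E (q0 + RtoC t * q1)%C).
  { intros t. unfold E, A. ring. }
  assert (IE : Cintegrable (fun t => E (q0 + RtoC t * q1)%C) a b).
  { apply Cintegrable_ext with (1 := HE).
    apply Cintegrable_plus; [easy|]. now apply Cintegrable_scal. }
  exists (Cint (fun t => E (q0 + RtoC t * q1)%C) a b). split.
  - now apply Cmod_Cint_le.
  - rewrite <- (Cint_ext _ _ a b HE).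
    rewrite Cint_plus, Cint_scal by (auto; now apply Cintegrable_scal).
    unfold A. rewrite Cint_affine. ring.
Qed.

(** Affine functions have zero boundary integral, so only the error of the
    first order expansion counts. *)
Lemma bdry_small (G : C -> C) (x y w h eps : R) (s0 l : C) :
  0 <= w -> 0 <= h -> holo_rect G x y w h ->
  (forall u v, x <= u <= x + w -> y <= v <= y + h ->
     Cmod (G (u, v) - G s0 - ((u, v) - s0) * l)%C <= eps) ->
  Cmod (bdry G x y w h) <= 2 * (w + h) * eps.
Proof.
  intros Hw Hh HG Hest.
  assert (Ph : forall v t : R, (t, v) = (Ci * RtoC v + RtoC t * 1)%C :> C).
  { intros v t. rewrite pair_RtoC. ring. }
  assert (Pv : forall u t : R, (u, t) = (RtoC u + RtoC t * Ci)%C :> C).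
  { intros u t. rewrite pair_RtoC. ring. }
  assert (HEh : forall v, y <= v <= y + h -> exists I, Cmod I <= (x + w - x) * eps /\
     Cint (fun s => G (s, v)) x (x + w)
     = (I + (RtoC (x + w - x) * (G s0 + (Ci * RtoC v - s0) * l)
             + RtoC (((x + w) ^ 2 - x ^ 2) / 2) * (1 * l)))%C).
  { intros v Hv.
    rewrite (Cint_ext _ (fun s => G (Ci * RtoC v + RtoC s * 1)%C)) by (intros t; now rewrite Ph).
    apply edge_error; [lra| |].
    - apply Cintegrable_ext with (fun s => G (s, v)); [intros t; now rewrite Ph|].
      apply Cint_hor_ok; [lra|]. intros u Hu. now apply HG.
    - intros t Ht. rewrite <- Ph. now apply Hest. }
  assert (HEv : forall u, x <= u <= x + w -> exists I, Cmod I <= (y + h - y) * eps /\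
     Cint (fun t => G (u, t)) y (y + h)
     = (I + (RtoC (y + h - y) * (G s0 + (RtoC u - s0) * l)
             + RtoC (((y + h) ^ 2 - y ^ 2) / 2) * (Ci * l)))%C).
  { intros u Hu.
    rewrite (Cint_ext _ (fun s => G (RtoC u + RtoC s * Ci)%C)) by (intros t; now rewrite Pv).
    apply edge_error; [lra| |].
    - apply Cintegrable_ext with (fun s => G (u, s)); [intros t; now rewrite Pv|].
      apply Cint_ver_ok; [lra|]. intros v Hv. now apply HG.
    - intros t Ht. rewrite <- Pv. now apply Hest. }
  destruct (HEh y ltac:(lra)) as [I1 [B1 E1]].
  destruct (HEh (y + h) ltac:(lra)) as [I2 [B2 E2]].
  destruct (HEv (x + w) ltac:(lra)) as [I3 [B3 E3]].
  destruct (HEv x ltac:(lra)) as [I4 [B4 E4]].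
  unfold bdry. rewrite E1, E2, E3, E4.
  match goal with |- Cmod ?X <= _ =>
    replace X with ((I1 + - I2) + (Ci * I3 + - (Ci * I4)))%C end.
  2:{ rewrite !RtoC_minus, !RtoC_plus. ring. }
  apply Rle_trans with (1 := Cmod_triangle _ _).
  apply Rle_trans with ((Cmod I1 + Cmod (- I2)%C) + (Cmod (Ci * I3)%C + Cmod (- (Ci * I4))%C)).
  { apply Rplus_le_compat; apply Cmod_triangle. }
  rewrite !Cmod_opp, !Cmod_mult, !Cmod_Ci. lra.
Qed.

Lemma nested_point (u : nat -> R) (w : R) :
  (forall n, u n <= u (S n) <= u n + w / 2 ^ (S n)) ->
  exists l, forall n, u n <= l <= u n + w / 2 ^ n.
Proof.
  intros H.
  assert (Hw : forall n, w / 2 ^ n = w / 2 ^ (S n) + w / 2 ^ (S n)).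
  { intros n. simpl. field. apply pow_nonzero. lra. }
  assert (H1 : forall n k, u n <= u (n + k)%nat /\ u (n + k)%nat + w / 2 ^ (n + k) <= u n + w / 2 ^ n).
  { intros n. induction k as [|k IH].
    - rewrite Nat.add_0_r. lra.
    - rewrite Nat.add_succ_r. specialize (H (n + k)%nat). specialize (Hw (n + k)%nat). lra. }
  assert (Hpos : forall n, 0 <= w / 2 ^ n).
  { intros n. specialize (Hw n). specialize (H n). lra. }
  assert (H2 : forall n m, u m <= u n + w / 2 ^ n).
  { intros n m. destruct (Nat.le_ge_cases n m) as [L|L].
    - replace m with (n + (m - n))%nat by lia.
      destruct (H1 n (m - n)%nat) as [_ K]. specialize (Hpos (n + (m - n))%nat). lra.
    - replace n with (m + (n - m))%nat by lia.
      destruct (H1 m (n - m)%nat) as [K _]. specialize (Hpos (m + (n - m))%nat). lra. }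
  destruct (completeness (fun y => exists n, y = u n)) as [l [L1 L2]].
  - exists (u 0%nat + w / 2 ^ 0). intros y [n ->]. apply H2.
  - exists (u 0%nat). now exists 0%nat.
  - exists l. intros n. split.
    + apply L1. now exists n.
    + apply L2. intros y [m ->]. apply H2.
Qed.

(** Bisection.  The bound [eps * (w + h)^2] is additive under division into
    quarters, so a rectangle that violates it contains a nested sequence of
    violators; near the common point this contradicts differentiability. *)
Lemma goursat (G : C -> C) (x y w h : R) :
  0 < w -> 0 < h -> holo_rect G x y w h -> bdry G x y w h = RtoC 0.
Proof.
  intros Hw Hh HG. apply Cmod_eq_0_of_lt. intros eps He0.
  set (eps' := eps / (w + h) ^ 2).
  assert (Hwh : 0 < (w + h) ^ 2) by (apply pow_lt; lra).
  assert (He : 0 < eps') by now apply Rdiv_lt_0_compat.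
  set (wn := fun n => w / 2 ^ n). set (hn := fun n => h / 2 ^ n).
  set (bd := fun n => eps' * (wn n + hn n) ^ 2).
  set (viol := fun (p : R * R) n => bd n < Cmod (bdry G (fst p) (snd p) (wn n) (hn n))).
  assert (Hwn : forall n, wn n = wn (S n) + wn (S n)).
  { intros n. unfold wn. simpl. field. apply pow_nonzero. lra. }
  assert (Hhn : forall n, hn n = hn (S n) + hn (S n)).
  { intros n. unfold hn. simpl. field. apply pow_nonzero. lra. }
  assert (Pw : forall n, 0 < wn n).
  { intros n. apply Rdiv_lt_0_compat; [easy|]. apply pow_lt. lra. }
  assert (Ph : forall n, 0 < hn n).
  { intros n. apply Rdiv_lt_0_compat; [easy|]. apply pow_lt. lra. }
  destruct (Rle_lt_dec (Cmod (bdry G x y w h)) eps) as [Hle|Hgt]; [easy|exfalso].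
  set (nxt := fun (p : R * R) n =>
    let (a, b) := p in
    if Rlt_dec (bd (S n)) (Cmod (bdry G a b (wn (S n)) (hn (S n)))) then (a, b)
    else if Rlt_dec (bd (S n)) (Cmod (bdry G (a + wn (S n)) b (wn (S n)) (hn (S n))))
         then (a + wn (S n), b)
    else if Rlt_dec (bd (S n)) (Cmod (bdry G a (b + hn (S n)) (wn (S n)) (hn (S n))))
         then (a, b + hn (S n))
    else (a + wn (S n), b + hn (S n))).
  set (sq := fix sq n := match n with 0%nat => (x, y) | S m => nxt (sq m) m end).
  assert (Hstep : forall n,
     fst (sq n) <= fst (sq (S n)) <= fst (sq n) + wn (S n) /\
     snd (sq n) <= snd (sq (S n)) <= snd (sq n) + hn (S n)).
  { intros n. change (sq (S n)) with (nxt (sq n) n).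
    destruct (sq n) as [a b]. unfold nxt.
    specialize (Pw (S n)). specialize (Ph (S n)).
    repeat destruct Rlt_dec; simpl; lra. }
  assert (Hin : forall n,
     x <= fst (sq n) /\ fst (sq n) + wn n <= x + w /\
     y <= snd (sq n) /\ snd (sq n) + hn n <= y + h).
  { induction n as [|n IH].
    - unfold wn, hn. simpl. lra.
    - specialize (Hstep n). specialize (Hwn n). specialize (Hhn n). lra. }
  assert (Hsub : forall n, holo_rect G (fst (sq n)) (snd (sq n)) (wn n) (hn n)).
  { intros n u v Hu Hv. specialize (Hin n). apply HG; lra. }
  assert (Hviol : forall n, viol (sq n) n).
  { induction n as [|n IH].
    - unfold viol, bd, wn, hn. simpl fst. simpl snd. simpl pow.
      unfold Rdiv. rewrite Rinv_1, !Rmult_1_r.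
      apply Rle_lt_trans with (2 := Hgt). unfold eps'. apply Req_le. field. lra.
    - change (sq (S n)) with (nxt (sq n) n).
      specialize (Hsub n). unfold viol in *.
      destruct (sq n) as [a b]. simpl fst in *. simpl snd in *.
      assert (Hq := bdry_quarters G a b (wn (S n)) (hn (S n))
         (Rlt_le _ _ (Pw _)) (Rlt_le _ _ (Ph _))).
      rewrite <- Hwn, <- Hhn in Hq. specialize (Hq Hsub).
      unfold nxt.
      destruct Rlt_dec as [V1|V1]; [exact V1|].
      destruct Rlt_dec as [V2|V2]; [exact V2|].
      destruct Rlt_dec as [V3|V3]; [exact V3|]. simpl fst. simpl snd.
      apply Rnot_lt_le in V1, V2, V3.
      rewrite Hq in IH.
      assert (E4 : bd n = 4 * bd (S n)).
      { unfold bd. rewrite (Hwn n), (Hhn n). ring. }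
      rewrite E4 in IH.
      assert (T1 := Cmod_triangle (bdry G a b (wn (S n)) (hn (S n))
         + bdry G (a + wn (S n)) b (wn (S n)) (hn (S n))
         + bdry G a (b + hn (S n)) (wn (S n)) (hn (S n)))%C
         (bdry G (a + wn (S n)) (b + hn (S n)) (wn (S n)) (hn (S n)))).
      assert (T2 := Cmod_triangle (bdry G a b (wn (S n)) (hn (S n))
         + bdry G (a + wn (S n)) b (wn (S n)) (hn (S n)))%C
         (bdry G a (b + hn (S n)) (wn (S n)) (hn (S n)))).
      assert (T3 := Cmod_triangle (bdry G a b (wn (S n)) (hn (S n)))
         (bdry G (a + wn (S n)) b (wn (S n)) (hn (S n)))).
      lra. }
  destruct (nested_point (fun n => fst (sq n)) w) as [px Hpx].
  { intros n. apply Hstep. }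
  destruct (nested_point (fun n => snd (sq n)) h) as [py Hpy].
  { intros n. apply Hstep. }
  assert (Hp : holo G (px, py)).
  { specialize (Hpx 0%nat). specialize (Hpy 0%nat). simpl in Hpx, Hpy.
    apply HG; lra. }
  destruct Hp as [l Hl]. rewrite C_is_derive_iff in Hl.
  destruct (Hl (eps' / 2)) as [d [Hd Hl2]]; [lra|].
  assert (Hn : exists n, wn n + hn n < d).
  { destruct (pow_lt_1_zero (/ 2)) with (y := d / (w + h)) as [n Hn].
    - rewrite Rabs_pos_eq; lra.
    - apply Rdiv_lt_0_compat; lra.
    - exists n. specialize (Hn n (Nat.le_refl n)).
      rewrite Rabs_pos_eq in Hn by (apply pow_le; lra).
      apply Rlt_div_r in Hn; [|lra].
      unfold wn, hn, Rdiv. rewrite <- !pow_inv. lra. }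
  destruct Hn as [n Hn].
  assert (Hb := bdry_small G (fst (sq n)) (snd (sq n)) (wn n) (hn n)
     (eps' / 2 * (wn n + hn n)) (px, py) l (Rlt_le _ _ (Pw n)) (Rlt_le _ _ (Ph n)) (Hsub n)).
  assert (Hc : Cmod (bdry G (fst (sq n)) (snd (sq n)) (wn n) (hn n)) <= bd n).
  { apply Rle_trans with (2 * (wn n + hn n) * (eps' / 2 * (wn n + hn n))).
    2:{ unfold bd. apply Req_le. field. }
    apply Hb. intros u v Hu Hv.
    assert (Hdist : Cmod ((u, v) - (px, py))%C <= wn n + hn n).
    { unfold Cminus, Cplus, Copp; simpl.
      apply Rle_trans with (1 := Cmod_pair_le _ _).
      specialize (Hpx n). specialize (Hpy n). unfold wn, hn in *.
      apply Rplus_le_compat; apply Rabs_le; lra. }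
    specialize (Hl2 ((u, v) - (px, py))%C (Rle_lt_trans _ _ _ Hdist Hn)).
    replace ((px, py) + ((u, v) - (px, py)))%C with (u, v) in Hl2.
    2:{ unfold Cminus, Cplus, Copp; simpl. f_equal; ring. }
    apply Rle_trans with (1 := Hl2).
    apply Rmult_le_compat_l; lra. }
  specialize (Hviol n). unfold viol in Hviol. lra.
Qed.

(** * Calculus of complex derivatives *)

(** The two normed module structures on [C] over itself have the same
    operations and norm, and differ in their uniform structure only. *)
Lemma is_derive_AbsRing (F : C -> C) (z l : C) :
  @is_derive C_AbsRing C_NormedModule F z l <->
  @is_derive C_AbsRing (AbsRing_NormedModule C_AbsRing) F z l.
Proof.
  split; intros [[H1 H2 H3] H4]; (split; [split; [exact H1|exact H2|exact H3]|exact H4]).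
Qed.

Lemma holo_mult (F G : C -> C) (z : C) :
  holo F z -> holo G z -> holo (fun w => F w * G w)%C z.
Proof.
  intros [l Hl] [m Hm]. apply is_derive_AbsRing in Hl, Hm. eexists.
  apply is_derive_AbsRing.
  apply (is_derive_mult (K := C_AbsRing) F G z _ _ Hl Hm). exact Cmult_comm.
Qed.

Lemma holo_comp (F G : C -> C) (z : C) :
  holo G z -> holo F (G z) -> holo (fun w => F (G w)) z.
Proof.
  intros [l Hl] [m Hm]. apply is_derive_AbsRing in Hl. eexists.
  apply (is_derive_comp (K := C_AbsRing) (V := C_NormedModule) F G z _ _ Hm Hl).
Qed.

Lemma holo_const (k z : C) : holo (fun _ => k) z.
Proof. eexists. apply (@is_derive_const C_AbsRing C_NormedModule). Qed.

Lemma holo_plus (F G : C -> C) (z : C) :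
  holo F z -> holo G z -> holo (fun w => F w + G w)%C z.
Proof.
  intros [l Hl] [m Hm]. eexists.
  apply (@is_derive_plus C_AbsRing C_NormedModule F G z _ _ Hl Hm).
Qed.

Lemma holo_id (z : C) : holo (fun w => w) z.
Proof.
  exists (RtoC 1). apply C_is_derive_iff. intros eps He.
  exists 1. split; [lra|]. intros h _.
  replace (z + h - z - h * 1)%C with (RtoC 0) by ring. rewrite Cmod_0.
  assert (H := Cmod_ge_0 h). nra.
Qed.

Lemma holo_minus_const (F : C -> C) (k z : C) : holo F z -> holo (fun w => F w - k)%C z.
Proof. intros H. apply holo_plus; [easy|apply holo_const]. Qed.

Lemma holo_ext_loc (F G : C -> C) (z : C) (d : R) :
  0 < d -> (forall h, Cmod h < d -> F (z + h)%C = G (z + h)%C) -> holo F z -> holo G z.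
Proof.
  intros Hd H [l Hl]. exists l. rewrite C_is_derive_iff in *. intros eps He.
  destruct (Hl eps He) as [d2 [Hd2 H2]].
  exists (Rmin d d2). split; [now apply Rmin_pos|]. intros h Hh.
  rewrite <- H by (apply Rlt_le_trans with (1 := Hh), Rmin_l).
  assert (E := H 0%C). rewrite Cplus_0_r, Cmod_0 in E. rewrite <- E by easy.
  apply H2. apply Rlt_le_trans with (1 := Hh), Rmin_r.
Qed.

Lemma holo_inv (z : C) : z <> RtoC 0 -> holo Cinv z.
Proof.
  intros Hz. exists (- / (z * z))%C. apply C_is_derive_iff. intros eps He.
  assert (Hm : 0 < Cmod z) by now apply Cmod_gt_0.
  assert (Hm3 : 0 < Cmod z ^ 3) by now apply pow_lt.
  exists (Rmin (Cmod z / 2) (eps * Cmod z ^ 3 / 2)). split.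
  { apply Rmin_pos; [lra|]. apply Rdiv_lt_0_compat; [|lra].
    apply Rmult_lt_0_compat; lra. }
  intros h Hh.
  assert (H1 := Rlt_le_trans _ _ _ Hh (Rmin_l _ _)).
  assert (H2 := Rlt_le_trans _ _ _ Hh (Rmin_r _ _)).
  assert (H3 : Cmod z / 2 <= Cmod (z + h)%C).
  { assert (T := Cmod_triangle (z + h) (- h)). rewrite Cmod_opp in T.
    replace (z + h + - h)%C with z in T by ring. lra. }
  assert (Hzh : (z + h)%C <> RtoC 0).
  { intros E. rewrite E, Cmod_0 in H3. lra. }
  replace (/ (z + h) - / z - h * - / (z * z))%C with (h * (h / (z * z * (z + h))))%C by now field.
  rewrite Cmod_mult, Rmult_comm. apply Rmult_le_compat_r; [apply Cmod_ge_0|].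
  rewrite Cmod_div, !Cmod_mult by (apply Cmult_neq_0; [now apply Cmult_neq_0|easy]).
  apply Rle_div_l.
  - repeat apply Rmult_lt_0_compat; lra.
  - apply Rle_trans with (eps * (Cmod z * Cmod z * (Cmod z / 2))); [simpl in H2; lra|].
    apply Rmult_le_compat_l; [lra|]. apply Rmult_le_compat_l; [nra|easy].
Qed.

Lemma holo_pow (F : C -> C) (n : nat) (z : C) : holo F z -> holo (fun w => F w ^ n)%C z.
Proof.
  intros H. induction n as [|n IH]; [apply (holo_const 1)|]. now apply holo_mult.
Qed.

(** * The exponential map and circles *)

Definition cexp (s : C) : C := (RtoC (exp (fst s)) * Cexpi (snd s))%C.

Lemma Cexpi_plus (s t : R) : Cexpi (s + t) = (Cexpi s * Cexpi t)%C.
Proof.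
  unfold Cexpi, Cmult; simpl. rewrite cos_plus, sin_plus. f_equal; ring.
Qed.

Lemma Cexpi_0 : Cexpi 0 = RtoC 1.
Proof. unfold Cexpi. now rewrite cos_0, sin_0. Qed.

Lemma Cexpi_2PI (t : R) : Cexpi (t + 2 * PI) = Cexpi t.
Proof.
  unfold Cexpi. assert (H1 := cos_period t 1). assert (H2 := sin_period t 1).
  simpl in H1, H2. rewrite Rmult_1_r in H1, H2. now rewrite H1, H2.
Qed.

Lemma Cmod_Cexpi (t : R) : Cmod (Cexpi t) = 1.
Proof.
  unfold Cmod, Cexpi; simpl fst; simpl snd.
  replace (cos t ^ 2 + sin t ^ 2) with 1; [apply sqrt_1|].
  rewrite <- (sin2_cos2 t). unfold Rsqr. ring.
Qed.

Lemma Cexpi_neq_0 (t : R) : Cexpi t <> RtoC 0.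
Proof. apply Cmod_gt_0. rewrite Cmod_Cexpi. lra. Qed.

Lemma Cexpi_conj (t : R) : (Cexpi t * Cconj (Cexpi t))%C = RtoC 1.
Proof. rewrite <- Cmod2_conj, Cmod_Cexpi. f_equal. ring. Qed.

Lemma Cexpi_pow (t : R) (n : nat) : (Cexpi t ^ n)%C = Cexpi (INR n * t).
Proof.
  induction n as [|n IH].
  - simpl. now rewrite Rmult_0_l, Cexpi_0.
  - rewrite S_INR. replace ((INR n + 1) * t) with (t + INR n * t) by ring.
    rewrite Cexpi_plus, <- IH. reflexivity.
Qed.

Lemma cexp_plus (s h : C) : cexp (s + h) = (cexp s * cexp h)%C.
Proof.
  unfold cexp. simpl fst. simpl snd. rewrite exp_plus, RtoC_mult, Cexpi_plus. ring.
Qed.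

Lemma derivable_0_eps (f : R -> R) (l : R) :
  derivable_pt_lim f 0 l -> forall eps, 0 < eps -> exists delta, 0 < delta /\
    forall h, Rabs h < delta -> Rabs (f h - f 0 - h * l) <= eps * Rabs h.
Proof.
  intros H eps He. destruct (H eps He) as [d Hd].
  exists d. split; [apply cond_pos|]. intros h Hh.
  destruct (Req_dec h 0) as [E|E].
  - rewrite E. replace (f 0 - f 0 - 0 * l) with 0 by ring. rewrite Rabs_R0. lra.
  - specialize (Hd h E Hh). rewrite Rplus_0_l in Hd.
    replace (f h - f 0 - h * l) with (((f h - f 0) / h - l) * h) by now field.
    rewrite Rabs_mult. apply Rmult_le_compat_r; [apply Rabs_pos|lra].
Qed.

Lemma cexp_is_derive (s : C) : @is_derive C_AbsRing C_NormedModule cexp s (cexp s).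
Proof.
  apply C_is_derive_iff. intros eps He.
  assert (Hs := Cmod_ge_0 (cexp s)).
  set (k := Rmin 1 (eps / (8 * (Cmod (cexp s) + 1)))).
  assert (Hk : 0 < k).
  { apply Rmin_pos; [lra|]. apply Rdiv_lt_0_compat; lra. }
  assert (Hk1 : k <= 1) by apply Rmin_l.
  assert (Hk2 : k * (8 * (Cmod (cexp s) + 1)) <= eps).
  { apply Rle_div_r; [lra|]. apply Rmin_r. }
  destruct (derivable_0_eps exp 1 derivable_pt_lim_exp_0 k Hk) as [d1 [Hd1 D1]].
  destruct (derivable_0_eps sin 1 derivable_pt_lim_sin_0 k Hk) as [d2 [Hd2 D2]].
  destruct (derivable_0_eps cos (- sin 0) (derivable_pt_lim_cos 0) k Hk) as [d3 [Hd3 D3]].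
  rewrite exp_0 in D1. rewrite sin_0 in D2, D3. rewrite cos_0 in D3.
  exists (Rmin (Rmin d1 (k / 2)) (Rmin d2 d3)). split.
  { repeat apply Rmin_pos; lra. }
  intros h Hh.
  rewrite cexp_plus.
  replace (cexp s * cexp h - cexp s - h * cexp s)%C
    with (cexp s * (cexp h - 1 - h))%C by ring.
  rewrite Cmod_mult.
  set (a := fst h). set (b := snd h).
  assert (Ha : Rabs a <= Cmod h) by apply fst_le_Cmod.
  assert (Hb : Rabs b <= Cmod h) by apply snd_le_Cmod.
  assert (M1 := Rmin_l (Rmin d1 (k / 2)) (Rmin d2 d3)).
  assert (M2 := Rmin_r (Rmin d1 (k / 2)) (Rmin d2 d3)).
  assert (M3 := Rmin_l d1 (k / 2)). assert (M4 := Rmin_r d1 (k / 2)).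
  assert (M5 := Rmin_l d2 d3). assert (M6 := Rmin_r d2 d3).
  specialize (D1 a ltac:(lra)). specialize (D2 b ltac:(lra)). specialize (D3 b ltac:(lra)).
  assert (Hea : Rabs (exp a - 1) <= 2 * Rabs a).
  { replace (exp a - 1) with ((exp a - 1 - a * 1) + a) by ring.
    apply Rle_trans with (1 := Rabs_triang _ _). assert (P := Rabs_pos a). nra. }
  assert (Hea2 : Rabs (exp a) <= 2).
  { replace (exp a) with ((exp a - 1) + 1) by ring.
    apply Rle_trans with (1 := Rabs_triang _ _). rewrite Rabs_R1. lra. }
  assert (Hmain : Cmod (cexp h - 1 - h)%C <= 8 * k * Cmod h).
  { replace (cexp h - 1 - h)%C with
      ((exp a * (cos b - 1 - b * - 0) + (exp a - 1 - a * 1))%R,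
       (exp a * (sin b - 0 - b * 1) + (exp a - 1) * b)%R).
    2:{ unfold cexp, Cexpi, Cminus, Cplus, Cmult, Copp, RtoC; simpl.
        unfold a, b. f_equal; ring. }
    apply Rle_trans with (1 := Cmod_pair_le _ _).
    assert (B1 := Rabs_triang (exp a * (cos b - 1 - b * - 0)) (exp a - 1 - a * 1)).
    assert (B2 := Rabs_triang (exp a * (sin b - 0 - b * 1)) ((exp a - 1) * b)).
    rewrite Rabs_mult in B1. rewrite !Rabs_mult in B2.
    assert (P1 := Rabs_pos (exp a)). assert (P2 := Rabs_pos b). assert (P3 := Rabs_pos a).
    assert (Q1 : Rabs (exp a) * Rabs (cos b - 1 - b * - 0) <= 2 * (k * Rabs b)).
    { apply Rmult_le_compat; auto using Rabs_pos. }
    assert (Q2 : Rabs (exp a) * Rabs (sin b - 0 - b * 1) <= 2 * (k * Rabs b)).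
    { apply Rmult_le_compat; auto using Rabs_pos. }
    assert (Q3 : Rabs (exp a - 1) * Rabs b <= k * Rabs b).
    { apply Rmult_le_compat_r; lra. }
    assert (Q4 : k * Rabs b <= k * Cmod h) by (apply Rmult_le_compat_l; lra).
    assert (Q5 : k * Rabs a <= k * Cmod h) by (apply Rmult_le_compat_l; lra).
    assert (Q6 : 0 <= k * Cmod h) by (apply Rmult_le_pos; [lra|apply Cmod_ge_0]). lra. }
  apply Rle_trans with (Cmod (cexp s) * (8 * k * Cmod h)).
  { apply Rmult_le_compat_l; easy. }
  assert (Hh0 := Cmod_ge_0 h).
  apply Rle_trans with (k * (8 * (Cmod (cexp s) + 1)) * Cmod h).
  - assert (0 <= k * Cmod h) by (apply Rmult_le_pos; lra). nra.
  - now apply Rmult_le_compat_r.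
Qed.

Lemma holo_cexp (s : C) : holo cexp s.
Proof. exists (cexp s). apply cexp_is_derive. Qed.

Lemma Cmod_cexp (s : C) : Cmod (cexp s) = exp (fst s).
Proof.
  unfold cexp. rewrite Cmod_mult, Cmod_R, Cmod_Cexpi, Rabs_pos_eq; [ring|].
  left. apply exp_pos.
Qed.

Lemma Ccontinuous_comp (F G : C -> C) (z : C) :
  Ccontinuous_at G z -> Ccontinuous_at F (G z) -> Ccontinuous_at (fun w => F (G w)) z.
Proof.
  intros HG HF eps He. destruct (HF eps He) as [d [Hd H1]].
  destruct (HG d Hd) as [d2 [Hd2 H2]]. exists d2. split; [easy|].
  intros h Hh. specialize (H1 _ (H2 h Hh)).
  replace (G z + (G (z + h) - G z))%C with (G (z + h)%C) in H1 by ring. exact H1.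
Qed.

Lemma Ccont_Cexpi (t : R) : Ccont Cexpi t.
Proof.
  split.
  - apply (continuous_cos t).
  - apply (continuous_sin t).
Qed.

Lemma Ccont_circle (g : C -> C) (r t : R) :
  Ccontinuous_at g (RtoC r * Cexpi t)%C -> Ccont (fun u => g (RtoC r * Cexpi u)%C) t.
Proof.
  intros H. apply (Ccont_comp g (fun u => RtoC r * Cexpi u)%C); [exact H|].
  apply Ccont_mult; [apply Ccont_const|apply Ccont_Cexpi].
Qed.

Lemma Cmod_circle (r t : R) : 0 <= r -> Cmod (RtoC r * Cexpi t)%C = r.
Proof. intros Hr. apply Cmod_ray; [apply Cmod_Cexpi|easy]. Qed.

Lemma Cint_hor_continuous (G : C -> C) (a b y : R) :
  a <= b -> (forall s t, a <= s <= b -> Ccontinuous_at G (s, t)) ->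
  forall eps, 0 < eps -> exists delta, 0 < delta /\ forall v, Rabs (v - y) < delta ->
    Cmod (Cint (fun s => G (s, v)) a b - Cint (fun s => G (s, y)) a b)%C <= (b - a) * eps.
Proof.
  intros Hab HG eps He.
  assert (H2d : forall x, a <= x <= b ->
    continuity_2d_pt (fun u v => fst (G (u, v))) x y /\
    continuity_2d_pt (fun u v => snd (G (u, v))) x y).
  { intros x Hx.
    assert (K : forall e : posreal, locally_2d (fun u v => Cmod (G (u, v) - G (x, y))%C < e) x y).
    { intros e. destruct (HG x y Hx e (cond_pos e)) as [d [Hd H]].
      exists (mkposreal (d / 2) ltac:(lra)). simpl. intros u v Hu Hv.
      specialize (H (u - x, v - y)%R).
      replace ((x, y) + ((u - x)%R, (v - y)%R))%C with (u, v) in H.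
      2:{ unfold Cplus; simpl. f_equal; ring. }
      apply H. apply Rle_lt_trans with (1 := Cmod_pair_le _ _). lra. }
    split; intros e; destruct (K e) as [d Hd]; exists d; intros u v Hu Hv;
      apply Rle_lt_trans with (2 := Hd u v Hu Hv).
    - apply (fst_le_Cmod (G (u, v) - G (x, y))%C).
    - apply (snd_le_Cmod (G (u, v) - G (x, y))%C). }
  destruct (uniform_continuity_2d_1d (fun u v => fst (G (u, v))) a b y
    (fun x Hx => proj1 (H2d x Hx)) (mkposreal (eps / 2) ltac:(lra))) as [d1 U1].
  destruct (uniform_continuity_2d_1d (fun u v => snd (G (u, v))) a b y
    (fun x Hx => proj2 (H2d x Hx)) (mkposreal (eps / 2) ltac:(lra))) as [d2 U2].
  simpl in U1, U2.
  assert (P1 := cond_pos d1). assert (P2 := cond_pos d2).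
  exists (Rmin d1 d2). split; [now apply Rmin_pos|].
  intros v Hv.
  assert (V1 := Rlt_le_trans _ _ _ Hv (Rmin_l _ _)).
  assert (V2 := Rlt_le_trans _ _ _ Hv (Rmin_r _ _)).
  apply Rabs_def2 in V1. apply Rabs_def2 in V2.
  assert (HI : forall t, Cintegrable (fun s => G (s, t)) a b).
  { intros t. apply Ccont_integrable; [easy|]. intros s Hs.
    apply (Ccont_comp G (fun s => (s, t))); [|apply Ccont_hor]. now apply HG. }
  replace (Cint (fun s => G (s, v)) a b - Cint (fun s => G (s, y)) a b)%C
    with (Cint (fun s => G (s, v) + (-1) * G (s, y))%C a b).
  2:{ rewrite Cint_plus, Cint_scal by (auto; now apply Cintegrable_scal). ring. }
  apply Cmod_Cint_le; [easy| |].
  { apply Cintegrable_plus; [easy|]. now apply Cintegrable_scal. }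
  intros s Hs.
  replace (G (s, v) + (-1) * G (s, y))%C with
    ((fst (G (s, v)) - fst (G (s, y)))%R, (snd (G (s, v)) - snd (G (s, y)))%R).
  2:{ destruct (G (s, v)), (G (s, y)). unfold Cplus, Cmult, RtoC; simpl. f_equal; ring. }
  apply Rle_trans with (1 := Cmod_pair_le _ _).
  assert (X1 := U1 s y s v Hs ltac:(lra) Hs ltac:(lra)
     ltac:(rewrite Rminus_diag, Rabs_R0; lra)).
  assert (X2 := U2 s y s v Hs ltac:(lra) Hs ltac:(lra)
     ltac:(rewrite Rminus_diag, Rabs_R0; lra)).
  lra.
Qed.

Lemma bounded_on_segment (f : R -> C) (a b : R) :
  a <= b -> (forall t, a <= t <= b -> Ccont f t) ->
  exists M, forall t, a <= t <= b -> Cmod (f t) <= M.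
Proof.
  intros Hab Hf.
  assert (K : forall u : R -> R, (forall t, a <= t <= b -> continuous u t) ->
     exists M, forall t, a <= t <= b -> Rabs (u t) <= M).
  { intros u Hu.
    destruct (continuity_ab_maj (fun t => Rabs (u t)) a b Hab) as [m [Hm _]].
    - intros c Hc. apply continuity_pt_filterlim.
      apply (continuous_comp u Rabs); [now apply Hu|]. apply continuous_Rabs.
    - now exists (Rabs (u m)). }
  destruct (K (fun t => fst (f t))) as [M1 H1]; [intros t Ht; now apply Hf|].
  destruct (K (fun t => snd (f t))) as [M2 H2]; [intros t Ht; now apply Hf|].
  exists (M1 + M2). intros t Ht.
  rewrite (surjective_pairing (f t)). apply Rle_trans with (1 := Cmod_pair_le _ _).
  specialize (H1 t Ht). specialize (H2 t Ht). lra.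
Qed.

(** Pulled back by the exponential, an annulus cut along the ray of angle [a]
    is a rectangle whose two horizontal sides have the same integral.
    Differentiability is required off the ray only: Goursat's theorem is
    applied to slightly smaller rectangles and the boundary terms are
    continuous; this leaves room for a singular point on the ray. *)
Lemma circle_integral_const (g : C -> C) (a r1 r2 : R) :
  (forall z, 0 < Cmod z < 1 -> Ccontinuous_at g z) ->
  (forall r t, 0 < r < 1 -> a < t < a + 2 * PI -> holo g (RtoC r * Cexpi t)%C) ->
  0 < r1 -> r1 < r2 -> r2 < 1 ->
  Cint (fun t => g (RtoC r1 * Cexpi t)%C) a (a + 2 * PI)
  = Cint (fun t => g (RtoC r2 * Cexpi t)%C) a (a + 2 * PI).
Proof.
  intros Hc Hh H1 H12 H2.
  assert (HPI := PI_RGT_0).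
  set (G := fun s => g (cexp s)).
  set (x := ln r1). set (w := ln r2 - ln r1).
  assert (Hw : 0 < w) by (unfold w; assert (L := ln_increasing r1 r2 H1 H12); lra).
  assert (Hneg : forall s, s <= x + w -> 0 < exp s < 1).
  { intros s Hs. split; [apply exp_pos|].
    apply Rle_lt_trans with (2 := H2). rewrite <- (exp_ln r2) by lra.
    unfold x, w in Hs. destruct Hs as [Hs|Hs].
    - left. apply exp_increasing. lra.
    - right. f_equal. lra. }
  assert (HGc : forall s t, s <= x + w -> Ccontinuous_at G (s, t)).
  { intros s t Hs. apply (Ccontinuous_comp g cexp).
    - apply holo_continuous, holo_cexp.
    - apply Hc. rewrite Cmod_cexp. simpl. now apply Hneg. }
  set (A := fun v => Cint (fun s => G (s, v)) x (x + w)).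
  assert (HA : forall v, A (v + 2 * PI) = A v).
  { intros v. apply Cint_ext. intros s. unfold G, cexp. simpl. now rewrite Cexpi_2PI. }
  assert (HGv : forall u c d, u <= x + w -> c <= d -> Cintegrable (fun t => G (u, t)) c d).
  { intros u c d Hu Hcd. apply Ccont_integrable; [easy|]. intros t _.
    apply (Ccont_comp G (fun t => (u, t))); [|apply Ccont_ver]. now apply HGc. }
  destruct (bounded_on_segment (fun t => G (x, t)) a (a + 2 * PI)) as [M1 HM1]; [lra| |].
  { intros t _. apply (Ccont_comp G (fun t => (x, t))); [|apply Ccont_ver]. apply HGc. lra. }
  destruct (bounded_on_segment (fun t => G ((x + w)%R, t)) a (a + 2 * PI)) as [M2 HM2]; [lra| |].
  { intros t _. apply (Ccont_comp G (fun t => ((x + w)%R, t))); [|apply Ccont_ver]. apply HGc. lra. }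
  set (I1 := Cint (fun t => G (x, t)) a (a + 2 * PI)).
  set (I2 := Cint (fun t => G ((x + w)%R, t)) a (a + 2 * PI)).
  assert (E1 : Cint (fun t => g (RtoC r1 * Cexpi t)%C) a (a + 2 * PI) = I1).
  { apply Cint_ext. intros t. unfold G, cexp, x. simpl. now rewrite exp_ln. }
  assert (E2 : Cint (fun t => g (RtoC r2 * Cexpi t)%C) a (a + 2 * PI) = I2).
  { apply Cint_ext. intros t. unfold G, cexp, x, w. simpl.
    replace (ln r1 + (ln r2 - ln r1)) with (ln r2) by ring. rewrite exp_ln; [easy|lra]. }
  rewrite E1, E2.
  assert (HM1p : 0 <= M1).
  { apply Rle_trans with (2 := HM1 a ltac:(lra)). apply Cmod_ge_0. }
  assert (HM2p : 0 <= M2).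
  { apply Rle_trans with (2 := HM2 a ltac:(lra)). apply Cmod_ge_0. }
  assert (Hcut : forall u M eta, u <= x + w -> 0 < eta < PI ->
     (forall t, a <= t <= a + 2 * PI -> Cmod (G (u, t)) <= M) ->
     Cmod (Cint (fun t => G (u, t)) a (a + 2 * PI)
           - Cint (fun t => G (u, t)) (a + eta) (a + eta + (2 * PI - 2 * eta)))%C <= 2 * eta * M).
  { intros u M eta Hu Heta HM.
    set (c := a + eta + (2 * PI - 2 * eta)).
    assert (Hc1 : c = a + 2 * PI - eta) by (unfold c; ring).
    rewrite (Cint_Chasles _ a (a + eta) (a + 2 * PI)) by (apply HGv; lra).
    rewrite (Cint_Chasles _ (a + eta) c (a + 2 * PI)) by (apply HGv; lra).
    assert (B1 : Cmod (Cint (fun t => G (u, t)) a (a + eta)) <= (a + eta - a) * M).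
    { apply Cmod_Cint_le; [lra|apply HGv; lra|]. intros t Ht. apply HM. lra. }
    assert (B2 : Cmod (Cint (fun t => G (u, t)) c (a + 2 * PI)) <= (a + 2 * PI - c) * M).
    { apply Cmod_Cint_le; [lra|apply HGv; lra|]. intros t Ht. apply HM. lra. }
    match goal with |- Cmod ?X <= _ => replace X with
      (Cint (fun t => G (u, t)) a (a + eta) + Cint (fun t => G (u, t)) c (a + 2 * PI))%C by ring end.
    apply Rle_trans with (1 := Cmod_triangle _ _).
    replace (a + 2 * PI - c) with eta in B2 by (rewrite Hc1; ring).
    replace (a + eta - a) with eta in B1 by ring. lra. }
  assert (Hz : (I1 - I2)%C = RtoC 0).
  { apply Cmod_eq_0_of_lt. intros eps He.
    destruct (Cint_hor_continuous G x (x + w) a) with (eps := eps / (4 * w)) as [d [Hd HdA]].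
    - lra.
    - intros s t Hs. apply HGc. lra.
    - apply Rdiv_lt_0_compat; lra.
    - replace ((x + w - x) * (eps / (4 * w))) with (eps / 4) in HdA by (field; lra).
      set (eta := Rmin (Rmin (PI / 2) (d / 2)) (eps / (4 * (M1 + M2 + 1)))).
      assert (Heta : 0 < eta).
      { repeat apply Rmin_pos; try lra. apply Rdiv_lt_0_compat; lra. }
      assert (L1 : eta <= PI / 2).
      { apply Rle_trans with (1 := Rmin_l _ _), Rmin_l. }
      assert (L2 : eta <= d / 2).
      { apply Rle_trans with (1 := Rmin_l _ _), Rmin_r. }
      assert (L3 : eta * (4 * (M1 + M2 + 1)) <= eps).
      { apply Rle_div_r; [lra|]. apply Rmin_r. }
      assert (HG := goursat G x (a + eta) w (2 * PI - 2 * eta) Hw ltac:(lra)).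
      unfold bdry in HG. fold (A (a + eta)) in HG.
      fold (A (a + eta + (2 * PI - 2 * eta))) in HG.
      replace (A (a + eta + (2 * PI - 2 * eta))) with (A (a - eta)) in HG.
      2:{ rewrite <- (HA (a - eta)). f_equal. ring. }
      assert (HR : holo_rect G x (a + eta) w (2 * PI - 2 * eta)).
      { intros u v Hu Hv. apply (holo_comp g cexp); [apply holo_cexp|].
        unfold cexp. simpl. apply Hh; [apply Hneg; lra|lra]. }
      specialize (HG HR).
      assert (K1 := Hcut x M1 eta ltac:(lra) ltac:(lra) HM1).
      assert (K2 := Hcut (x + w) M2 eta ltac:(lra) ltac:(lra) HM2).
      fold I1 in K1. fold I2 in K2.
      set (J1 := Cint (fun t => G (x, t)) (a + eta) (a + eta + (2 * PI - 2 * eta))) in *.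
      set (J2 := Cint (fun t => G ((x + w)%R, t)) (a + eta) (a + eta + (2 * PI - 2 * eta))) in *.
      assert (A1 : Cmod (A (a + eta)%R - A a)%C <= eps / 4).
      { apply HdA. replace (a + eta - a) with eta by ring. rewrite Rabs_pos_eq; lra. }
      assert (A2 : Cmod (A (a - eta)%R - A a)%C <= eps / 4).
      { apply HdA. replace (a - eta - a) with (- eta) by ring.
        rewrite Rabs_Ropp, Rabs_pos_eq; lra. }
      assert (EJ : (Ci * (J1 - J2))%C = (A (a + eta)%R - A (a - eta)%R)%C).
      { transitivity (A (a + eta)%R - A (a - eta)%R
          - (A (a + eta)%R - A (a - eta)%R + Ci * J2 - Ci * J1))%C; [ring|].
        rewrite HG. ring. }
      assert (BJ : Cmod (J1 - J2)%C <= eps / 2).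
      { rewrite <- (Rmult_1_l (Cmod _)), <- Cmod_Ci, <- Cmod_mult, EJ.
        replace (A (a + eta)%R - A (a - eta)%R)%C
          with ((A (a + eta)%R - A a) + - (A (a - eta)%R - A a))%C by ring.
        apply Rle_trans with (1 := Cmod_triangle _ _). rewrite Cmod_opp. lra. }
      replace (I1 - I2)%C with ((I1 - J1) + ((J1 - J2) + - (I2 - J2)))%C by ring.
      apply Rle_trans with (1 := Cmod_triangle _ _).
      apply Rle_trans with (Cmod (I1 - J1)%C + (Cmod (J1 - J2)%C + Cmod (- (I2 - J2))%C)).
      + apply Rplus_le_compat_l, Cmod_triangle.
      + rewrite Cmod_opp. nra. }
  transitivity ((I1 - I2) + I2)%C; [ring|]. rewrite Hz. ring.
Qed.

Lemma circle_mean_value (g : C -> C) (a r : R) :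
  (forall z, Cmod z < 1 -> Ccontinuous_at g z) ->
  (forall r t, 0 < r < 1 -> a < t < a + 2 * PI -> holo g (RtoC r * Cexpi t)%C) ->
  0 < r < 1 ->
  Cint (fun t => g (RtoC r * Cexpi t)%C) a (a + 2 * PI) = (RtoC (2 * PI) * g 0)%C.
Proof.
  intros Hc Hh Hr. assert (HPI := PI_RGT_0).
  assert (HI : forall s, 0 < s < 1 ->
    Cintegrable (fun t => g (RtoC s * Cexpi t)%C) a (a + 2 * PI)).
  { intros s Hs. apply Ccont_integrable; [lra|]. intros t _.
    apply Ccont_circle, Hc. rewrite Cmod_circle; lra. }
  assert (Hz : (Cint (fun t => g (RtoC r * Cexpi t)%C) a (a + 2 * PI)
                - RtoC (2 * PI) * g 0)%C = RtoC 0).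
  { apply Cmod_eq_0_of_lt. intros eps He.
    destruct (Hc 0) with (eps := eps / (2 * PI)) as [d [Hd H]].
    - rewrite Cmod_0. lra.
    - apply Rdiv_lt_0_compat; lra.
    - set (s := Rmin (r / 2) (d / 2)).
      assert (Hs : 0 < s) by (apply Rmin_pos; lra).
      assert (S1 : s <= r / 2) by apply Rmin_l.
      assert (S2 : s <= d / 2) by apply Rmin_r.
      rewrite <- (circle_integral_const g a s r) by (lra || auto; intros z Hz; apply Hc; lra).
      replace (RtoC (2 * PI) * g 0)%C with (Cint (fun _ => g 0) a (a + 2 * PI)).
      2:{ rewrite Cint_const. f_equal. f_equal. ring. }
      replace (Cint (fun t => g (RtoC s * Cexpi t)%C) a (a + 2 * PI)
               - Cint (fun _ => g 0) a (a + 2 * PI))%C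
        with (Cint (fun t => g (RtoC s * Cexpi t) + (-1) * g 0)%C a (a + 2 * PI)).
      2:{ rewrite (Cint_plus _ (fun _ => (-1) * g 0)%C).
          - rewrite (Cint_scal (-1) (fun _ => g 0)) by apply Cintegrable_const. ring.
          - apply HI. lra.
          - apply Cintegrable_const. }
      replace eps with ((a + 2 * PI - a) * (eps / (2 * PI))) by (field; lra).
      apply Cmod_Cint_le; [lra| |].
      + apply Cintegrable_plus; [apply HI; lra|apply Cintegrable_const].
      + intros t _. left.
        specialize (H (RtoC s * Cexpi t)%C). rewrite Cmod_circle in H by lra.
        rewrite Cplus_0_l in H.
        replace (g (RtoC s * Cexpi t) + (-1) * g 0)%C with (g (RtoC s * Cexpi t) - g 0)%C by ring.
        apply H. lra. }
  transitivity ((Cint (fun t => g (RtoC r * Cexpi t)%C) a (a + 2 * PI)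
                - RtoC (2 * PI) * g 0) + RtoC (2 * PI) * g 0)%C; [ring|].
  rewrite Hz. ring.
Qed.

(** * Taylor expansion of differentiable functions in the disk *)

Lemma angle_exists (e : C) : Cmod e = 1 -> exists a, - PI <= a <= PI /\ e = Cexpi a.
Proof.
  intros He. destruct e as [x y].
  assert (H : x ^ 2 + y ^ 2 = 1).
  { change (Re (x, y) ^ 2 + Im (x, y) ^ 2 = 1). rewrite <- Cmod2_alt, He. ring. }
  assert (Hx : -1 <= x <= 1) by nra.
  assert (Hb := acos_bound x).
  assert (Hs : sqrt (1 - x ^ 2) = Rabs y).
  { replace (1 - x ^ 2) with (Rsqr y) by (unfold Rsqr; lra). apply sqrt_Rsqr_abs. }
  destruct (Rle_lt_dec 0 y) as [Hy|Hy].
  - exists (acos x). split; [lra|]. unfold Cexpi.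
    rewrite cos_acos, sin_acos by lra. unfold Rsqr.
    replace (1 - x * x) with (1 - x ^ 2) by ring.
    rewrite Hs, Rabs_pos_eq; easy.
  - exists (- acos x). split; [lra|]. unfold Cexpi.
    rewrite cos_neg, sin_neg, cos_acos, sin_acos by lra. unfold Rsqr.
    replace (1 - x * x) with (1 - x ^ 2) by ring.
    rewrite Hs, Rabs_left by easy. f_equal. ring.
Qed.

Lemma circle_bounded (f : C -> C) (r : R) :
  0 <= r -> (forall t, Ccont (fun t => f (RtoC r * Cexpi t)%C) t) ->
  exists M, forall t, Cmod (f (RtoC r * Cexpi t)%C) <= M.
Proof.
  intros Hr Hf. assert (HPI := PI_RGT_0).
  destruct (bounded_on_segment (fun t => f (RtoC r * Cexpi t)%C) (- PI) PI) as [M HM]; [lra|auto|].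
  exists M. intros t.
  destruct (angle_exists (Cexpi t) (Cmod_Cexpi t)) as [a [Ha E]].
  rewrite E. now apply HM.
Qed.

Lemma Cint_period (f : R -> C) (a : R) :
  (forall t, Ccont f t) -> (forall t, f (t + 2 * PI) = f t) ->
  Cint f a (a + 2 * PI) = Cint f 0 (2 * PI).
Proof.
  intros Hf Hp. assert (HPI := PI_RGT_0).
  assert (HI : forall u v, Cintegrable f u v).
  { intros u v. split; apply (ex_RInt_continuous (V := R_CompleteNormedModule));
      intros t _; apply Hf. }
  assert (E1 := Cint_Chasles f a 0 (a + 2 * PI) (HI _ _) (HI _ _)).
  assert (E2 := Cint_Chasles f 0 (2 * PI) (a + 2 * PI) (HI _ _) (HI _ _)).
  assert (E3 : Cint f (2 * PI) (a + 2 * PI) = Cint f 0 a).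
  { rewrite <- (Rplus_0_l (2 * PI)) at 1. rewrite <- Cint_shift by apply HI.
    now apply Cint_ext. }
  assert (E4 := Cint_Chasles f 0 a 0 (HI _ _) (HI _ _)).
  assert (E5 : Cint f 0 0 = RtoC 0).
  { unfold Cint. now rewrite !(RInt_point (V := R_CompleteNormedModule)). }
  rewrite E1, E2, E3. rewrite E5 in E4.
  transitivity ((Cint f 0 a + Cint f a 0) + Cint f 0 (2 * PI))%C; [ring|].
  rewrite <- E4. ring.
Qed.

Lemma Cint_Cexpi_pow (n : nat) :
  Cint (fun t => Cexpi t ^ n)%C 0 (2 * PI)
  = match n with 0%nat => RtoC (2 * PI) | S _ => RtoC 0 end.
Proof.
  destruct n as [|n].
  - simpl. rewrite Cint_const. rewrite Rminus_0_r. ring.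
  - assert (Hn : INR (S n) <> 0) by (apply not_0_INR; lia).
    set (k := INR (S n)) in *.
    rewrite (Cint_ext _ (fun t => Cexpi (k * t))).
    2:{ intros t. apply Cexpi_pow. }
    assert (Hs : sin (k * (2 * PI)) = 0 /\ cos (k * (2 * PI)) = 1).
    { split.
      - assert (H := sin_period 0 (S n)). rewrite sin_0 in H. rewrite <- H. f_equal.
        unfold k. ring.
      - assert (H := cos_period 0 (S n)). rewrite cos_0 in H. rewrite <- H. f_equal.
        unfold k. ring. }
    destruct Hs as [Hs Hc].
    assert (D1 : forall t : R, is_derive (fun t => sin (k * t) / k) t (cos (k * t))).
    { intros t. auto_derive; [easy|]. field. easy. }
    assert (D2 : forall t : R, is_derive (fun t => - cos (k * t) / k) t (sin (k * t))).
    { intros t. auto_derive; [easy|]. field. easy. }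
    assert (X1 : forall t : R, ex_derive (fun t => cos (k * t)) t).
    { intros t. auto_derive. easy. }
    assert (X2 : forall t : R, ex_derive (fun t => sin (k * t)) t).
    { intros t. auto_derive. easy. }
    unfold Cint, Cexpi, RtoC; simpl fst; simpl snd. f_equal; apply is_RInt_unique.
    + replace 0 with (sin (k * (2 * PI)) / k - sin (k * 0) / k) at 2.
      2:{ rewrite Hs, Rmult_0_r, sin_0. field. easy. }
      apply (is_RInt_derive (V := R_CompleteNormedModule) (fun t => sin (k * t) / k)).
      * intros t _. apply D1.
      * intros t _. apply ex_derive_cont, X1.
    + replace 0 with (- cos (k * (2 * PI)) / k - - cos (k * 0) / k) at 2.
      2:{ rewrite Hc, Rmult_0_r, cos_0. field. easy. }
      apply (is_RInt_derive (V := R_CompleteNormedModule) (fun t => - cos (k * t) / k)).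
      * intros t _. apply D2.
      * intros t _. apply ex_derive_cont, X2.
Qed.

Lemma Ccont_integrable_any (f : R -> C) (a b : R) :
  (forall t, Ccont f t) -> Cintegrable f a b.
Proof.
  intros Hf. split; apply (ex_RInt_continuous (V := R_CompleteNormedModule));
    intros t _; apply Hf.
Qed.

Lemma Csum_zero (u : nat -> C) : (forall n, u n = RtoC 0) -> Csum u = RtoC 0.
Proof.
  intros H. assert (Hs : Cabs_summable u).
  { apply Cabs_summable_le with (2 := ex_series_0). intros n. rewrite H, Cmod_0. lra. }
  transitivity (0 * Csum u)%C; [|ring].
  rewrite <- Csum_scal by easy. apply Csum_ext. intros n. rewrite H. ring.
Qed.

Lemma Cabs_summable_single (u : nat -> C) (m : nat) :
  (forall n, n <> m -> u n = RtoC 0) -> Cabs_summable u.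
Proof.
  revert u. induction m as [|m IH]; intros u H; apply Cabs_summable_S.
  - apply Cabs_summable_le with (2 := ex_series_0). intros n. rewrite H, Cmod_0 by easy. lra.
  - apply IH. intros n Hn. apply H. lia.
Qed.

Lemma Csum_single (u : nat -> C) (m : nat) :
  (forall n, n <> m -> u n = RtoC 0) -> Csum u = u m.
Proof.
  revert u. induction m as [|m IH]; intros u H.
  - rewrite Csum_S by now apply Cabs_summable_single with 0%nat.
    rewrite Csum_zero; [ring|]. intros n. apply H. lia.
  - rewrite Csum_S by now apply Cabs_summable_single with (S m).
    rewrite (IH (fun n => u (S n))).
    + rewrite H by lia. ring.
    + intros n Hn. apply H. lia.
Qed.

(** Fourier coefficient on the circle of radius [r]; independent of [r], and
    then equal to the Taylor coefficient. *)
Definition taylor_coef (f : C -> C) (r : R) (n : nat) : C :=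
  (/ RtoC (2 * PI) * (/ RtoC r) ^ n
   * Cint (fun t => f (RtoC r * Cexpi t) * Cconj (Cexpi t) ^ n)%C 0 (2 * PI))%C.

Lemma Cinv_circle (r t : R) : r <> 0 ->
  (/ (RtoC r * Cexpi t))%C = (/ RtoC r * Cconj (Cexpi t))%C.
Proof.
  intros Hr. assert (H1 := Cexpi_neq_0 t). assert (H2 := RtoC_neq_0 r Hr).
  transitivity (/ RtoC r * ((Cexpi t * Cconj (Cexpi t)) * / Cexpi t))%C.
  - rewrite Cexpi_conj. field. now split.
  - field. now split.
Qed.

Lemma RtoC_2PI_neq_0 : RtoC (2 * PI) <> RtoC 0.
Proof. apply RtoC_neq_0. assert (H := PI_RGT_0). lra. Qed.

Lemma taylor_coef_const (f : C -> C) (r1 r2 : R) (n : nat) :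
  (forall z, Cmod z < 1 -> holo f z) -> 0 < r1 -> r1 < r2 -> r2 < 1 ->
  taylor_coef f r1 n = taylor_coef f r2 n.
Proof.
  intros Hf H1 H12 H2. unfold taylor_coef. rewrite <- !Cmult_assoc. f_equal.
  set (g := fun z => (f z * (/ z) ^ n)%C).
  assert (Hg : forall z, 0 < Cmod z < 1 -> holo g z).
  { intros z Hz. apply holo_mult; [apply Hf; lra|].
    apply holo_pow, holo_inv. apply Cmod_gt_0. lra. }
  assert (E := circle_integral_const g 0 r1 r2).
  rewrite Rplus_0_l in E.
  assert (Hgi : forall r, 0 < r < 1 ->
    Cint (fun t => g (RtoC r * Cexpi t)%C) 0 (2 * PI)
    = ((/ RtoC r) ^ n * Cint (fun t => f (RtoC r * Cexpi t) * Cconj (Cexpi t) ^ n)%C 0 (2 * PI))%C).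
  { intros r Hr. rewrite <- Cint_scal.
    - apply Cint_ext. intros t. unfold g. rewrite Cinv_circle by lra.
      rewrite Cpow_mult_l. ring.
    - apply Ccont_integrable_any. intros t. apply Ccont_mult.
      + apply Ccont_circle, holo_continuous, Hf. rewrite Cmod_circle; lra.
      + apply Ccont_pow, Ccont_conj, Ccont_Cexpi. }
  rewrite <- !Hgi by lra. apply E; auto.
  - intros z Hz. now apply holo_continuous, Hg.
  - intros r t Hr _. apply Hg. rewrite Cmod_circle; lra.
Qed.

Lemma taylor_coef_const_any (f : C -> C) (r1 r2 : R) (n : nat) :
  (forall z, Cmod z < 1 -> holo f z) -> 0 < r1 < 1 -> 0 < r2 < 1 ->
  taylor_coef f r1 n = taylor_coef f r2 n.
Proof.
  intros Hf H1 H2. destruct (Rtotal_order r1 r2) as [H|[H|H]].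
  - apply taylor_coef_const; auto; lra.
  - now rewrite H.
  - symmetry. apply taylor_coef_const; auto; lra.
Qed.

Lemma Cmod_pow_conj_Cexpi (t : R) (n : nat) : Cmod (Cconj (Cexpi t) ^ n)%C = 1.
Proof. now rewrite Cmod_pow, Cmod_conj, Cmod_Cexpi, pow1. Qed.

Lemma taylor_coef_tame (f : C -> C) :
  (forall z, Cmod z < 1 -> holo f z) -> ctame (taylor_coef f (1 / 2)).
Proof.
  intros Hf. assert (HPI := PI_RGT_0).
  assert (K : forall r, 0 < r < 1 -> exists M, forall n,
     Cmod (taylor_coef f (1 / 2) n) * r ^ n <= M).
  { intros r Hr.
    assert (Hcf : forall t, Ccont (fun t => f (RtoC r * Cexpi t)%C) t).
    { intros t. apply Ccont_circle, holo_continuous, Hf. rewrite Cmod_circle; lra. }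
    destruct (circle_bounded f r ltac:(lra) Hcf) as [M HM].
    exists M. intros n.
    rewrite (taylor_coef_const_any f (1 / 2) r n Hf) by lra.
    unfold taylor_coef. rewrite !Cmod_mult, Cmod_pow.
    rewrite !Cmod_inv by (apply RtoC_2PI_neq_0 || (apply RtoC_neq_0; lra)).
    rewrite !Cmod_R, (Rabs_pos_eq r), (Rabs_pos_eq (2 * PI)) by lra.
    assert (HI : Cmod (Cint (fun t => f (RtoC r * Cexpi t) * Cconj (Cexpi t) ^ n)%C 0 (2 * PI))
                 <= (2 * PI - 0) * M).
    { apply Cmod_Cint_le; [lra| |].
      - apply Ccont_integrable_any. intros t. apply Ccont_mult; [apply Hcf|].
        apply Ccont_pow, Ccont_conj, Ccont_Cexpi.
      - intros t _. rewrite Cmod_mult, Cmod_pow_conj_Cexpi, Rmult_1_r. apply HM. }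
    set (I := Cmod (Cint _ _ _)) in *.
    rewrite pow_inv. assert (Hp : 0 < r ^ n) by (apply pow_lt; lra).
    replace (/ (2 * PI) * / r ^ n * I * r ^ n) with (I / (2 * PI)) by (field; lra).
    apply Rle_div_l; lra. }
  intros r Hr. destruct (Rle_lt_or_eq_dec 0 r (proj1 Hr)) as [H|H].
  - destruct (K r) as [M HM]; [lra|]. exists M. intros n.
    rewrite Rabs_pos_eq by apply Cmod_ge_0. apply HM.
  - destruct (K (1 / 2)) as [M HM]; [lra|]. exists M. intros n.
    rewrite Rabs_pos_eq by apply Cmod_ge_0.
    apply Rle_trans with (2 := HM n). apply Rmult_le_compat_l; [apply Cmod_ge_0|].
    apply pow_incr. lra.
Qed.

Lemma circle_neq (z0 : C) (a r t : R) :
  0 < Cmod z0 -> z0 = (RtoC (Cmod z0) * Cexpi a)%C -> 0 < r -> a < t < a + 2 * PI ->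
  (RtoC r * Cexpi t)%C <> z0.
Proof.
  intros H0 E Hr Ht Heq.
  assert (Hm : r = Cmod z0).
  { rewrite <- Heq. rewrite Cmod_circle; lra. }
  rewrite E, <- Hm in Heq.
  assert (Hr0 : RtoC r <> RtoC 0) by (apply RtoC_neq_0; lra).
  assert (Hee : Cexpi t = Cexpi a).
  { transitivity (/ RtoC r * (RtoC r * Cexpi t))%C; [now field|].
    rewrite Heq. now field. }
  assert (H1 : Cexpi (t - a) = RtoC 1).
  { assert (Hx : (Cexpi (t - a) * Cexpi a)%C = Cexpi a).
    { rewrite <- Cexpi_plus. replace (t - a + a) with t by ring. exact Hee. }
    transitivity (Cexpi (t - a) * Cexpi a * / Cexpi a)%C.
    - field. apply Cexpi_neq_0.
    - rewrite Hx. field. apply Cexpi_neq_0. }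
  assert (Hcos : cos (t - a) = 1) by exact (f_equal fst H1).
  (* [cos u = 1] with [0 < u < 2 * PI] is excluded by the half angle. *)
  assert (Hsin : 0 < sin ((t - a) / 2)) by (apply sin_gt_0; lra).
  assert (H2 := cos_2a_sin ((t - a) / 2)).
  replace (2 * ((t - a) / 2)) with (t - a) in H2 by field.
  rewrite Hcos in H2. nra.
Qed.

(** [z * (f z - f z0) / (z - z0)] is continuous at [z0] and vanishes at [0],
    so its mean over a circle around both points is zero. *)
Lemma cauchy_mean (f : C -> C) (z0 : C) (a r : R) :
  (forall z, Cmod z < 1 -> holo f z) ->
  0 < Cmod z0 -> z0 = (RtoC (Cmod z0) * Cexpi a)%C -> Cmod z0 < r < 1 ->
  Cint (fun t => (RtoC r * Cexpi t) * (f (RtoC r * Cexpi t) - f z0)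
                 / (RtoC r * Cexpi t - z0))%C a (a + 2 * PI) = RtoC 0.
Proof.
  intros Hf H0 E Hr.
  destruct (Hf z0 ltac:(lra)) as [l Hl].
  set (g := fun z => if Ceq_dec z z0 then (z0 * l)%C
                     else (z * (f z - f z0) / (z - z0))%C).
  assert (Hg : forall z, Cmod z < 1 -> z <> z0 -> holo g z).
  { intros z Hz Hne.
    assert (Hd : (z - z0)%C <> RtoC 0).
    { intros Hc. apply Hne. transitivity (z - z0 + z0)%C; [ring|]. rewrite Hc. ring. }
    apply holo_ext_loc with (fun z => z * (f z - f z0) * / (z - z0))%C (Cmod (z - z0)%C).
    - now apply Cmod_gt_0.
    - intros h Hh. unfold g. destruct (Ceq_dec (z + h) z0) as [Ez|Ez]; [|reflexivity].
      exfalso. apply (Rlt_irrefl (Cmod h)).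
      replace (z - z0)%C with (- h)%C in Hh by (rewrite <- Ez; ring).
      now rewrite Cmod_opp in Hh.
    - apply holo_mult; [apply holo_mult|].
      + apply holo_id.
      + now apply holo_minus_const, Hf.
      + apply (holo_comp Cinv (fun z => z - z0)%C); [apply holo_minus_const, holo_id|].
        now apply holo_inv. }
  assert (Hgc : forall z, Cmod z < 1 -> Ccontinuous_at g z).
  { intros z Hz. destruct (Ceq_dec z z0) as [Ez|Ez]; [|now apply holo_continuous, Hg].
    subst z. intros eps He. rewrite C_is_derive_iff in Hl.
    assert (Hl0 := Cmod_ge_0 l).
    destruct (Hl (eps / 4)) as [d [Hd H1]]; [lra|].
    exists (Rmin (Rmin d 1) (eps / (2 * (Cmod l + 1)))). split.
    { repeat apply Rmin_pos; try lra. apply Rdiv_lt_0_compat; lra. }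
    intros h Hh.
    assert (L1 : Cmod h < d).
    { apply Rlt_le_trans with (1 := Hh). apply Rle_trans with (1 := Rmin_l _ _), Rmin_l. }
    assert (L2 : Cmod h < 1).
    { apply Rlt_le_trans with (1 := Hh). apply Rle_trans with (1 := Rmin_l _ _), Rmin_r. }
    assert (L3 : Cmod h * (2 * (Cmod l + 1)) < eps).
    { apply Rlt_div_r; [lra|]. apply Rlt_le_trans with (1 := Hh), Rmin_r. }
    unfold g. destruct (Ceq_dec z0 z0) as [_|Hc]; [|now elim Hc].
    destruct (Ceq_dec (z0 + h) z0) as [Ez|Ez].
    - replace (z0 * l - z0 * l)%C with (RtoC 0) by ring. now rewrite Cmod_0.
    - assert (Hh0 : h <> RtoC 0) by (intros Hc; apply Ez; rewrite Hc; ring).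
      assert (Hhp : 0 < Cmod h) by now apply Cmod_gt_0.
      replace ((z0 + h) * (f (z0 + h) - f z0) / (z0 + h - z0) - z0 * l)%C
        with ((z0 + h) * ((f (z0 + h) - f z0 - h * l) / h) + h * l)%C.
      2:{ replace (z0 + h - z0)%C with h by ring. now field. }
      specialize (H1 h L1).
      assert (Hq : Cmod ((f (z0 + h) - f z0 - h * l) / h)%C <= eps / 4).
      { rewrite Cmod_div by easy. now apply Rle_div_l. }
      apply Rle_lt_trans with (1 := Cmod_triangle _ _). rewrite !Cmod_mult.
      assert (Hzh : Cmod (z0 + h)%C <= 2).
      { apply Rle_trans with (1 := Cmod_triangle _ _). lra. }
      assert (Cmod (z0 + h)%C * Cmod ((f (z0 + h) - f z0 - h * l) / h)%C <= 2 * (eps / 4)).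
      { apply Rmult_le_compat; auto using Cmod_ge_0. }
      nra. }
  assert (HM := circle_mean_value g a r Hgc).
  assert (Hg0 : g 0 = RtoC 0).
  { unfold g. destruct (Ceq_dec 0 z0) as [Ez|Ez].
    - rewrite <- Ez, Cmod_0 in H0. lra.
    - unfold Cdiv. ring. }
  rewrite Hg0 in HM.
  transitivity (Cint (fun t => g (RtoC r * Cexpi t)%C) a (a + 2 * PI)).
  - apply Cint_ext. intros t. unfold g.
    destruct (Ceq_dec (RtoC r * Cexpi t) z0) as [Ez|Ez]; [|reflexivity].
    exfalso. assert (Hr1 : 0 <= r) by lra. rewrite <- Ez, (Cmod_circle r t Hr1) in Hr. lra.
  - rewrite HM; [ring| |lra].
    intros s t Hs Ht. apply Hg; [rewrite Cmod_circle; lra|].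
    now apply circle_neq with a.
Qed.

Lemma geom_circle (z0 : C) (r t : R) : Cmod z0 < r ->
  (RtoC r * Cexpi t / (RtoC r * Cexpi t - z0))%C
  = Csum (fun n => (z0 * / RtoC r) ^ n * Cconj (Cexpi t) ^ n)%C.
Proof.
  intros Hr. assert (H0 := Cmod_ge_0 z0).
  assert (Hr0 : RtoC r <> RtoC 0) by (apply RtoC_neq_0; lra).
  set (q := (z0 * / RtoC r * Cconj (Cexpi t))%C).
  assert (Hq : Cmod q < 1).
  { unfold q. rewrite !Cmod_mult, Cmod_conj, Cmod_Cexpi, Cmod_inv, Cmod_R, Rabs_pos_eq
      by (easy || lra).
    rewrite Rmult_1_r. apply Rlt_div_l; lra. }
  transitivity (CPS (fun _ => RtoC 1) q).
  - rewrite CPS_geom by easy.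
    assert (Hz : z0 = (RtoC r * Cexpi t * q)%C).
    { unfold q. transitivity (z0 * (RtoC r * / RtoC r) * (Cexpi t * Cconj (Cexpi t)))%C; [|ring].
      rewrite Cexpi_conj, Cinv_r by easy. ring. }
    assert (Hq1 := one_minus_neq_0 q Hq). assert (He := Cexpi_neq_0 t).
    rewrite Hz at 1.
    replace (RtoC r * Cexpi t - RtoC r * Cexpi t * q)%C with (RtoC r * Cexpi t * (1 - q))%C by ring.
    field. now split.
  - apply Csum_ext. intros n. unfold q. rewrite Cpow_mult_l. ring.
Qed.

Lemma Cint_CPS (u p : R -> C) (h : nat -> C) (M s a b : R) :
  a <= b -> (forall t, Ccont u t) -> (forall t, Cmod (u t) <= M) ->
  (forall t, Ccont p t) -> (forall t, Cmod (p t) = s) -> s < 1 -> ctame h ->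
  Cint (fun t => u t * CPS h (p t))%C a b
  = Csum (fun n => h n * Cint (fun t => u t * p t ^ n)%C a b)%C.
Proof.
  intros Hab Hu HM Hp Hs Hs1 Hh.
  assert (Hs0 : 0 <= s) by (rewrite <- (Hs a); apply Cmod_ge_0).
  assert (Hsum : forall t, Cabs_summable (fun n => h n * p t ^ n)%C).
  { intros t. apply ctame_summable; [easy|]. now rewrite Hs. }
  assert (Hcn : forall n t, Ccont (fun t => u t * p t ^ n)%C t).
  { intros n t. apply Ccont_mult; [easy|]. now apply Ccont_pow. }
  transitivity (Csum (fun n => Cint (fun t => h n * (u t * p t ^ n))%C a b)).
  2:{ apply Csum_ext. intros n. apply Cint_scal. apply Ccont_integrable_any, Hcn. }
  rewrite <- (Cint_Csum (fun n t => h n * (u t * p t ^ n))%C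
                (fun n => M * (Rabs (Cmod (h n)) * s ^ n))).
  - apply Cint_ext. intros t. unfold CPS. rewrite <- Csum_scal by easy.
    apply Csum_ext. intros n. ring.
  - easy.
  - apply (@ex_series_scal_l R_AbsRing). now apply tame_ex_series.
  - intros n t. rewrite !Cmod_mult, Cmod_pow, Hs.
    rewrite Rabs_pos_eq by apply Cmod_ge_0.
    replace (Cmod (h n) * (Cmod (u t) * s ^ n))
      with (Cmod (u t) * (Cmod (h n) * s ^ n)) by ring.
    apply Rmult_le_compat_r; [|easy].
    apply Rmult_le_pos; [apply Cmod_ge_0|now apply pow_le].
  - intros n. apply Cintegrable_scal. apply Ccont_integrable_any, Hcn.
  - apply Ccont_integrable_any. intros t.
    apply Ccont_ext with (fun t => u t * CPS h (p t))%C.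
    + intros x. unfold CPS. rewrite <- Csum_scal by easy.
      apply Csum_ext. intros n. ring.
    + apply Ccont_mult; [easy|]. apply Ccont_CPS; auto. now rewrite Hs.
Qed.

(** [q ^ n * Cconj (Cexpi t) ^ n] is the [n]-th term of the geometric series
    of [z / (z - z0)] at [z = r * Cexpi t], for [q = z0 / r]. *)
Lemma Cint_geom_circle (u : R -> C) (q : C) (M a : R) :
  (forall t, Ccont u t) -> (forall t, Cmod (u t) <= M) -> Cmod q < 1 ->
  Cint (fun t => u t * Csum (fun n => q ^ n * Cconj (Cexpi t) ^ n))%C a (a + 2 * PI)
  = Csum (fun n => q ^ n * Cint (fun t => u t * Cconj (Cexpi t) ^ n)%C a (a + 2 * PI))%C.
Proof.
  intros Hu HM Hq. assert (HPI := PI_RGT_0).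
  assert (Hcp : forall t, Ccont (fun t => q * Cconj (Cexpi t))%C t).
  { intros t. apply Ccont_mult; [apply Ccont_const|]. apply Ccont_conj, Ccont_Cexpi. }
  transitivity (Cint (fun t => u t * CPS (fun _ => RtoC 1) (q * Cconj (Cexpi t)))%C a (a + 2 * PI)).
  - apply Cint_ext. intros t. f_equal. apply Csum_ext. intros n.
    rewrite Cpow_mult_l. ring.
  - rewrite (Cint_CPS u (fun t => q * Cconj (Cexpi t))%C _ M (Cmod q)); auto.
    + apply Csum_ext. intros n. rewrite Cmult_1_l, <- Cint_scal.
      * apply Cint_ext. intros t. rewrite Cpow_mult_l. ring.
      * apply Ccont_integrable_any. intros t. apply Ccont_mult; [easy|].
        apply Ccont_pow, Ccont_conj, Ccont_Cexpi.
    + lra.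
    + intros t. rewrite Cmod_mult, Cmod_conj, Cmod_Cexpi. ring.
    + apply ctame_R, tame_1.
Qed.

(** Expanding [z / (z - z0)] in the vanishing mean of
    [z * (f z - f z0) / (z - z0)] gives the Taylor series at [z0]; the circle
    is cut at the angle of [z0], and periodicity moves the cut back to [0]. *)
Theorem taylor (f : C -> C) :
  (forall z, Cmod z < 1 -> holo f z) ->
  exists a, ctame a /\ forall z, Cmod z < 1 -> f z = CPS a z.
Proof.
  intros Hf. exists (taylor_coef f (1 / 2)).
  assert (HPI := PI_RGT_0). assert (H2P := RtoC_2PI_neq_0).
  assert (HT := taylor_coef_tame f Hf). split; [exact HT|].
  intros z0 Hz0. destruct (Ceq_dec z0 0) as [E0|E0].
  - subst z0. rewrite CPS_0 by easy. unfold taylor_coef.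
    assert (HM := circle_mean_value f 0 (1 / 2)). rewrite Rplus_0_l in HM.
    rewrite (Cint_ext _ (fun t => f (RtoC (1 / 2) * Cexpi t)%C)).
    2:{ intros t. simpl. ring. }
    rewrite HM.
    + simpl. now field.
    + intros z Hz. now apply holo_continuous, Hf.
    + intros r t Hr _. apply Hf. rewrite Cmod_circle; lra.
    + lra.
  - assert (H0 : 0 < Cmod z0) by now apply Cmod_gt_0.
    destruct (polar z0) as [e [He Ez]].
    destruct (angle_exists e He) as [a [_ Ea]]. rewrite Ea in Ez.
    set (r := (1 + Cmod z0) / 2).
    assert (Hr : Cmod z0 < r < 1) by (unfold r; lra).
    assert (Hr0 : RtoC r <> RtoC 0) by (apply RtoC_neq_0; lra).
    assert (HC := cauchy_mean f z0 a r Hf H0 Ez Hr).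
    set (q := (z0 * / RtoC r)%C).
    assert (Hq : Cmod q < 1).
    { unfold q. rewrite Cmod_mult, Cmod_inv, Cmod_R, Rabs_pos_eq by (easy || lra).
      apply Rlt_div_l; lra. }
    set (K := fun t => Csum (fun n => q ^ n * Cconj (Cexpi t) ^ n)%C).
    assert (HK : forall t, K t = (RtoC r * Cexpi t / (RtoC r * Cexpi t - z0))%C).
    { intros t. unfold K, q. symmetry. apply geom_circle. lra. }
    assert (Hne : forall t, (RtoC r * Cexpi t - z0)%C <> RtoC 0).
    { intros t Hc. apply (Rlt_irrefl r).
      assert (Ex : (RtoC r * Cexpi t)%C = z0).
      { transitivity (RtoC r * Cexpi t - z0 + z0)%C; [ring|]. rewrite Hc. ring. }
      rewrite <- (Cmod_circle r t) at 1 by lra. rewrite Ex. lra. }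
    assert (HcK : forall t, Ccont K t).
    { intros t. apply Ccont_ext with (fun t => RtoC r * Cexpi t / (RtoC r * Cexpi t - z0))%C.
      - intros s. now rewrite HK.
      - apply (Ccont_circle (fun w => w / (w - z0))%C).
        apply holo_continuous, holo_mult; [apply holo_id|].
        apply (holo_comp Cinv (fun w => w - z0)%C); [apply holo_minus_const, holo_id|].
        now apply holo_inv. }
    assert (Hcf : forall t, Ccont (fun t => f (RtoC r * Cexpi t)%C) t).
    { intros t. apply Ccont_circle, holo_continuous, Hf. rewrite Cmod_circle; lra. }
    destruct (circle_bounded f r ltac:(lra) Hcf) as [M HM].
    rewrite (Cint_ext _ (fun t => f (RtoC r * Cexpi t) * K t + (- f z0) * (1 * K t))%C) in HC.
    2:{ intros t. rewrite HK. specialize (Hne t). now field. }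
    rewrite Cint_plus in HC.
    2:{ apply Ccont_integrable_any. intros t. now apply Ccont_mult. }
    2:{ apply Ccont_integrable_any. intros t. apply Ccont_mult; [apply Ccont_const|].
        apply Ccont_mult; [apply Ccont_const|easy]. }
    rewrite Cint_scal in HC.
    2:{ apply Ccont_integrable_any. intros t. apply Ccont_mult; [apply Ccont_const|easy]. }
    unfold K in HC.
    rewrite (Cint_geom_circle _ q M a Hcf HM Hq) in HC.
    rewrite (Cint_geom_circle (fun _ => RtoC 1) q 1 a) in HC.
    2:{ intros t. apply Ccont_const. }
    2:{ intros t. rewrite Cmod_1. lra. }
    2:{ easy. }
    assert (Hperc : forall t n, (Cconj (Cexpi (t + 2 * PI)) ^ n)%C = (Cconj (Cexpi t) ^ n)%C).
    { intros t n. now rewrite Cexpi_2PI. }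
    rewrite (Csum_single
      (fun n => q ^ n * Cint (fun t => 1 * Cconj (Cexpi t) ^ n)%C a (a + 2 * PI))%C 0) in HC.
    2:{ intros n Hn. rewrite Cint_period.
        - rewrite (Cint_ext _ (fun t => Cconj (Cexpi t ^ n))%C).
          + rewrite Cint_conj.
            * rewrite Cint_Cexpi_pow. destruct n; [easy|].
              unfold Cconj, RtoC; simpl. rewrite Ropp_0. apply Cmult_0_r.
            * apply Ccont_integrable_any. intros t. apply Ccont_pow, Ccont_Cexpi.
          + intros t. rewrite Cpow_conj. ring.
        - intros t. apply Ccont_mult; [apply Ccont_const|].
          apply Ccont_pow, Ccont_conj, Ccont_Cexpi.
        - intros t. now rewrite Hperc. }
    rewrite (Cint_ext (fun t => 1 * Cconj (Cexpi t) ^ 0)%C (fun _ => RtoC 1)) in HC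
      by (intros t; simpl; ring).
    rewrite Cint_const in HC. replace (a + 2 * PI - a) with (2 * PI) in HC by ring.
    rewrite (Csum_ext _ (fun n => RtoC (2 * PI) * (taylor_coef f (1 / 2) n * z0 ^ n))%C) in HC.
    2:{ intros n. rewrite (taylor_coef_const_any f (1 / 2) r n Hf) by lra.
        unfold taylor_coef. rewrite Cint_period.
        - unfold q. rewrite Cpow_mult_l. field. easy.
        - intros t. apply Ccont_mult; [easy|]. apply Ccont_pow, Ccont_conj, Ccont_Cexpi.
        - intros t. now rewrite Hperc, Cexpi_2PI. }
    rewrite Csum_scal in HC by now apply ctame_summable.
    fold (CPS (taylor_coef f (1 / 2)) z0) in HC.
    set (S := CPS (taylor_coef f (1 / 2)) z0) in *.
    transitivity (f z0 + / RtoC (2 * PI) * (RtoC (2 * PI) * S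
       + - f z0 * (q ^ 0 * (RtoC (2 * PI) * 1))))%C.
    + rewrite HC. ring.
    + simpl. now field.
Qed.

(** * Convolution with functions of bounded real part *)

Lemma Cexpi_orth (k n : nat) :
  Cint (fun t => Cconj (Cexpi t) ^ k * Cexpi t ^ n)%C 0 (2 * PI)
  = if Nat.eq_dec n k then RtoC (2 * PI) else RtoC 0.
Proof.
  assert (K : forall m t, (Cconj (Cexpi t) ^ m * Cexpi t ^ m)%C = RtoC 1).
  { intros m t. rewrite <- Cpow_mult_l, Cmult_comm with (x := Cconj _), Cexpi_conj.
    apply Cpow_1_l. }
  destruct (Nat.le_ge_cases k n) as [H|H].
  - rewrite (Cint_ext _ (fun t => Cexpi t ^ (n - k))%C).
    + rewrite Cint_Cexpi_pow. destruct (Nat.eq_dec n k) as [E|E].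
      * subst. now rewrite Nat.sub_diag.
      * destruct (n - k)%nat eqn:E2; [lia|easy].
    + intros t. replace n with (k + (n - k))%nat at 1 by lia.
      rewrite Cpow_add_r, Cmult_assoc, K. ring.
  - rewrite (Cint_ext _ (fun t => Cconj (Cexpi t ^ (k - n)))%C).
    + rewrite Cint_conj, Cint_Cexpi_pow.
      2:{ apply Ccont_integrable_any. intros t. apply Ccont_pow, Ccont_Cexpi. }
      destruct (Nat.eq_dec n k) as [E|E].
      * subst. rewrite Nat.sub_diag. unfold Cconj, RtoC; simpl. f_equal. ring.
      * destruct (k - n)%nat eqn:E2; [lia|]. unfold Cconj, RtoC; simpl. f_equal. ring.
    + intros t. replace k with ((k - n) + n)%nat at 1 by lia.
      rewrite Cpow_add_r, <- Cmult_assoc, K, Cpow_conj. ring.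
Qed.

Lemma CPS_circle_cont (p : nat -> C) (r t : R) :
  ctame p -> 0 <= r < 1 -> Ccont (fun t => CPS p (RtoC r * Cexpi t)) t.
Proof.
  intros Hp Hr. apply Ccont_CPS; [easy|rewrite Cmod_circle; lra|].
  apply Ccont_mult; [apply Ccont_const|apply Ccont_Cexpi].
Qed.

Lemma CPS_circle_neg (p : nat -> C) (r : R) (k : nat) :
  ctame p -> 0 <= r < 1 ->
  Cint (fun t => CPS p (RtoC r * Cexpi t) * Cconj (Cexpi t) ^ k)%C 0 (2 * PI)
  = (RtoC (2 * PI) * (p k * RtoC r ^ k))%C.
Proof.
  intros Hp Hr. assert (HPI := PI_RGT_0).
  rewrite (Cint_ext _ (fun t => Cconj (Cexpi t) ^ k * CPS p (RtoC r * Cexpi t))%C)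
    by (intros; ring).
  assert (Hck : forall t, Ccont (fun t => Cconj (Cexpi t) ^ k)%C t).
  { intros t. apply Ccont_pow, Ccont_conj, Ccont_Cexpi. }
  rewrite (Cint_CPS (fun t => Cconj (Cexpi t) ^ k)%C (fun t => RtoC r * Cexpi t)%C p 1 r);
    auto; try lra.
  - rewrite (Csum_ext _ (fun n => p n * (RtoC r ^ n *
        (if Nat.eq_dec n k then RtoC (2 * PI) else RtoC 0)))%C).
    + rewrite (Csum_single _ k).
      * destruct (Nat.eq_dec k k); [ring|easy].
      * intros n Hn. destruct (Nat.eq_dec n k); [easy|]. ring.
    + intros n. f_equal. rewrite <- Cexpi_orth, <- Cint_scal.
      * apply Cint_ext. intros t. rewrite Cpow_mult_l. ring.
      * apply Ccont_integrable_any. intros t. apply Ccont_mult; [easy|].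
        apply Ccont_pow, Ccont_Cexpi.
  - intros t. rewrite Cmod_pow_conj_Cexpi. lra.
  - intros t. apply Ccont_mult; [apply Ccont_const|apply Ccont_Cexpi].
  - intros t. now apply Cmod_circle.
Qed.

Lemma CPS_circle_pos (p : nat -> C) (r : R) (k : nat) :
  ctame p -> 0 <= r < 1 ->
  Cint (fun t => CPS p (RtoC r * Cexpi t) * Cexpi t ^ k)%C 0 (2 * PI)
  = match k with 0%nat => (RtoC (2 * PI) * p 0%nat)%C | S _ => RtoC 0 end.
Proof.
  intros Hp Hr. assert (HPI := PI_RGT_0).
  rewrite (Cint_ext _ (fun t => Cexpi t ^ k * CPS p (RtoC r * Cexpi t))%C)
    by (intros; ring).
  assert (Hck : forall t, Ccont (fun t => Cexpi t ^ k)%C t).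
  { intros t. apply Ccont_pow, Ccont_Cexpi. }
  rewrite (Cint_CPS (fun t => Cexpi t ^ k)%C (fun t => RtoC r * Cexpi t)%C p 1 r);
    auto; try lra.
  - rewrite (Csum_ext _ (fun n => p n * (RtoC r ^ n *
        (match (k + n)%nat with 0%nat => RtoC (2 * PI) | S _ => RtoC 0 end)))%C).
    + rewrite (Csum_single _ 0).
      * destruct k; simpl; ring.
      * intros [|n] Hn; [easy|]. rewrite Nat.add_succ_r. ring.
    + intros n. f_equal. rewrite <- Cint_Cexpi_pow, <- Cint_scal.
      * apply Cint_ext. intros t. rewrite Cpow_mult_l, Cpow_add_r. ring.
      * apply Ccont_integrable_any. intros t. apply Ccont_pow, Ccont_Cexpi.
  - intros t. rewrite Cmod_pow, Cmod_Cexpi, pow1. lra.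
  - intros t. apply Ccont_mult; [apply Ccont_const|apply Ccont_Cexpi].
  - intros t. now apply Cmod_circle.
Qed.

Lemma CPS_conj (h : nat -> C) (z : C) :
  Cconj (CPS h z) = CPS (fun n => Cconj (h n)) (Cconj z).
Proof.
  unfold CPS. rewrite <- Csum_conj. apply Csum_ext. intros n.
  rewrite <- Cpow_conj. unfold Cconj, Cmult; simpl. f_equal; ring.
Qed.

(** Convolution of [p] and [h] as a mean over the circle of radius [r]; the
    antiholomorphic half of the kernel [2 * Re h] only sees the constant
    terms. *)
Lemma convolution_mean (p h : nat -> C) (k r : R) (q : C) :
  ctame p -> ctame h -> 0 <= r < 1 -> Cmod q < 1 ->
  Cint (fun t => CPS p (RtoC r * Cexpi t)
        * RtoC (2 * fst (CPS h (q * Cconj (Cexpi t))) - 2 * k))%C 0 (2 * PI)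
  = (RtoC (2 * PI) * (CPS (fun m => p m * h m) (RtoC r * q)
        + (Cconj (h 0%nat) - RtoC (2 * k)) * p 0%nat))%C.
Proof.
  intros Hp Hh Hr Hq. assert (HPI := PI_RGT_0).
  assert (Hcu : forall t, Ccont (fun t => CPS p (RtoC r * Cexpi t)) t).
  { intros t. now apply CPS_circle_cont. }
  destruct (circle_bounded (CPS p) r (proj1 Hr) Hcu) as [M HM].
  assert (Hc1 : forall t, Ccont (fun t => q * Cconj (Cexpi t))%C t).
  { intros t. apply Ccont_mult; [apply Ccont_const|]. apply Ccont_conj, Ccont_Cexpi. }
  assert (Hc2 : forall t, Ccont (fun t => Cconj q * Cexpi t)%C t).
  { intros t. apply Ccont_mult; [apply Ccont_const|]. apply Ccont_Cexpi. }
  assert (Hm1 : forall t, Cmod (q * Cconj (Cexpi t))%C = Cmod q).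
  { intros t. rewrite Cmod_mult, Cmod_conj, Cmod_Cexpi. ring. }
  assert (Hm2 : forall t, Cmod (Cconj q * Cexpi t)%C = Cmod q).
  { intros t. rewrite Cmod_mult, Cmod_conj, Cmod_Cexpi. ring. }
  set (hc := fun n => Cconj (h n)).
  assert (Hhc : ctame hc).
  { apply ctame_le with (1 := Hh). intros n. unfold hc. rewrite Cmod_conj. lra. }
  rewrite (Cint_ext _ (fun t =>
     CPS p (RtoC r * Cexpi t) * CPS h (q * Cconj (Cexpi t))
     + (CPS p (RtoC r * Cexpi t) * CPS hc (Cconj q * Cexpi t)
        + (- RtoC (2 * k)) * (CPS p (RtoC r * Cexpi t) * Cexpi t ^ 0)))%C).
  2:{ intros t.
      replace (Cconj q * Cexpi t)%C with (Cconj (q * Cconj (Cexpi t))).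
      2:{ unfold Cconj, Cmult; simpl. f_equal; ring. }
      unfold hc. rewrite <- CPS_conj.
      set (H := CPS h (q * Cconj (Cexpi t))). set (P := CPS p (RtoC r * Cexpi t)).
      replace (RtoC (2 * fst H - 2 * k)) with (H + Cconj H - RtoC (2 * k))%C.
      - simpl. ring.
      - unfold Cconj, Cminus, Cplus, Copp, RtoC; simpl. f_equal; ring. }
  assert (I1 : Cintegrable (fun t => CPS p (RtoC r * Cexpi t) * CPS h (q * Cconj (Cexpi t)))%C 0 (2 * PI)).
  { apply Ccont_integrable_any. intros t. apply Ccont_mult; [easy|].
    apply Ccont_CPS; auto. now rewrite Hm1. }
  assert (I2 : Cintegrable (fun t => CPS p (RtoC r * Cexpi t) * CPS hc (Cconj q * Cexpi t))%C 0 (2 * PI)).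
  { apply Ccont_integrable_any. intros t. apply Ccont_mult; [easy|].
    apply Ccont_CPS; auto. now rewrite Hm2. }
  assert (I3 : Cintegrable (fun t => CPS p (RtoC r * Cexpi t) * Cexpi t ^ 0)%C 0 (2 * PI)).
  { apply Ccont_integrable_any. intros t. apply Ccont_mult; [easy|]. apply Ccont_const. }
  rewrite Cint_plus, Cint_plus, Cint_scal; auto using Cintegrable_plus, Cintegrable_scal.
  rewrite (CPS_circle_pos p r 0 Hp Hr).
  rewrite (Cint_CPS (fun t => CPS p (RtoC r * Cexpi t)) (fun t => q * Cconj (Cexpi t))%C
             h M (Cmod q)); auto; try lra.
  rewrite (Cint_CPS (fun t => CPS p (RtoC r * Cexpi t)) (fun t => Cconj q * Cexpi t)%C
             hc M (Cmod q)); auto; try lra.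
  rewrite (Csum_single (fun n => hc n
    * Cint (fun t => CPS p (RtoC r * Cexpi t) * (Cconj q * Cexpi t) ^ n) 0 (2 * PI))%C 0).
  2:{ intros [|n] Hn; [easy|].
      rewrite (Cint_ext _ (fun t => Cconj q ^ S n * (CPS p (RtoC r * Cexpi t) * Cexpi t ^ S n))%C).
      - rewrite Cint_scal.
        + rewrite (CPS_circle_pos p r (S n) Hp Hr). ring.
        + apply Ccont_integrable_any. intros t. apply Ccont_mult; [easy|].
          apply Ccont_pow, Ccont_Cexpi.
      - intros t. rewrite Cpow_mult_l. ring. }
  assert (E0 := CPS_circle_pos p r 0 Hp Hr). simpl in E0.
  assert (E1 : Cint (fun t => CPS p (RtoC r * Cexpi t) * (Cconj q * Cexpi t) ^ 0)%C 0 (2 * PI)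
               = (RtoC (2 * PI) * p 0%nat)%C) by exact E0.
  rewrite E1.
  rewrite (Csum_ext _ (fun n => RtoC (2 * PI) * (p n * h n * (RtoC r * q) ^ n))%C).
  2:{ intros n.
      rewrite (Cint_ext _ (fun t => q ^ n * (CPS p (RtoC r * Cexpi t) * Cconj (Cexpi t) ^ n))%C).
      - rewrite Cint_scal.
        + rewrite CPS_circle_neg by easy. rewrite Cpow_mult_l. ring.
        + apply Ccont_integrable_any. intros t. apply Ccont_mult; [easy|].
          apply Ccont_pow, Ccont_conj, Ccont_Cexpi.
      - intros t. rewrite Cpow_mult_l. ring. }
  rewrite Csum_scal.
  - fold (CPS (fun m => p m * h m)%C (RtoC r * q)). unfold hc. ring.
  - destruct (Hp r Hr) as [N HN].
    apply Cabs_summable_le with (fun n => N * (Rabs (Cmod (h n)) * Cmod q ^ n)).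
    + intros n. rewrite Cpow_mult_l, !Cmod_mult, !Cmod_pow, Cmod_R, (Rabs_pos_eq r) by lra.
      specialize (HN n). rewrite Rabs_pos_eq in HN by apply Cmod_ge_0.
      rewrite Rabs_pos_eq by apply Cmod_ge_0.
      replace (Cmod (p n) * Cmod (h n) * (r ^ n * Cmod q ^ n))
        with (Cmod (p n) * r ^ n * (Cmod (h n) * Cmod q ^ n)) by ring.
      apply Rmult_le_compat_r; [|easy].
      apply Rmult_le_pos; [apply Cmod_ge_0|apply pow_le, Cmod_ge_0].
    + apply (@ex_series_scal_l R_AbsRing). apply tame_ex_series; [easy|].
      split; [apply Cmod_ge_0|easy].
Qed.

(** The kernel [2 * Re h - 2 * k] is nonnegative with mean [2 - 2 * k], so the
    mean of [p] against it lies in every open half plane, bounded by a line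
    through 0, that contains the values of [p]. *)
Lemma convolution_half_plane (p h : nat -> C) (k : R) (d z : C) :
  ctame p -> ctame h -> h 0%nat = RtoC 1 -> k < 1 ->
  (forall w, Cmod w < 1 -> k <= fst (CPS h w)) ->
  (forall w, Cmod w < 1 -> 0 < fst (d * CPS p w)%C) ->
  Cmod z < 1 ->
  0 < fst (d * (CPS (fun m => p m * h m) z + RtoC (1 - 2 * k) * p 0%nat))%C.
Proof.
  intros Hp Hh Hh0 Hk Hhk Hpd Hz. assert (HPI := PI_RGT_0). assert (Hz0 := Cmod_ge_0 z).
  set (r := (1 + Cmod z) / 2).
  assert (Hr : Cmod z < r < 1) by (unfold r; lra).
  assert (Hr0 : RtoC r <> RtoC 0) by (apply RtoC_neq_0; lra).
  set (q := (z / RtoC r)%C).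
  assert (Hq : Cmod q < 1).
  { unfold q. rewrite Cmod_div, Cmod_R, Rabs_pos_eq by (easy || lra).
    apply Rlt_div_l; lra. }
  assert (Hrq : (RtoC r * q)%C = z) by (unfold q; now field).
  set (ker := fun t => 2 * fst (CPS h (q * Cconj (Cexpi t))) - 2 * k).
  assert (Hm1 : forall t, Cmod (q * Cconj (Cexpi t))%C = Cmod q).
  { intros t. rewrite Cmod_mult, Cmod_conj, Cmod_Cexpi. ring. }
  assert (Hker : forall t, 0 <= ker t).
  { intros t. unfold ker. specialize (Hhk (q * Cconj (Cexpi t))%C).
    rewrite Hm1 in Hhk. specialize (Hhk Hq). lra. }
  assert (Hkc : forall t, Ccont (fun t => RtoC (ker t)) t).
  { intros t.
    assert (Hc : Ccont (fun t => CPS h (q * Cconj (Cexpi t))) t).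
    { apply Ccont_CPS; [easy|now rewrite Hm1|].
      apply Ccont_mult; [apply Ccont_const|]. apply Ccont_conj, Ccont_Cexpi. }
    split; [|apply continuous_const].
    apply (continuous_minus (fun t => 2 * fst (CPS h (q * Cconj (Cexpi t)))) (fun _ => 2 * k));
      [|apply continuous_const].
    apply (continuous_mult (fun _ => 2) (fun t => fst (CPS h (q * Cconj (Cexpi t)))));
      [apply continuous_const|]. apply Hc. }
  assert (Hr' : 0 <= r < 1) by lra.
  assert (HPc : forall t, Ccont (fun t => CPS p (RtoC r * Cexpi t)) t).
  { intros t. now apply CPS_circle_cont. }
  set (re := fun t => fst (d * CPS p (RtoC r * Cexpi t))%C).
  assert (Hrec : forall t, continuous re t).
  { intros t.
    exact (proj1 (Ccont_mult (fun _ => d) (fun t => CPS p (RtoC r * Cexpi t)) t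
                    (Ccont_const d t) (HPc t))). }
  destruct (continuity_ab_min re 0 (2 * PI)) as [tm [Hmin _]]; [lra| |].
  { intros c _. apply continuity_pt_filterlim, Hrec. }
  set (m := re tm) in *.
  assert (Hm : 0 < m).
  { apply Hpd. rewrite Cmod_circle; lra. }
  (* Total mass of the kernel: the case [p = 1]. *)
  set (one := fun n : nat => match n with 0%nat => RtoC 1 | S _ => RtoC 0 end).
  assert (Hone : forall w, CPS one w = RtoC 1).
  { intros w. unfold CPS. rewrite (Csum_single _ 0).
    - simpl. ring.
    - intros [|n] Hn; [easy|]. simpl. ring. }
  assert (Tone : ctame one).
  { apply ctame_le with (fun _ => RtoC 1); [apply ctame_R, tame_1|].
    intros [|n]; simpl; rewrite ?Cmod_0, ?Cmod_1; lra. }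
  assert (Emass := convolution_mean one h k r q Tone Hh Hr' Hq).
  rewrite (Cint_ext _ (fun t => RtoC (ker t))) in Emass.
  2:{ intros t. rewrite Hone. unfold ker. ring. }
  assert (Eoh : CPS (fun n => one n * h n)%C (RtoC r * q) = RtoC 1).
  { unfold CPS. rewrite (Csum_single _ 0).
    - simpl. rewrite Hh0. ring.
    - intros [|n] Hn; [easy|]. simpl. ring. }
  rewrite Eoh in Emass. simpl (one 0%nat) in Emass. rewrite Hh0 in Emass.
  assert (Hmass : RInt ker 0 (2 * PI) = 2 * PI * (2 - 2 * k)).
  { apply (f_equal fst) in Emass.
    change (RInt ker 0 (2 * PI) = fst (RtoC (2 * PI)
       * (RtoC 1 + (Cconj (RtoC 1) - RtoC (2 * k)) * RtoC 1))%C) in Emass.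
    rewrite Emass. simpl. ring. }
  assert (Emean : Cint (fun t => CPS p (RtoC r * Cexpi t) * RtoC (ker t))%C 0 (2 * PI)
     = (RtoC (2 * PI) * (CPS (fun m => p m * h m) (RtoC r * q)
        + (Cconj (h 0%nat) - RtoC (2 * k)) * p 0%nat))%C)
    by exact (convolution_mean p h k r q Hp Hh Hr' Hq).
  rewrite Hrq, Hh0 in Emean.
  replace (Cconj (RtoC 1) - RtoC (2 * k))%C with (RtoC (1 - 2 * k)) in Emean.
  2:{ unfold Cconj, Cminus, Cplus, Copp, RtoC; simpl. f_equal; ring. }
  set (T := (CPS (fun m => p m * h m) z + RtoC (1 - 2 * k) * p 0%nat)%C) in *.
  assert (Hex : ex_RInt ker 0 (2 * PI)).
  { apply (ex_RInt_continuous (V := R_CompleteNormedModule)). intros t _. apply Hkc. }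
  assert (Hrk : ex_RInt (fun t => re t * ker t) 0 (2 * PI)).
  { apply (ex_RInt_continuous (V := R_CompleteNormedModule)). intros t _.
    apply (continuous_mult re ker); [apply Hrec|apply Hkc]. }
  assert (HT : RInt (fun t => re t * ker t) 0 (2 * PI) = 2 * PI * fst (d * T)%C).
  { assert (E := Cint_scal d (fun t => CPS p (RtoC r * Cexpi t) * RtoC (ker t))%C 0 (2 * PI)).
    rewrite Emean in E.
    assert (E' := E (Ccont_integrable_any _ _ _ (fun t => Ccont_mult _ _ t (HPc t) (Hkc t)))).
    apply (f_equal fst) in E'.
    transitivity (fst (d * (RtoC (2 * PI) * T))%C).
    - rewrite <- E'. unfold Cint. cbv beta iota. simpl fst at 1.
      apply (RInt_ext (V := R_CompleteNormedModule)). intros t _.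
      unfold re. simpl. match goal with |- @eq _ ?x ?y => change (@eq R x y) end. ring.
    - simpl. ring. }
  assert (Hge : m * (2 * PI * (2 - 2 * k)) <= 2 * PI * fst (d * T)%C).
  { rewrite <- HT, <- Hmass.
    replace (m * RInt ker 0 (2 * PI)) with (RInt (fun t => m * ker t) 0 (2 * PI)).
    2:{ apply (RInt_scal (V := R_CompleteNormedModule) ker 0 (2 * PI) m Hex). }
    apply RInt_le; [lra| |easy|].
    - apply (ex_RInt_scal (V := R_NormedModule) ker 0 (2 * PI) m Hex).
    - intros t Ht. apply Rmult_le_compat_r; [apply Hker|]. apply Hmin. lra. }
  assert (0 < m * (2 * PI * (2 - 2 * k))).
  { apply Rmult_lt_0_compat; [easy|]. apply Rmult_lt_0_compat; lra. }
  nra.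
Qed.

(** * The extremal constant *)

Lemma tame_sq : tame (fun n => INR (S n) ^ 2).
Proof.
  apply tame_dom with (1 := tame_S_INR) (K := 1). intros n.
  replace (INR (S n) ^ 2) with (INR (S n) * INR (S n)) by ring.
  rewrite Rabs_mult, (Rabs_pos_eq (INR (S n))) by apply pos_INR. lra.
Qed.

(** The right hand side is the derivative of [x / (1 + x)^2]. *)
Lemma PSeries_koebe_derive (x : R) : Rabs x < 1 ->
  PSeries (fun n => INR (S n) ^ 2 * (-1) ^ n) x = (1 - x) / (1 + x) ^ 3.
Proof.
  intros Hx. apply Rabs_def2 in Hx as Hx'.
  set (u := fun n => - (INR n * (-1) ^ n)).
  assert (Tu : tame u) by (apply tame_opp, tame_alt, tame_INR).
  assert (Eu : forall y, Rabs y < 1 -> PSeries u y = y / (1 + y) ^ 2).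
  { intros y Hy. apply Rabs_def2 in Hy as Hy'.
    change (PSeries (PS_opp (fun n => INR n * (-1) ^ n)) y = y / (1 + y) ^ 2).
    rewrite PSeries_opp, PSeries_alt_INR by easy. field. lra. }
  rewrite (PSeries_ext _ (PS_derive u)).
  - rewrite <- Derive_PSeries by now apply tame_CV_radius.
    rewrite (Derive_ext_loc _ (fun y => y / (1 + y) ^ 2)).
    + apply is_derive_unique. auto_derive; [|field; lra].
      rewrite Rmult_1_r. apply Rmult_integral_contrapositive_currified; lra.
    + exists (mkposreal (1 - Rabs x) ltac:(lra)). intros y Hy.
      change (Rabs (y + - x) < 1 - Rabs x) in Hy. apply Eu.
      replace y with ((y + - x) + x) by ring.
      apply Rle_lt_trans with (1 := Rabs_triang _ _). lra.
  - intros n. unfold PS_derive, u. change ((-1) ^ S n) with (-1 * (-1) ^ n). ring.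
Qed.

Lemma int01_eq (V : CompleteNormedModule R_AbsRing) (h k : R -> V) (l : V) :
  (forall t, 0 < t < 1 -> k t = h t) ->
  is_RInt_gen k (at_right 0) (at_left 1) l -> int01 h = l.
Proof.
  intros H Hk. apply (is_RInt_gen_unique (V := V)).
  apply (is_RInt_gen_ext k h) with (2 := Hk).
  apply (Filter_prod (at_right 0) (at_left 1) _ (fun x => 0 < x < 1) (fun y => 0 < y < 1)).
  - apply (at_right_0_near 1 Rlt_0_1).
  - apply (at_left_1_near 0 Rlt_0_1).
  - intros x y Hx Hy t. simpl. intros Ht. apply H.
    assert (A1 := Rmin_glb_lt x y 0). assert (A2 := Rmax_lub_lt x y 1). lra.
Qed.

Lemma PSeries_dilate (d : nat -> R) (t x : R) :
  PSeries (fun n => d n * t ^ n) x = PSeries d (t * x).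
Proof. apply Series_ext. intros n. rewrite Rpow_mult_distr. ring. Qed.

(** The inner integrals in the equations of [g] and [q]; since [t < 1], the
    averaged series is continuous up to the end point. *)
Lemma int01_dilated (a t : R) (d : nat -> R) (phi : R -> R) :
  tame d -> 0 < a -> 0 < t < 1 -> (forall x, 0 <= x < 1 -> phi x = PSeries d x) ->
  int01 (V := R_CompleteNormedModule) (fun s => Rpower s (a - 1) * phi (s * t))
  = PSeries (avg a d) t.
Proof.
  intros Hd Ha Ht Hphi.
  set (e := fun n => d n * t ^ n).
  assert (He : tame e).
  { apply tame_le with (1 := Hd). intros n. unfold e.
    rewrite Rabs_mult, <- RPow_abs, (Rabs_pos_eq t) by lra.
    rewrite <- (Rmult_1_r (Rabs (d n))) at 2.
    apply Rmult_le_compat_l; [apply Rabs_pos|].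
    rewrite <- (pow1 n). apply pow_incr. lra. }
  apply int01_eq with (fun s => Rpower s (a - 1) * PSeries e s).
  - intros s Hs. unfold e. rewrite PSeries_dilate. rewrite Hphi by nra.
    now rewrite (Rmult_comm s t).
  - apply int01_avg; [easy|easy|].
    assert (E : forall x, PSeries (avg a d) (t * x) = PSeries (avg a e) x).
    { intros x. rewrite <- PSeries_dilate. apply PSeries_ext. intros n.
      unfold avg, e, Rdiv. ring. }
    apply filterlim_ext with (1 := E).
    replace (PSeries (avg a d) t) with (PSeries (avg a d) (t * 1)) by (f_equal; ring).
    apply (filterlim_filter_le_1 (F := locally 1)); [apply filter_le_within|].
    apply (continuous_comp (fun x => t * x) (PSeries (avg a d)) 1).
    + apply (continuous_mult (fun _ => t) (fun x => x)); [apply continuous_const|apply continuous_id].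
    + apply PSeries_continuous; [now apply tame_avg|]. rewrite Rmult_1_r, Rabs_pos_eq; lra.
Qed.

Definition ode_coef (mu nu : R) (d : nat -> R) (n : nat) : R :=
  d n / ((1 + mu * INR n) * (1 + nu * INR n)).

Lemma tame_ode_coef (mu nu : R) (d : nat -> R) :
  0 < mu -> 0 < nu -> tame d -> tame (ode_coef mu nu d).
Proof.
  intros Hmu Hnu Hd. apply tame_le with (1 := Hd). intros n.
  assert (Hn := pos_INR n).
  assert (0 <= mu * INR n) by (apply Rmult_le_pos; lra).
  assert (0 <= nu * INR n) by (apply Rmult_le_pos; lra).
  unfold ode_coef, Rdiv. rewrite Rabs_mult, Rabs_inv, (Rabs_pos_eq (_ * _)) by nra.
  rewrite <- (Rmult_1_r (Rabs (d n))) at 2.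
  apply Rmult_le_compat_l; [apply Rabs_pos|].
  rewrite <- Rinv_1. apply Rinv_le_contravar; nra.
Qed.

(** The singular equation determines its solution among functions with a
    finite limit at the origin: there [t^(1/nu)] forces the difference with
    the power series solution to vanish. *)
Lemma ode_unique (mu nu K : R) (d : nat -> R) (y : R -> R) (y0 : R) :
  0 < mu -> 0 < nu -> tame d ->
  filterlim y (at_right 0) (locally y0) ->
  (forall t, 0 < t < 1 ->
     is_derive (fun u => Rpower u (1 / nu) * y u) t
       (K / (mu * nu) * Rpower t (1 / nu - 1) * PSeries (avg (1 / mu) d) t)) ->
  forall t, 0 < t < 1 ->
    y t = K * PSeries (ode_coef mu nu d) t.
Proof.
  intros Hmu Hnu Hd Hlim Hder t Ht.
  set (b := 1 / nu) in *. set (a := 1 / mu) in *.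
  assert (Hb : 0 < b) by (apply Rdiv_lt_0_compat; lra).
  assert (Ha : 0 < a) by (apply Rdiv_lt_0_compat; lra).
  assert (Ta : tame (avg a d)) by now apply tame_avg.
  assert (Tb : tame (avg b (avg a d))) by now apply tame_avg.
  set (k := K / (mu * nu)) in *.
  set (F := fun u => Rpower u b * y u - k * (Rpower u b * PSeries (avg b (avg a d)) u)).
  assert (HF : forall u, 0 < u < 1 -> is_derive F u 0).
  { intros u Hu.
    assert (H1 := Hder u Hu).
    assert (H2 := avg_is_derive b u (avg a d) Ta Hb Hu).
    assert (H3 := is_derive_scal _ u k _ H2).
    assert (H4 := is_derive_minus (K := R_AbsRing) (V := R_NormedModule) _ _ _ _ _ H1 H3).
    replace 0 with (minus (k * Rpower u (b - 1) * PSeries (avg a d) u)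
                          (mult k (Rpower u (b - 1) * PSeries (avg a d) u))).
    - exact H4.
    - unfold minus, plus, opp, mult; simpl. unfold mult; simpl. ring. }
  assert (Hconst : forall u, 0 < u <= t -> F u = F t).
  { intros u Hu. apply Rle_antisym.
    - apply (derive_nonneg_le F (fun _ => 0)); [lra| |intros; lra].
      intros x Hx. apply HF. lra.
    - apply Ropp_le_cancel.
      apply (derive_nonneg_le (fun x => - F x) (fun _ => - 0)); [lra| |intros; lra].
      intros x Hx. apply (is_derive_opp (K := R_AbsRing) (V := R_NormedModule)).
      apply HF. lra. }
  assert (HL : filterlim F (at_right 0) (locally (0 * y0 - k * 0))).
  { apply (filterlim_comp_2 (G := locally (0 * y0)) (H := locally (- (k * 0)))
       (fun u => Rpower u b * y u) (fun u => - (k * (Rpower u b * PSeries (avg b (avg a d)) u))) Rplus).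
    - apply (filterlim_comp_2 (G := locally 0) (H := locally y0) (fun u => Rpower u b) y Rmult).
      + now apply Rpower_lim_0.
      + exact Hlim.
      + apply (filterlim_mult (K := R_AbsRing) 0 y0).
    - apply filterlim_comp with (locally (k * 0)).
      + apply filterlim_comp with (locally 0); [now apply avg_lim_0|].
        apply (filterlim_scal_r (K := R_AbsRing) (V := R_NormedModule) k 0).
      + apply (filterlim_opp (K := R_AbsRing) (V := R_NormedModule) (k * 0)).
    - apply (filterlim_plus (K := R_AbsRing) (V := R_NormedModule) (0 * y0) (- (k * 0))). }
  assert (HFt : F t = 0 * y0 - k * 0).
  { apply (filterlim_locally_unique (F := at_right 0) F); [|exact HL].
    apply filterlim_ext_loc with (fun _ => F t); [|apply filterlim_const].
    apply filter_imp with (2 := at_right_0_near t (proj1 Ht)). intros u Hu. symmetry. apply Hconst. lra. }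
  assert (Hp : 0 < Rpower t b) by apply exp_pos.
  unfold F in HFt.
  assert (E : y t = k * PSeries (avg b (avg a d)) t).
  { apply Rmult_eq_reg_l with (Rpower t b); [|lra]. lra. }
  rewrite E. unfold k. rewrite <- !PSeries_scal. apply PSeries_ext. intros n.
  change (K / (mu * nu) * avg b (avg a d) n = K * ode_coef mu nu d n).
  unfold ode_coef, avg, a, b.
  assert (Pmu := one_plus_pos mu n ltac:(lra)). assert (Pnu := one_plus_pos nu n ltac:(lra)).
  field. repeat split; lra.
Qed.

Lemma is_g_series (mu nu : R) (g : R -> R) (t : R) :
  0 < mu -> 0 < nu -> is_g mu nu g -> 0 < t < 1 ->
  1 + g t = 2 * PSeries (ode_coef mu nu (fun n => INR (S n) * (-1) ^ n)) t.
Proof.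
  intros Hmu Hnu [_ [Hlim Hder]] Ht.
  assert (Ha : 0 < 1 / mu) by (apply Rdiv_lt_0_compat; lra).
  assert (Td : tame (fun n => INR (S n) * (-1) ^ n)) by (apply tame_alt, tame_S_INR).
  apply (ode_unique mu nu 2 _ (fun t => 1 + g t) (1 + g 0)); auto.
  - apply (filterlim_comp_2 (G := locally 1) (H := locally (g 0)) (fun _ => 1) g Rplus).
    + apply filterlim_const.
    + exact Hlim.
    + apply (filterlim_plus (K := R_AbsRing) (V := R_NormedModule) 1 (g 0)).
  - intros u Hu. specialize (Hder u Hu).
    rewrite <- (int01_dilated (1 / mu) u _ (fun x => / (1 + x) ^ 2) Td Ha Hu).
    + exact Hder.
    + intros x Hx. rewrite PSeries_koebe by (rewrite Rabs_pos_eq; lra).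
      unfold Rdiv. ring.
Qed.

Lemma is_q_series (mu nu : R) (q : R -> R) (t : R) :
  0 < mu -> 0 < nu -> is_q mu nu q -> 0 < t < 1 ->
  q t = PSeries (ode_coef mu nu (fun n => INR (S n) ^ 2 * (-1) ^ n)) t.
Proof.
  intros Hmu Hnu [_ [Hlim Hder]] Ht.
  assert (Ha : 0 < 1 / mu) by (apply Rdiv_lt_0_compat; lra).
  assert (Td : tame (fun n => INR (S n) ^ 2 * (-1) ^ n)) by (apply tame_alt, tame_sq).
  rewrite <- (Rmult_1_l (PSeries _ t)).
  apply (ode_unique mu nu 1 _ q (q 0)); auto.
  intros u Hu. specialize (Hder u Hu).
  rewrite <- (int01_dilated (1 / mu) u _ (fun x => (1 - x) / (1 + x) ^ 3) Td Ha Hu).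
  - exact Hder.
  - intros x Hx. rewrite PSeries_koebe_derive by (rewrite Rabs_pos_eq; lra). easy.
Qed.

(** The two series combine into the coefficients [(m+1)(1+xi m)(-1)^m] over
    [(1+mu m)(1+nu m)], and the weight [t^c] supplies the missing factor of
    [weight]; the integral is the limit of the Koebe values at [-1]. *)
Lemma int01_gq (mu nu xi c kappa : R) (g q : R -> R) :
  0 < mu -> 0 < nu -> 0 <= xi -> -1 < c -> is_g mu nu g -> is_q mu nu q ->
  filterlim (koebe mu nu xi c) (at_left 1) (locally kappa) ->
  (1 + c) * int01 (V := R_CompleteNormedModule) (fun t => Rpower t c
                * ((1 - xi) * g t + xi * (2 * q t - 1)))
  = 2 * kappa - 1.
Proof.
  intros Hmu Hnu Hxi Hc Hg Hq Hk.
  set (dg := ode_coef mu nu (fun n => INR (S n) * (-1) ^ n)).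
  set (dq := ode_coef mu nu (fun n => INR (S n) ^ 2 * (-1) ^ n)).
  assert (Tg : tame dg) by (now apply tame_ode_coef, tame_alt, tame_S_INR).
  assert (Tq : tame dq) by (now apply tame_ode_coef, tame_alt, tame_sq).
  set (one := fun n : nat => match n with 0%nat => 1 | S _ => 0 end).
  assert (Tone : tame one).
  { apply tame_le with (1 := tame_1). intros [|n]; simpl; rewrite ?Rabs_R0, ?Rabs_R1; lra. }
  assert (Eone : forall x, PSeries one x = 1).
  { intros x. assert (E := PSeries_decr_1 one x).
    rewrite E.
    - rewrite (PSeries_ext _ (fun _ => 0)) by easy. rewrite PSeries_const_0. simpl. ring.
    - apply (ex_pseries_R one x).
      apply (@ex_series_incr_1 R_AbsRing R_NormedModule).
      apply ex_series_ext with (2 := ex_series_0).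
      intros n. symmetry. apply Rmult_0_l. }
  set (e := fun n => (1 - xi) * dg n + xi * dq n).
  assert (Te : tame e) by (apply tame_plus; now apply tame_scal_l).
  set (d := fun n => 2 * e n + (-1) * one n).
  assert (Td : tame d) by (apply tame_plus; now apply tame_scal_l).
  assert (Ed : forall x, Rabs x < 1 ->
     PSeries d x = 2 * ((1 - xi) * PSeries dg x + xi * PSeries dq x) - 1).
  { intros x Hx. unfold d, e. rewrite !PSeries_lin, Eone by easy. ring. }
  assert (Hc1 : 0 < c + 1) by lra.
  assert (Hint : int01 (V := R_CompleteNormedModule) (fun t => Rpower t c
                * ((1 - xi) * g t + xi * (2 * q t - 1))) = (2 * kappa - 1) / (1 + c)).
  { apply int01_eq with (fun s => Rpower s (c + 1 - 1) * PSeries d s).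
    - intros t Ht. replace (c + 1 - 1) with c by ring.
      rewrite Ed by (rewrite Rabs_pos_eq; lra).
      assert (E1 := is_g_series mu nu g t Hmu Hnu Hg Ht).
      assert (E2 := is_q_series mu nu q t Hmu Hnu Hq Ht).
      fold dg in E1. fold dq in E2. rewrite E2.
      replace (g t) with (2 * PSeries dg t - 1) by lra.
      match goal with |- @eq _ ?u ?v => change (@eq R u v) end. ring.
    - apply int01_avg; [easy|easy|].
      set (F := fun x => (2 * koebe mu nu xi c x - 1) / (1 + c)).
      assert (HF : forall x, Rabs x < 1 -> F x = PSeries (avg (c + 1) d) x).
      { intros x Hx. unfold F, koebe.
        set (w := fun m => weight mu nu xi c m * (INR (S m) * (-1) ^ m)).
        assert (Tw : tame w) by (apply tame_weight; try lra; apply tame_alt, tame_S_INR).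
        rewrite (PSeries_ext (avg (c + 1) d)
          (fun n => 2 / (1 + c) * w n + - / (1 + c) * one n)).
        - rewrite PSeries_lin, Eone by easy. field. lra.
        - intros n. unfold w, avg, d, e, dg, dq, ode_coef, weight.
          assert (Hn := pos_INR n).
          assert (Pmu := one_plus_pos mu n ltac:(lra)).
          assert (Pnu := one_plus_pos nu n ltac:(lra)).
          rewrite S_INR. destruct n as [|n]; unfold one.
          + simpl. field. lra.
          + field. repeat split; lra. }
      apply filterlim_ext_loc with F.
      + apply filter_imp with (2 := at_left_1_near 0 Rlt_0_1). intros x Hx.
        apply HF. rewrite Rabs_pos_eq; lra.
      + refine (filterlim_comp _ _ _ (koebe mu nu xi c) (fun y => (2 * y - 1) / (1 + c)) _ _ _ Hk _).
        apply (ex_derive_cont (fun y => (2 * y - 1) / (1 + c)) kappa).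
        auto_derive. easy. }
  rewrite Hint. field. lra.
Qed.

(** * The integral operator on Taylor series *)

Lemma is_RInt_gen_pair (f : R -> C) (Fa Fb : (R -> Prop) -> Prop) (l1 l2 : R) :
  Filter Fa -> Filter Fb ->
  is_RInt_gen (V := R_NormedModule) (fun t => fst (f t)) Fa Fb l1 ->
  is_RInt_gen (V := R_NormedModule) (fun t => snd (f t)) Fa Fb l2 ->
  is_RInt_gen (V := C_R_NormedModule) f Fa Fb (l1, l2).
Proof.
  intros FFa FFb H1 H2 P [eps HP].
  assert (K1 := H1 (ball l1 eps) (locally_ball l1 eps)).
  assert (K2 := H2 (ball l2 eps) (locally_ball l2 eps)).
  unfold filtermapi in *.
  assert (K := filter_and _ _ K1 K2). apply filter_imp with (2 := K).
  intros ab [[y1 [A1 B1]] [y2 [A2 B2]]].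
  exists (y1, y2). split.
  - now apply (is_RInt_fct_extend_pair (U := R_NormedModule) (V := R_NormedModule) f).
  - apply HP. now split.
Qed.

(** The factor [(1 + c) / (c + n)] may be singular at [n = 0], where functions
    vanishing at the origin have no term. *)
Definition V_coef (c : R) (a : nat -> C) (n : nat) : C :=
  match n with
  | 0%nat => RtoC 0
  | S m => (RtoC ((1 + c) / (1 + c + INR m)) * a (S m))%C
  end.

Lemma ctame_V_coef (c : R) (a : nat -> C) :
  -1 < c -> ctame a -> ctame (fun m => V_coef c a (S m)).
Proof.
  intros Hc Ha. apply ctame_le with (1 := ctame_S _ Ha). intros m.
  unfold V_coef. assert (Hm := pos_INR m).
  rewrite Cmod_mult, Cmod_R, Rabs_pos_eq by (apply Rdiv_le_0_compat; lra).
  rewrite <- (Rmult_1_l (Cmod (a (S m)))) at 2.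
  apply Rmult_le_compat_r; [apply Cmod_ge_0|]. apply Rle_div_l; lra.
Qed.

Lemma ctame_V_coef_all (c : R) (a : nat -> C) : -1 < c -> ctame a -> ctame (V_coef c a).
Proof.
  intros Hc Ha. apply (tame_unshift (fun n => Cmod (V_coef c a n))).
  now apply (ctame_V_coef c a).
Qed.

(** Along the ray through [z] both components of the integrand are [t^c]
    times a real power series. *)
Lemma V_op_series (c : R) (f : C -> C) (a : nat -> C) (z : C) :
  -1 < c -> ctame a -> a 0%nat = RtoC 0 ->
  (forall w, Cmod w < 1 -> f w = CPS a w) -> Cmod z < 1 ->
  V_op c f z = CPS (V_coef c a) z.
Proof.
  intros Hc Ha Ha0 Hf Hz. assert (Hc1 : 0 < c + 1) by lra.
  assert (Hz0 := Cmod_ge_0 z).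
  set (b := fun m => (RtoC (/ (INR m + (c + 1))) * a (S m))%C).
  assert (Tb : ctame b).
  { apply ctame_le with (fun m => / RtoC (1 + c) * V_coef c a (S m))%C.
    - apply ctame_scal. now apply ctame_V_coef.
    - intros m. right. f_equal. unfold b, V_coef.
      assert (Hm := pos_INR m).
      unfold Rdiv. rewrite RtoC_mult.
      replace (INR m + (c + 1)) with (1 + c + INR m) by ring.
      field. apply RtoC_neq_0. lra. }
  assert (EV : CPS (V_coef c a) z = (RtoC (1 + c) * (z * CPS b z))%C).
  { rewrite CPS_S by (easy || now apply ctame_V_coef_all).
    rewrite (CPS_ext (fun n => V_coef c a (S n)) (fun n => RtoC (1 + c) * b n)%C).
    - rewrite CPS_scal by easy. simpl. ring.
    - intros n. unfold b, V_coef, Rdiv. rewrite RtoC_mult.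
      replace (INR n + (c + 1)) with (1 + c + INR n) by ring. ring. }
  rewrite EV. unfold V_op. f_equal.
  set (d1 := fun m => fst (a (S m) * z ^ S m)%C).
  set (d2 := fun m => snd (a (S m) * z ^ S m)%C).
  assert (Taz : ctame (fun m => a (S m) * z ^ S m)%C).
  { apply (ctame_S (fun m => a m * z ^ m)%C). apply ctame_ray; [easy|lra]. }
  assert (T1 : tame d1) by exact (tame_fst _ Taz).
  assert (T2 : tame d2) by exact (tame_snd _ Taz).
  set (Ez := fun x => (z * CPS b (RtoC x * z))%C).
  assert (HEz : forall x, Ez x = CPS (fun n => z * b n)%C (RtoC x * z) \/ 1 <= Cmod (RtoC x * z)%C).
  { intros x. destruct (Rlt_le_dec (Cmod (RtoC x * z)%C) 1) as [H|H]; [left|now right].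
    unfold Ez. now rewrite CPS_scal. }
  assert (Hxz : forall x, 0 <= x <= 1 -> Cmod (RtoC x * z)%C < 1).
  { intros x Hx. rewrite Cmod_mult, Cmod_R, Rabs_pos_eq by lra. nra. }
  assert (E1 : forall x, 0 <= x <= 1 -> fst (Ez x) = PSeries (avg (c + 1) d1) x).
  { intros x Hx. destruct (HEz x) as [H|H]; [|specialize (Hxz x Hx); lra].
    rewrite H, Re_CPS_ray. apply PSeries_ext. intros n.
    unfold avg, d1, b. simpl (z ^ S n)%C.
    replace (z * (RtoC (/ (INR n + (c + 1))) * a (S n)) * z ^ n)%C
      with (RtoC (/ (INR n + (c + 1))) * (a (S n) * (z * z ^ n)))%C by ring.
    change (fst (RtoC ?k * ?w)%C) with (k * fst w - 0 * snd w). unfold Rdiv. ring. }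
  assert (E2 : forall x, 0 <= x <= 1 -> snd (Ez x) = PSeries (avg (c + 1) d2) x).
  { intros x Hx. destruct (HEz x) as [H|H]; [|specialize (Hxz x Hx); lra].
    rewrite H, Im_CPS_ray. apply PSeries_ext. intros n.
    unfold avg, d2, b. simpl (z ^ S n)%C.
    replace (z * (RtoC (/ (INR n + (c + 1))) * a (S n)) * z ^ n)%C
      with (RtoC (/ (INR n + (c + 1))) * (a (S n) * (z * z ^ n)))%C by ring.
    change (snd (RtoC ?k * ?w)%C) with (k * snd w + 0 * fst w). unfold Rdiv. ring. }
  assert (HcE : Ccont Ez 1).
  { apply Ccont_mult; [apply Ccont_const|].
    apply Ccont_CPS; [easy|apply Hxz; lra|].
    apply Ccont_mult; [|apply Ccont_const].
    split; [apply continuous_id|apply continuous_const]. }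
  assert (Hloc : forall u v : R -> R, (forall x, 0 <= x <= 1 -> u x = v x) ->
     continuous u 1 -> filterlim v (at_left 1) (locally (u 1))).
  { intros u v Huv Hu. apply filterlim_ext_loc with u.
    - apply filter_imp with (2 := at_left_1_near 0 Rlt_0_1). intros x Hx. apply Huv. lra.
    - apply (filterlim_filter_le_1 (F := locally 1)); [apply filter_le_within|exact Hu]. }
  assert (I1 := int01_avg (c + 1) _ d1 T1 Hc1 (Hloc _ _ E1 (proj1 HcE))).
  assert (I2 := int01_avg (c + 1) _ d2 T2 Hc1 (Hloc _ _ E2 (proj2 HcE))).
  cbv beta in I1, I2.
  assert (EE : Ez 1 = (z * CPS b z)%C).
  { unfold Ez. f_equal. f_equal. ring. }
  rewrite <- EE.
  assert (IC := is_RInt_gen_pair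
    (fun t => (Rpower t (c + 1 - 1) * PSeries d1 t, Rpower t (c + 1 - 1) * PSeries d2 t)%R)
    (at_right 0) (at_left 1) (fst (Ez 1)) (snd (Ez 1)) _ _ I1 I2).
  rewrite <- surjective_pairing in IC.
  apply (int01_eq C_R_CompleteNormedModule _ _ _) with (2 := IC).
  intros t Ht.
  assert (Htz : Cmod (RtoC t * z)%C < 1) by (apply Hxz; lra).
  rewrite Hf by easy.
  assert (Hat : Rabs t < 1) by (rewrite Rabs_pos_eq; lra).
  assert (F1 : fst (CPS a (RtoC t * z)) = t * PSeries d1 t).
  { rewrite Re_CPS_ray, PSeries_decr_1.
    - rewrite Ha0. unfold PS_decr_1, d1. rewrite Cmult_0_l. simpl fst. apply Rplus_0_l.
    - apply tame_ex_pseries; [|easy].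
      apply (tame_fst (fun n => a n * z ^ n)%C). apply ctame_ray; [easy|lra]. }
  assert (F2 : snd (CPS a (RtoC t * z)) = t * PSeries d2 t).
  { rewrite Im_CPS_ray, PSeries_decr_1.
    - rewrite Ha0. unfold PS_decr_1, d2. rewrite Cmult_0_l. simpl snd. apply Rplus_0_l.
    - apply tame_ex_pseries; [|easy].
      apply (tame_snd (fun n => a n * z ^ n)%C). apply ctame_ray; [easy|lra]. }
  replace (c + 1 - 1) with c by ring.
  rewrite (Rpower_pred c t) by lra.
  rewrite (surjective_pairing (CPS a (RtoC t * z))), F1, F2.
  unfold Cmult, RtoC; simpl. f_equal; ring.
Qed.

(** * Starlikeness from convolution *)

(** Choosing [w] against the argument of [d * (N - D)] turns the hypothesis
    into [|N - D| < Re (d * (N + D)) <= |N + D|], that is, [Re (N / D) > 0];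
    [w = -1] excludes [D = 0]. *)
Lemma half_plane_ratio (d N D : C) :
  Cmod d = 1 ->
  (forall w, Cmod w = 1 ->
     0 < fst (d * ((1 + w) / RtoC 2 * N + (1 - w) / RtoC 2 * D))%C) ->
  D <> RtoC 0 /\ 0 < Re (N / D)%C.
Proof.
  intros Hd H.
  assert (H2 : RtoC 2 <> RtoC 0) by (apply RtoC_neq_0; lra).
  assert (HD : D <> RtoC 0).
  { intros E. specialize (H (- (1))%C). rewrite Cmod_m1 in H. specialize (H eq_refl).
    replace (d * ((1 + - (1)) / RtoC 2 * N + (1 - - (1)) / RtoC 2 * D))%C with (d * D)%C in H
      by (field; easy).
    rewrite E, Cmult_0_r in H. simpl in H. lra. }
  split; [exact HD|].
  destruct (Cmod_unit (d * (N - D))%C) as [k [Hk Ek]].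
  specialize (H (- k)%C). rewrite Cmod_opp in H. specialize (H Hk).
  replace (d * ((1 + - k) / RtoC 2 * N + (1 - - k) / RtoC 2 * D))%C
    with (RtoC (/ 2) * (d * (N + D) - k * (d * (N - D))))%C in H.
  2:{ rewrite RtoC_inv by lra. now field. }
  rewrite Ek in H.
  assert (Hlt : Cmod (N - D)%C < Cmod (N + D)%C).
  { rewrite Cmod_mult, Hd, Rmult_1_l in H.
    assert (L := fst_le_Cmod (d * (N + D))%C).
    rewrite Cmod_mult, Hd, Rmult_1_l in L.
    assert (L2 := Rle_abs (fst (d * (N + D))%C)).
    set (X := (d * (N + D))%C) in *.
    change (0 < / 2 * (fst X + - Cmod (N - D)%C) - 0 * (snd X + - 0)) in H. lra. }
  assert (Hsq : Cmod (N - D)%C ^ 2 < Cmod (N + D)%C ^ 2).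
  { assert (P := Cmod_ge_0 (N - D)%C). simpl. nra. }
  rewrite !Cmod2_alt in Hsq.
  destruct N as [n1 n2], D as [e1 e2]. unfold Re, Im in *. simpl in *.
  assert (Hpos : 0 < e1 * e1 + e2 * e2).
  { destruct (Req_dec e1 0) as [Z1|Z1].
    - destruct (Req_dec e2 0) as [Z2|Z2]; [|nra].
      exfalso. apply HD. rewrite Z1, Z2. reflexivity.
    - nra. }
  replace (n1 * (e1 / (e1 * (e1 * 1) + e2 * (e2 * 1))) - n2 * (- e2 / (e1 * (e1 * 1) + e2 * (e2 * 1))))
    with ((n1 * e1 + n2 * e2) / (e1 * e1 + e2 * e2)) by (field; lra).
  apply Rdiv_lt_0_compat; [lra|easy].
Qed.

Lemma ctame_INR (a : nat -> C) : ctame a -> ctame (fun n => RtoC (INR n) * a n)%C.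
Proof.
  intros Ha. apply ctame_dom with (1 := Ha) (K := 1). intros n.
  rewrite Cmod_mult, Cmod_R, Rabs_pos_eq by apply pos_INR.
  apply Rmult_le_compat_r; [apply Cmod_ge_0|]. rewrite S_INR. lra.
Qed.

Lemma CPS_dcoef_mult (a : nat -> C) (z : C) :
  ctame a -> Cmod z < 1 ->
  (z * CPS (C_dcoef a) z)%C = CPS (fun n => RtoC (INR n) * a n)%C z.
Proof.
  intros Ha Hz. rewrite (CPS_S (fun n => RtoC (INR n) * a n)%C).
  - simpl (INR 0). unfold C_dcoef. ring.
  - now apply ctame_INR.
  - easy.
Qed.

(** The differential operator of the class acts on the coefficient of
    [z^(m+1)] as [1 - alpha + 2 gamma + (alpha - 2 gamma)(m+1) + gamma m (m+1)],
    and the relations between the parameters factor this polynomial. *)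
Lemma class_W_series (beta alpha gamma mu nu : R) (f : C -> C) (a : nat -> C) (z : C) :
  mu + nu = alpha - gamma -> mu * nu = gamma ->
  ctame a -> a 0%nat = RtoC 0 -> (forall w, Cmod w < 1 -> f w = CPS a w) -> Cmod z < 1 ->
  (RtoC (1 - alpha + 2 * gamma) * div_id f z
             + RtoC (alpha - 2 * gamma) * C_derive f z
             + RtoC gamma * z * C_derive (C_derive f) z)%C
  = CPS (fun m => RtoC ((1 + mu * INR m) * (1 + nu * INR m)) * a (S m))%C z.
Proof.
  intros Hs Hp Ha Ha0 Hf Hz.
  assert (Td := ctame_dcoef a Ha). assert (TS := ctame_S a Ha).
  assert (E1 : forall w, Cmod w < 1 -> C_derive f w = CPS (C_dcoef a) w).
  { intros w Hw. now apply C_derive_CPS. }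
  assert (E2 : C_derive (C_derive f) z = CPS (C_dcoef (C_dcoef a)) z) by now apply C_derive_CPS.
  assert (E0 : div_id f z = CPS (fun m => a (S m)) z).
  { unfold div_id. destruct (Ceq_dec z 0) as [E|E].
    - rewrite E, E1 by (rewrite Cmod_0; lra). rewrite !CPS_0 by easy.
      unfold C_dcoef. simpl. ring.
    - rewrite Hf, CPS_S, Ha0 by easy. now field. }
  rewrite E0, E1, E2 by easy.
  rewrite <- Cmult_assoc, CPS_dcoef_mult by easy.
  assert (TI := ctame_INR _ Td).
  rewrite <- !CPS_scal by easy.
  rewrite <- CPS_plus by (easy || now apply ctame_scal).
  rewrite <- CPS_plus by (easy || (try apply ctame_plus; now apply ctame_scal)).
  apply CPS_ext. intros m. unfold C_dcoef. rewrite S_INR.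
  replace alpha with (mu + nu + mu * nu) by lra. rewrite <- Hp.
  rewrite !RtoC_plus, !RtoC_minus, !RtoC_mult, !RtoC_plus, !RtoC_mult. ring.
Qed.

Theorem theorem3p1
  (alpha gamma xi mu nu c beta : R) (g q : R -> R) (f : C -> C)
  (Halpha : 0 <= alpha) (Hgamma : 0 < gamma) (Hxi : 0 <= xi <= 1)
  (Hmu : 1 <= mu) (Hmunu : mu <= nu)
  (Hsum : mu + nu = alpha - gamma) (Hprod : mu * nu = gamma)
  (Hg : is_g mu nu g) (Hq : is_q mu nu q)
  (Hc : -1 < c
        <= Rmin (1 + 1 / mu - 1 / nu) ((1 + 1 / mu - xi) / (1 + 2 * xi)))
  (Hbeta1 : beta < 1)
  (Hbeta : beta / (1 - beta)
           = - (1 + c) * int01 (fun t => Rpower t c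
                * ((1 - xi) * g t + xi * (2 * q t - 1))))
  (Hf : class_W beta alpha gamma f) :
  class_M xi (V_op c f).
Proof.
  destruct Hc as [Hc1 Hc2].
  assert (Hc3 : c <= (1 + 1 / mu - xi) / (1 + 2 * xi)).
  { apply Rle_trans with (1 := Hc2), Rmin_r. }
  destruct Hf as [[Hdiff [Hf0 Hf1]] [phi HW]].
  destruct (taylor f Hdiff) as [a [Ta Ea]].
  assert (H00 : Cmod 0 < 1) by (rewrite Cmod_0; lra).
  assert (Ha0 : a 0%nat = RtoC 0).
  { rewrite <- (CPS_0 a Ta), <- Ea by easy. exact Hf0. }
  assert (Ha1 : a 1%nat = RtoC 1).
  { rewrite (C_derive_CPS f a 0 Ta Ea H00), CPS_0 in Hf1 by now apply ctame_dcoef.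
    unfold C_dcoef in Hf1. simpl in Hf1. rewrite Cmult_1_l in Hf1. exact Hf1. }
  set (b := weight mu nu xi c).
  (* [kappa] is the Koebe value at [-1], and [beta] is normalized so that
     [1 / (1 - beta)] is the mass [2 - 2 * kappa] of the convolution kernel. *)
  destruct (decr_lim_left_1 (koebe mu nu xi c)) as [kappa [Hk1 Hk2]].
  { intros x y Hx Hxy Hy. apply koebe_decr; lra. }
  { intros x Hx. apply koebe_nonneg; lra. }
  assert (Hint := int01_gq mu nu xi c kappa g q ltac:(lra) ltac:(lra) ltac:(lra) Hc1 Hg Hq Hk1).
  assert (Hbk : (1 - beta) * (2 - 2 * kappa) = 1).
  { assert (E : beta / (1 - beta) = 1 - 2 * kappa).
    { rewrite Hbeta. rewrite Ropp_mult_distr_l_reverse.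
      change (- ((1 + c) * int01 (V := R_CompleteNormedModule) (fun t => Rpower t c
                * ((1 - xi) * g t + xi * (2 * q t - 1)))) = 1 - 2 * kappa).
      rewrite Hint. ring. }
    assert (E2 : beta = (1 - 2 * kappa) * (1 - beta)).
    { rewrite <- E. field. lra. }
    lra. }
  assert (Hkap : kappa < 1) by nra.
  (* [p] expands the function that the class maps into a half plane; the
     constant [beta] is kept as a series supported at [0]. *)
  set (pc := fun m => (RtoC ((1 + mu * INR m) * (1 + nu * INR m)) * a (S m))%C).
  assert (Tpc : ctame pc).
  { assert (TI := ctame_INR _ (ctame_S _ Ta)).
    assert (TII := ctame_INR _ TI).
    apply ctame_le with (fun m => (RtoC 1 * a (S m) + RtoC (mu + nu) * (RtoC (INR m) * a (S m)))
        + RtoC (mu * nu) * (RtoC (INR m) * (RtoC (INR m) * a (S m))))%C.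
    - apply ctame_plus; [apply ctame_plus|]; apply ctame_scal; auto. now apply ctame_S.
    - intros m. right. f_equal. unfold pc.
      rewrite !RtoC_mult, !RtoC_plus, !RtoC_mult. ring. }
  set (cst := fun m : nat => match m with 0%nat => RtoC beta | S _ => RtoC 0 end).
  assert (Ecst : forall u w, CPS (fun m => cst m * u m)%C w = (RtoC beta * u 0%nat)%C).
  { intros u w. unfold CPS. rewrite (Csum_single _ 0).
    - simpl. ring.
    - intros [|n] Hn; [easy|]. simpl. ring. }
  assert (Tcst : forall u, ctame (fun m => cst m * u m)%C).
  { intros u r Hr. exists (Rabs (Cmod (RtoC beta * u 0%nat))). intros [|n]; simpl.
    - lra.
    - rewrite Cmult_0_l, Cmod_0, Rabs_R0, Rmult_0_l. apply Rabs_pos. }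
  set (p := fun m => (pc m + (-1) * (cst m * RtoC 1))%C).
  assert (Tp : ctame p).
  { apply ctame_plus; [easy|]. apply ctame_scal. apply (Tcst (fun _ => RtoC 1)). }
  assert (Hp : forall w, Cmod w < 1 -> 0 < fst (Cexpi phi * CPS p w)%C).
  { intros w Hw. specialize (HW w Hw). unfold Re in HW.
    rewrite (class_W_series beta alpha gamma mu nu f a w Hsum Hprod Ta Ha0 Ea Hw) in HW.
    unfold p. rewrite CPS_plus, CPS_scal, (Ecst (fun _ => RtoC 1)); auto.
    - replace (CPS pc w + (-1) * (RtoC beta * RtoC 1))%C with (CPS pc w - RtoC beta)%C by ring.
      exact HW.
    - apply ctame_scal. apply (Tcst (fun _ => RtoC 1)). }
  assert (Hp0 : p 0%nat = RtoC (1 - beta)).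
  { unfold p, pc, cst. rewrite Ha1. simpl INR. rewrite !Rmult_0_r, !Rplus_0_r, Rmult_1_r.
    rewrite RtoC_minus. ring. }
  set (N := CPS (fun m => RtoC (b m) * (RtoC (INR (S m)) * pc m))%C).
  set (D := CPS (fun m => RtoC (b m) * pc m)%C).
  assert (TD : ctame (fun m => RtoC (b m) * pc m)%C) by (apply ctame_weight; try lra; easy).
  assert (TSp : ctame (fun m => RtoC (INR (S m)) * pc m)%C).
  { apply ctame_dom with (1 := Tpc) (K := 1). intros m.
    rewrite Cmod_mult, Cmod_R, Rabs_pos_eq by apply pos_INR. lra. }
  assert (TN : ctame (fun m => RtoC (b m) * (RtoC (INR (S m)) * pc m))%C)
    by (apply ctame_weight; try lra; easy).
  (* The constant terms of the convolution add up to the missing part of [N]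
     and [D], because [(1 - 2 * kappa) * (1 - beta) = beta]. *)
  assert (Hratio : forall z, Cmod z < 1 -> D z <> RtoC 0 /\ 0 < Re (N z / D z)%C).
  { intros z Hz. apply half_plane_ratio with (Cexpi phi); [apply Cmod_Cexpi|].
    intros w Hw.
    set (h := fun m => (RtoC (b m) * (1 + (1 + w) / RtoC 2 * RtoC (INR m)))%C).
    assert (Th : ctame h).
    { apply ctame_weight; try lra. apply ctame_excess. }
    assert (Hh0 : h 0%nat = RtoC 1).
    { unfold h, b. rewrite weight_0 by easy. simpl INR. ring. }
    assert (Hhk : forall v, Cmod v < 1 -> kappa <= fst (CPS h v)).
    { intros v Hv.
      apply Rle_trans with (koebe mu nu xi c (Cmod v)).
      2:{ apply Re_weighted_ge_koebe; easy || lra. }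
      assert (Hv0 := Cmod_ge_0 v).
      destruct (Rle_lt_or_eq_dec _ _ Hv0) as [Hv1|Hv1]; [apply Hk2; lra|].
      rewrite <- Hv1. unfold koebe. rewrite PSeries_0. simpl.
      fold b. unfold b. rewrite weight_0 by easy. lra. }
    assert (HC := convolution_half_plane p h kappa (Cexpi phi) z Tp Th Hh0 Hkap Hhk Hp Hz).
    replace ((1 + w) / RtoC 2 * N z + (1 - w) / RtoC 2 * D z)%C
      with (CPS (fun m => p m * h m) z + RtoC (1 - 2 * kappa) * p 0%nat)%C; [exact HC|].
    rewrite Hp0.
    assert (Eb : (RtoC (1 - 2 * kappa) * RtoC (1 - beta))%C = RtoC beta).
    { rewrite <- RtoC_mult. f_equal. lra. }
    rewrite Eb.
    assert (Tph : ctame (fun m => (1 + w) / RtoC 2 * (RtoC (b m) * (RtoC (INR (S m)) * pc m))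
         + (1 - w) / RtoC 2 * (RtoC (b m) * pc m))%C).
    { apply ctame_plus; now apply ctame_scal. }
    rewrite (CPS_ext _ (fun m => ((1 + w) / RtoC 2 * (RtoC (b m) * (RtoC (INR (S m)) * pc m))
         + (1 - w) / RtoC 2 * (RtoC (b m) * pc m)) + (-1) * (cst m * h m))%C).
    - rewrite CPS_plus, CPS_plus, !CPS_scal, Ecst, Hh0; auto using ctame_scal.
      fold N. fold D. ring.
    - intros m. unfold p, h. rewrite S_INR, RtoC_plus.
      field. }
  (* Both terms of the Pascu quotient of the image of [f] are divisible by
     the variable, with quotients [N] and [D]. *)
  set (v := V_coef c a).
  assert (Tv : ctame v) by now apply ctame_V_coef_all.
  assert (Ev : forall z, Cmod z < 1 -> V_op c f z = CPS v z).
  { intros z Hz. now apply V_op_series. }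
  set (u := fun n => (RtoC (INR n) * v n)%C).
  assert (Tu : ctame u) by now apply ctame_INR.
  assert (Edv : forall z, Cmod z < 1 -> C_derive (V_op c f) z = CPS (C_dcoef v) z).
  { intros z Hz. now apply C_derive_CPS. }
  assert (Edu : forall z, Cmod z < 1 -> (z * C_derive (V_op c f) z)%C = CPS u z).
  { intros z Hz. rewrite Edv by easy. now apply CPS_dcoef_mult. }
  assert (Hbv : forall m, (RtoC (b m) * pc m)%C = (RtoC (1 + xi * INR m) * v (S m))%C).
  { intros m. unfold pc, v, V_coef. rewrite !Cmult_assoc. f_equal.
    rewrite <- !RtoC_mult. f_equal. unfold b, weight.
    assert (Hm := pos_INR m).
    assert (Pmu := one_plus_pos mu m ltac:(lra)). assert (Pnu := one_plus_pos nu m ltac:(lra)).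
    field. repeat split; lra. }
  assert (Hden : forall z, Cmod z < 1 -> pascu_den xi (V_op c f) z = (z * D z)%C).
  { intros z Hz. unfold pascu_den. rewrite Ev, Edv by easy.
    rewrite (CPS_S v z Tv Hz). simpl (v 0%nat).
    unfold D. rewrite (CPS_ext (fun m => RtoC (b m) * pc m)%C
      (fun m => RtoC xi * C_dcoef v m + RtoC (1 - xi) * v (S m))%C).
    - rewrite CPS_plus, !CPS_scal; auto using ctame_scal, ctame_dcoef, ctame_S. ring.
    - intros m. rewrite Hbv. unfold C_dcoef.
      rewrite S_INR, RtoC_minus, !RtoC_plus, RtoC_mult. ring. }
  assert (Hnum : forall z, Cmod z < 1 -> pascu_num xi (V_op c f) z = (z * N z)%C).
  { intros z Hz. unfold pascu_num.
    rewrite (C_derive_CPS _ u z Tu Edu Hz), Edv by easy.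
    unfold N. rewrite (CPS_ext (fun m => RtoC (b m) * (RtoC (INR (S m)) * pc m))%C
      (fun m => RtoC xi * C_dcoef u m + RtoC (1 - xi) * C_dcoef v m)%C).
    - rewrite CPS_plus, !CPS_scal; auto using ctame_scal, ctame_dcoef. ring.
    - intros m.
      replace (RtoC (b m) * (RtoC (INR (S m)) * pc m))%C
        with (RtoC (INR (S m)) * (RtoC (b m) * pc m))%C by ring.
      rewrite Hbv. unfold C_dcoef, u.
      rewrite S_INR, RtoC_minus, !RtoC_plus, RtoC_mult. ring. }
  split; [split; [|split]|].
  - intros z Hz. exists (CPS (C_dcoef v) z).
    apply C_is_derive_ext_disk with (CPS v); auto.
    + intros w Hw. symmetry. auto.
    + now apply CPS_is_derive.
  - rewrite Ev by easy. now rewrite CPS_0.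
  - rewrite Edv by easy. rewrite CPS_0 by now apply ctame_dcoef.
    unfold C_dcoef, v, V_coef. rewrite Ha1. simpl INR. rewrite Rplus_0_r.
    replace ((1 + c) / (1 + c)) with 1 by (field; lra). ring.
  - intros z Hz Hz0. destruct (Hratio z Hz) as [R1 R2].
    rewrite Hden, Hnum by easy. split.
    + now apply Cmult_neq_0.
    + replace (z * N z / (z * D z))%C with (N z / D z)%C by (field; now split). exact R2.
Qed.
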